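(* Suppose that $\mathbb{Q}$ is a forcing poset with greatest lower bounds such that for every condition $p\in\mathbb{Q}$ there are stationarily many $N\in P_{\omega_1}(H(\lambda_{\mathbb{Q}}))$ such that $p\in N$ and there exists a strongly $(N,\mathbb{Q})$-generic condition extending $p$. Let $\mathbb{P}$ be a regular suborder of $\mathbb{Q}$ satisfying property $*(\mathbb{P},\mathbb{Q})$. Then $\mathbb{P}$ forces that $\mathbb{Q}/\dot G_{\mathbb{P}}$ is non-diagonally strongly proper. In particular, $\mathbb{P}$ forces that $\mathbb{Q}/\dot G_{\mathbb{P}}$ has the $\omega_1$-approximation property.
   Context: A forcing poset has greatest lower bounds if any two compatible conditions $p,q$ have a greatest lower bound $p\wedge q$. $\lambda_{\mathbb{Q}}$ is the least uncountable cardinal $\lambda$ with $\mathbb{Q}\subseteq H(\lambda)$. For a set $N$, $q\in\mathbb{Q}$ is strongly $(N,\mathbb{Q})$-generic if every set dense in the poset $N\cap\mathbb{Q}$ (induced order) is predense in $\mathbb{Q}$ below $q$. A suborder $\mathbb{P}\subseteq\mathbb{Q}$ is a regular suborder if any $p,q\in\mathbb{P}$ compatible in $\mathbb{Q}$ are compatible in $\mathbb{P}$, and every maximal antichain of $\mathbb{P}$ is maximal in $\mathbb{Q}$. $\mathbb{Q}/\dot G_{\mathbb{P}}$ is the $\mathbb{P}$-name for the set of $q\in\mathbb{Q}$ compatible with every member of $\dot G_{\mathbb{P}}$, ordered as in $\mathbb{Q}$. Property $*(\mathbb{P},\mathbb{Q})$: for all $x\in\mathbb{P}$ and $y,z\in\mathbb{Q}$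 pairwise compatible, $x$ is compatible with $y\wedge z$. A forcing poset $\mathbb{R}$ is non-diagonally strongly proper if for every $p\in\mathbb{R}$ there are stationarily many $N\in P_{\omega_1}(H(\lambda_{\mathbb{R}}))$ with $p\in N$ for which there is $q\leq p$ that is strongly $(N,\mathbb{R})$-generic. $\mathbb{R}$ has the $\omega_1$-approximation property if $\mathbb{R}$ forces: whenever $X\subseteq V$ satisfies $N\cap X\in V$ for every set $N$ countable in $V$, then $X\in V$. *)

(* Defs.v *)
(** [ZF] is Aczel's type of well-founded sets.  With excluded middle and choice
    in the metatheory it is a model of ZFC, and it plays the role of the
    universe [V].  Sets are compared by extensional equality [seteq], not by
    Leibniz equality. *)

Inductive ZF : Type := mkset (A : Type) (f : A -> ZF).

Fixpoint seteq (x y : ZF) : Prop :=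
  match x, y with
  | mkset A f, mkset B g =>
      (forall a, exists b, seteq (f a) (g b)) /\
      (forall b, exists a, seteq (f a) (g b))
  end.

Definition setin (x y : ZF) : Prop :=
  match y with mkset B g => exists b, seteq x (g b) end.

(** Formulas are written in higher-order abstract syntax over a type [X] of
    variables, so that one and the same formula can be evaluated in the
    universe ([holds]) or relativised to a forcing relation ([force]).

    [Ground x] says that [x] belongs to the ground model; it only has content
    inside a forcing relation. *)

Inductive fm (X : Type) : Type :=
| In (x y : X)
| Eq (x y : X)
| Ground (x : X)
| Not (a : fm X)
| And (a b : fm X)
| All (f : X -> fm X).

Arguments In {X} x y.
Arguments Eq {X} x y.
Arguments Ground {X} x.
Arguments Not {X} a.
Arguments And {X} a b.
Arguments All {X} f.

Definition Or {X} (a b : fm X) : fm X := Not (And (Not a) (Not b)).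
Definition Imp {X} (a b : fm X) : fm X := Not (And a (Not b)).
Definition Iff {X} (a b : fm X) : fm X := And (Imp a b) (Imp b a).
Definition Ex {X} (f : X -> fm X) : fm X := Not (All (fun x => Not (f x))).

Declare Scope fm_scope.
Delimit Scope fm_scope with fm.
Bind Scope fm_scope with fm.
Local Open Scope fm_scope.

Notation "x ∈ y" := (In x y) (at level 70, no associativity) : fm_scope.
Notation "x ≐ y" := (Eq x y) (at level 70, no associativity) : fm_scope.
Notation "¬ a" := (Not a) (at level 75, right associativity) : fm_scope.
Notation "a ∧ b" := (And a b) (at level 80, right associativity) : fm_scope.
Notation "a ∨ b" := (Or a b) (at level 85, right associativity) : fm_scope.
Notation "a ⇔ b" := (Iff a b) (at level 95, no associativity) : fm_scope.
Notation "a ⇒ b" := (Imp a b) (at level 99, right associativity, b at level 200) : fm_scope.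
Notation "∀ x , a" := (All (fun x => a))
  (at level 200, x name, a at level 200, right associativity) : fm_scope.
Notation "∃ x , a" := (Ex (fun x => a))
  (at level 200, x name, a at level 200, right associativity) : fm_scope.
Notation "∀ x ∈ s , a" := (All (fun x => Imp (In x s) a))
  (at level 200, x name, s at level 69, a at level 200, right associativity) : fm_scope.
Notation "∃ x ∈ s , a" := (Ex (fun x => And (In x s) a))
  (at level 200, x name, s at level 69, a at level 200, right associativity) : fm_scope.

(** Truth in the universe, which is its own ground model. *)
Fixpoint holds (a : fm ZF) : Prop :=
  match a with
  | In x y => setin x y
  | Eq x y => seteq x y
  | Ground _ => True
  | Not a => ~ holds a
  | And a b => holds a /\ holds b
  | All f => forall x, holds (f x)
  end.

Section Formulas.
Context {X : Type}.
Implicit Types (x y z a b c d e f g h k l m n p q r s t u v w : X).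

Definition sub x y : fm X := ∀ z ∈ x, z ∈ y.

Definition isPair u x y : fm X := ∀ z, z ∈ u ⇔ (z ≐ x ∨ z ≐ y).

Definition isOPair u x y : fm X :=
  ∃ a, ∃ b, isPair a x x ∧ isPair b x y ∧ isPair u a b.

(** [(x, y) ∈ r] *)
Definition pairIn x y r : fm X := ∃ u, isOPair u x y ∧ u ∈ r.

(** [(x, (y, z)) ∈ r] *)
Definition tripleIn x y z r : fm X := ∃ u, isOPair u y z ∧ pairIn x u r.

Definition isInjection f a b : fm X :=
  (∀ u ∈ f, ∃ x ∈ a, ∃ y ∈ b, isOPair u x y) ∧
  (∀ x ∈ a, ∃ y ∈ b, pairIn x y f ∧ (∀ z, pairIn x z f ⇒ z ≐ y)) ∧
  (∀ x, ∀ y, ∀ z, pairIn x z f ⇒ pairIn y z f ⇒ x ≐ y).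

Definition cardLe a b : fm X := ∃ f, isInjection f a b.
Definition cardLt a b : fm X := cardLe a b ∧ ¬ cardLe b a.

Definition transitive t : fm X := ∀ x ∈ t, sub x t.
Definition ordinal a : fm X := transitive a ∧ ∀ x ∈ a, transitive x.
Definition cardinal k : fm X := ordinal k ∧ ∀ a ∈ k, ¬ cardLe k a.

Definition isEmpty x : fm X := ∀ z, ¬ z ∈ x.
Definition isSucc m k : fm X := ∀ z, z ∈ m ⇔ (z ∈ k ∨ z ≐ k).
Definition isNat n : fm X :=
  ordinal n ∧ ∀ m, (m ∈ n ∨ m ≐ n) ⇒ (isEmpty m ∨ ∃ k, isSucc m k).
Definition isOmega w : fm X := ∀ n, n ∈ w ⇔ isNat n.

Definition countable a : fm X := ∃ w, isOmega w ∧ cardLe a w.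

Definition isTrcl t x : fm X :=
  transitive t ∧ sub x t ∧ ∀ s, transitive s ⇒ sub x s ⇒ sub t s.

(** [x ∈ H(k)], and [h = H(k)] *)
Definition inH k x : fm X := ∃ t, isTrcl t x ∧ cardLt t k.
Definition isH h k : fm X := ∀ x, x ∈ h ⇔ inH k x.

(** [n ∈ P_ω1(h)] *)
Definition inPω1 h n : fm X := sub n h ∧ countable n.

Definition isUnion u d : fm X := ∀ z, z ∈ u ⇔ ∃ n ∈ d, z ∈ n.

Definition isChain d : fm X := ∀ m ∈ d, ∀ n ∈ d, sub m n ∨ sub n m.

(** [c] is club in [P_ω1(h)]; closure is stated for unions of nonempty
    countable ⊆-chains of members of [c]. *)
Definition isClub c h : fm X :=
  (∀ n ∈ c, inPω1 h n) ∧
  (∀ m, inPω1 h m ⇒ ∃ n ∈ c, sub m n) ∧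
  (∀ d, sub d c ⇒ ¬ isEmpty d ⇒ countable d ⇒ isChain d ⇒
     ∀ u, isUnion u d ⇒ u ∈ c).

Definition stationarilyMany h (S : X -> fm X) : fm X :=
  ∀ c, isClub c h ⇒ ∃ n ∈ c, S n.

(** A forcing poset is a set [R] with a set [le] of ordered pairs coding the
    order.  Only the trace of [le] on [R] matters, so a suborder carries the
    same [le].  Antisymmetry and a largest condition are not required. *)

Definition forcingPoset R le : fm X :=
  ¬ isEmpty R ∧
  (∀ p ∈ R, pairIn p p le) ∧
  (∀ p ∈ R, ∀ q ∈ R, ∀ r ∈ R, pairIn p q le ⇒ pairIn q r le ⇒ pairIn p r le).

Definition compatible R le p q : fm X :=
  ∃ r ∈ R, pairIn r p le ∧ pairIn r q le.

Definition isGlb R le r p q : fm X :=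
  r ∈ R ∧ pairIn r p le ∧ pairIn r q le ∧
  ∀ s ∈ R, pairIn s p le ⇒ pairIn s q le ⇒ pairIn s r le.

Definition hasGlbs R le : fm X :=
  ∀ p ∈ R, ∀ q ∈ R, compatible R le p q ⇒ ∃ r, isGlb R le r p q.

(** [d] is dense in the poset [n ∩ R] *)
Definition denseInTrace d n R le : fm X :=
  (∀ x ∈ d, x ∈ n ∧ x ∈ R) ∧
  (∀ p ∈ R, p ∈ n ⇒ ∃ x ∈ d, pairIn x p le).

Definition predenseBelow d q R le : fm X :=
  ∀ r ∈ R, pairIn r q le ⇒ ∃ x ∈ d, compatible R le x r.

Definition stronglyGeneric q n R le : fm X :=
  q ∈ R ∧ ∀ d, denseInTrace d n R le ⇒ predenseBelow d q R le.

Definition antichain a R le : fm X :=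
  sub a R ∧ ∀ p ∈ a, ∀ q ∈ a, ¬ p ≐ q ⇒ ¬ compatible R le p q.

Definition maximalAntichain a R le : fm X :=
  antichain a R le ∧ ∀ b, antichain b R le ⇒ sub a b ⇒ sub b a.

Definition regularSuborder P Q le : fm X :=
  sub P Q ∧
  (∀ p ∈ P, ∀ q ∈ P, compatible Q le p q ⇒ compatible P le p q) ∧
  (∀ a, maximalAntichain a P le ⇒ maximalAntichain a Q le).

Definition starProperty P Q le : fm X :=
  ∀ x ∈ P, ∀ y ∈ Q, ∀ z ∈ Q,
    compatible Q le x y ⇒ compatible Q le x z ⇒ compatible Q le y z ⇒
    ∀ w, isGlb Q le w y z ⇒ compatible Q le x w.

Definition uncountableCardinalOver R l : fm X :=
  cardinal l ∧ ¬ countable l ∧ ∀ x ∈ R, inH l x.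

(** [l = λ_R] *)
Definition isLambda l R : fm X :=
  uncountableCardinalOver R l ∧
  ∀ k, uncountableCardinalOver R k ⇒ (l ∈ k ∨ l ≐ k).

Definition nonDiagStronglyProper R le : fm X :=
  forcingPoset R le ∧
  ∃ l, ∃ h, isLambda l R ∧ isH h l ∧
  ∀ p ∈ R, stationarilyMany h (fun n =>
    inPω1 h n ∧ p ∈ n ∧ ∃ q ∈ R, pairIn q p le ∧ stronglyGeneric q n R le).

(** Every set is an [R]-name; only its elements of the form [(z, r)] with
    [r ∈ R] are taken into account. *)

(** [c] is the canonical name [{(check z, r) : z ∈ x, r ∈ R}] of [x].  The
    recursion is witnessed by its restriction [f] to a transitive set [t]. *)
Definition isCheck R x c : fm X :=
  ∃ t, ∃ f, transitive t ∧ x ∈ t ∧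
    (∀ y ∈ t, ∃ d, pairIn y d f) ∧
    (∀ y, ∀ d, pairIn y d f ⇒
       y ∈ t ∧
       ∀ u, u ∈ d ⇔ ∃ z ∈ y, ∃ e, ∃ r ∈ R, pairIn z e f ∧ isOPair u e r) ∧
    pairIn x c f.

(** [g = {(check p, p) : p ∈ R}] *)
Definition isGenericName R g : fm X :=
  ∀ u, u ∈ g ⇔ ∃ p ∈ R, ∃ c, isCheck R p c ∧ isOPair u c p.

(** [p ⊩ z ∈ b], given the forcing relation [E] for equality *)
Definition memClause R le (E : X -> X -> X -> fm X) p z b : fm X :=
  ∀ q ∈ R, pairIn q p le ⇒ ∃ s ∈ R, pairIn s q le ∧
    ∃ y, ∃ r ∈ R, pairIn y r b ∧ pairIn s r le ∧ E s z y.

(** [p ⊩ a ⊆ b], given the forcing relation [E] for equality *)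
Definition subClause R le (E : X -> X -> X -> fm X) p a b : fm X :=
  ∀ z, ∀ r ∈ R, pairIn z r a ⇒
    ∀ q ∈ R, pairIn q p le ⇒ pairIn q r le ⇒ memClause R le E q z b.

(** [p ⊩ a = b].  The recursion is witnessed by its restriction [e] to the
    names in a transitive set [t]. *)
Definition forceEq R le p a b : fm X :=
  ∃ t, ∃ e, transitive t ∧ a ∈ t ∧ b ∈ t ∧
    (∀ q ∈ R, ∀ x ∈ t, ∀ y ∈ t,
       tripleIn q x y e ⇔
         (subClause R le (fun s z w => tripleIn s z w e) q x y ∧
          subClause R le (fun s z w => tripleIn s z w e) q y x)) ∧
    tripleIn p a b e.

Definition forceIn R le p a b : fm X := memClause R le (forceEq R le) p a b.

Definition forceGround R le p a : fm X :=
  ∀ q ∈ R, pairIn q p le ⇒ ∃ s ∈ R, pairIn s q le ∧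
    ∃ x, ∃ c, isCheck R x c ∧ forceEq R le s a c.

(** [force R le p φ] is the formula "[p ⊩ φ]"; the parameters of [φ], and the
    values of its bound variables, are read as [R]-names. *)
Fixpoint force R le p (φ : fm X) {struct φ} : fm X :=
  match φ with
  | In a b => forceIn R le p a b
  | Eq a b => forceEq R le p a b
  | Ground a => forceGround R le p a
  | Not ψ => ∀ q ∈ R, pairIn q p le ⇒ ¬ force R le q ψ
  | And ψ χ => force R le p ψ ∧ force R le p χ
  | All F => ∀ x, force R le p (F x)
  end.

Definition forced R le (φ : fm X) : fm X := ∀ p ∈ R, force R le p φ.

(** Inside [force R le p], [Ground] is the universe over which [R] forces:
    [V] at the top level, [V[G_P]] when [R] is the quotient [Q/G_P]. *)
Definition countableInGround n : fm X :=
  Ground n ∧ ∃ w, isOmega w ∧ ∃ f, Ground f ∧ isInjection f n w.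

Definition approximatedInGround : fm X :=
  ∀ x,
    (∀ z ∈ x, Ground z) ⇒
    (∀ n, countableInGround n ⇒
       ∃ y, Ground y ∧ ∀ z, z ∈ y ⇔ (z ∈ n ∧ z ∈ x)) ⇒
    Ground x.

Definition ω1Approximation R le : fm X := forced R le approximatedInGround.

(** [R = Q/G], the set of [q ∈ Q] compatible with every member of [G] *)
Definition isQuotient R Q le G : fm X :=
  ∀ q, q ∈ R ⇔ (q ∈ Q ∧ ∀ p ∈ G, compatible Q le q p).

(** [P] forces that [Q/G_P], with the order of [Q], satisfies [φ]. *)
Definition quotientForced P Q le (φ : X -> X -> fm X) : fm X :=
  ∃ Qc, ∃ lec, ∃ G,
    isCheck P Q Qc ∧ isCheck P le lec ∧ isGenericName P G ∧
    forced P le (∃ R, isQuotient R Qc lec G ∧ φ R lec).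

End Formulas.

(* Main.v *)
(** Let [M] be a model of ZFC, [R] a poset of [M] and [U] an ultrafilter on the
    conditions containing all dense open sets, generic or not.  The [R]-names of
    [M] modulo [U] again form a model [M[U]] of ZFC, possibly ill-founded, and
    [p ⊩ φ] holds iff [M[U] ⊨ φ] for all [U] concentrating below [p].  A poset
    that is strongly proper (non-diagonally) has the approximation property in
    every such model; applying this to [Q/G] in the extensions of [V] by [P], only
    strong properness of [Q/G] has to be shown.

    Suppose that [p0 ∈ P] forces [c] to be a club of countable subsets of [h] none
    of whose members is as required for [r ∈ Q/G].  Below [p0] and [r] there is
    [w ∈ Q]; choose [N] containing [w], and [q ≤ w] strongly [(N, Q)]-generic, such
    that [N] absorbs a countable set [MM] of names, closed under functions
    choosing meets, reductions from [Q] to [P], deciding conditions and names for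
    larger members of [c].  Let [u] name the union of a chain of members of [c]
    coming from [MM] that absorbs each of its elements, so that [u ∈ c] is forced.
    If [p2 ∈ P] is a reduction of [q], then [p2] forces [q ∈ Q/G] and also that
    [u] and [N] have the same trace on [Q/G]: an element of [u] is decided by
    conditions in [MM], by strong genericity of [q].  Finally [q] is strongly
    generic for [u] in [Q/G]: given a dense set [D] and [s ≤ q] in [Q/G], take a
    trace [v ∈ N] of a common extension of [s] and a condition of [P]; an element
    [z ≤ v] of [D] lies in [N], hence is compatible with [s], and by property [*]
    the meet of [z] and [s] is in [Q/G]. *)

Require Import Defs.
From Stdlib Require Import Classical ClassicalEpsilon FunctionalExtensionality
  PropExtensionality Arith Cantor Setoid.
From mathcomp Require wochoice filter.
From mathcomp Require Import ssreflect.
Local Close Scope fm_scope.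

(** * Well-orders, quotients and ultrafilters *)

(** Since [U] need not be generic, elements of the extension are decided by conditions but not by
    [U]: an element of [ck U a] need not be [ck U z] for any one [z]. So a fact seen at one [U] is
    pushed down to a condition and reread at another ultrafilter below it ([Gen_refine], [ck_all]).
    The schemas of ZFC are available in the extension for relations that have a Boolean value. This
    is the reason for the field [Def] of [Model], for the definability tactics, and for formulas
    given uniformly in the type of variables. Everything up to the approximation property is proved
    for an arbitrary [Model], so that it can be applied to [Q/G] over the extension without forming
    a two-step iteration. A further obstacle is that [H(λ)], computed for [Q/G] in the extension, is
    a different set from the one computed for [Q] in the ground model. What links each of them to
    the argument is that it contains the conditions; hence the member of the club and [N] are
    compared on conditions alone. *)

Lemma pred_ext {T : Type} (A B : T -> Prop) : (forall x, A x <-> B x) -> A = B.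
Proof. move=> H; extensionality x; apply: propositional_extensionality; exact: H. Qed.

Section WellOrdering.
Import ssrbool.

(** The library theorem provides a Boolean relation in which every nonempty set has exactly one
    least element, and [lt] is its strict part. Antisymmetry comes from uniqueness on two-element
    sets, well-foundedness from a least inaccessible point. *)
Lemma well_ordering (T : Type) : exists lt : T -> T -> Prop,
  (forall A : T -> Prop, (exists x, A x) ->
     exists x, A x /\ forall y, A y -> y = x \/ lt x y) /\
  (forall x y, lt x y -> ~ lt y x) /\ well_founded lt.
Proof.
(* Classically every type underlies an [eqType], as the library theorem requires. *)
elim/boolp.Peq: T => T0; set T := eqtype.Equality.sort T0.
have [R0 wo] := @wochoice.well_ordering_principle T0.
pose R x y := R0 x y = true.
have mn (A : T -> Prop) : (exists x, A x) ->
    exists x, (A x /\ forall y, A y -> R x y) /\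
    forall z, (A z /\ forall y, A y -> R z y) -> x = z.
  move=> [x Ax]; have [|z [[Az lz] uz]] := wo (fun x => boolp.asbool (A x)).
    by exists x; rewrite ssrbool.unfold_in; apply/boolp.asboolP.
  exists z; split; first split.
  - by move: Az; rewrite ssrbool.unfold_in => /boolp.asboolP.
  - by move=> y Ay; apply: lz; rewrite ssrbool.unfold_in; apply/boolp.asboolP.
  - move=> t [At lt]; apply: uz; split; first by rewrite ssrbool.unfold_in; apply/boolp.asboolP.
    by move=> y; rewrite ssrbool.unfold_in => /boolp.asboolP /lt.
have least (A : T -> Prop) : (exists x, A x) ->
    exists x, A x /\ forall y, A y -> y = x \/ (R x y /\ y <> x).
  move=> /mn [x [[Ax H] _]]; exists x; split=> // y Ay.
  by case: (classic (y = x)) => ?; [left | right; split=> //; apply: H].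
exists (fun x y => R x y /\ y <> x); split; [exact least | split].
- move=> x y [xy nyx] [yx _]; apply: nyx.
  have [|z [_ uz]] := mn (fun z => z = x \/ z = y); first by exists x; left.
  have refl t : R t t.
    by have [|? [[-> H] _]] := mn (fun z => z = t); [exists t | apply: H].
  transitivity z; [symmetry; apply: uz | apply: uz].
  + by split; [right | move=> ? [] ->].
  + by split; [left | move=> ? [] ->].
- move=> x; apply: NNPP => nx.
  have [|y [ny H]] := least (fun y => ~ Acc (fun x y => R x y /\ y <> x) y); first by exists x.
  apply: ny; constructor=> z [zy nyz]; apply: NNPP => nz.
  case: (H z nz) => [E|[yz nzy]]; first by apply: nyz.
  apply: nyz; have [|w [_ uw]] := mn (fun w => w = z \/ w = y); first by exists z; left.
  have refl t : R t t.
    by have [|? [[-> H'] _]] := mn (fun z => z = t); [exists t | apply: H'].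
  transitivity w; [symmetry; apply: uw | apply: uw].
  + by split; [right | move=> ? [] ->].
  + by split; [left | move=> ? [] ->].
Qed.

End WellOrdering.

(** A class is represented by the predicate [r x] itself, so that predicate extensionality and proof
    irrelevance turn an equivalence [r] into Leibniz equality. *)
Definition quot {T : Type} (r : T -> T -> Prop) : Type := {A : T -> Prop | exists x, A = r x}.
Definition cls {T : Type} (r : T -> T -> Prop) (x : T) : quot r :=
  exist _ (r x) (ex_intro _ x eq_refl).

Lemma cls_surj {T : Type} (r : T -> T -> Prop) (c : quot r) : exists x, c = cls r x.
Proof.
case: c => A [x E]; exists x; subst A; reflexivity.
Qed.

Lemma cls_eq {T : Type} (r : T -> T -> Prop) (x y : T) :
  (forall x, r x x) -> (forall x y, r x y -> r y x) ->
  (forall x y z, r x y -> r y z -> r x z) ->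
  cls r x = cls r y <-> r x y.
Proof.
move=> rr rs rt; split=> [E|rxy].
  have /(f_equal (fun f => f y)) E' : r x = r y := f_equal (@proj1_sig _ _) E.
  by rewrite E'.
have E : r x = r y.
  by apply: pred_ext => z; split; [apply: rt; apply: rs | apply: rt].
rewrite /cls; move: (ex_intro _ x _) (ex_intro _ y _); rewrite E => p q.
by rewrite (proof_irrelevance _ p q).
Qed.

Lemma ultrafilter_exists {T : Type} (F : (T -> Prop) -> Prop) :
  (forall A, F A -> exists x, A x) ->
  F (fun _ => True) ->
  (forall A B, F A -> F B -> F (fun x => A x /\ B x)) ->
  exists U : (T -> Prop) -> Prop,
    (forall A, F A -> U A) /\
    (forall A B : T -> Prop, (forall x, A x -> B x) -> U A -> U B) /\
    (forall A B, U A -> U B -> U (fun x => A x /\ B x)) /\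
    (forall A, U (fun x => ~ A x) <-> ~ U A).
Proof.
move=> Fne FT FI.
(* [F] is only assumed closed under binary intersections; its upward closure is the filter to be
   extended. *)
pose F' : (T -> Prop) -> Prop := fun A => exists B, F B /\ forall x, B x -> A x.
have PF : filter.ProperFilter F'.
  constructor.
    by move=> [B [/Fne [x Bx] H]]; exact: (H x Bx).
  constructor.
  - by exists (fun _ => True).
  - move=> A B [A' [FA HA]] [B' [FB HB]]; exists (fun x => A' x /\ B' x); split; first exact: FI.
    by move=> x [/HA ? /HB ?]; split.
  - by move=> A B AB [A' [FA HA]]; exists A'; split=> // x /HA /AB.
have [U [UU FU]] := filter.ultraFilterLemma PF.
have PU : filter.ProperFilter U by exact: (@filter.ultra_proper _ _ UU).
have FilU : filter.Filter U by case: PU.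
have UI A B : U A -> U B -> U (fun x => A x /\ B x).
  by move=> UA UB; exact: (@filter.filterI _ U FilU A B UA UB).
exists U; split; [|split; [|split]].
- by move=> A FA; apply: FU; exists A.
- move=> A B AB UA; exact: (@filter.filterS _ U FilU A B AB UA).
- exact: UI.
- move=> A; split.
  + move=> UnA UA; have [x [nAx Ax]] := @filter.filter_ex _ U PU _ (UI _ _ UnA UA).
    exact: nAx.
  + by move=> nUA; case: (filter.in_ultra_setVsetC A UU).
Qed.

(** * Formulas uniform in the type of variables *)

(** The innermost variable is [snd], and [fst] moves outwards; a tuple [(tt, a, b)] lists the oldest
    variable first. *)
Fixpoint env (X : Type) (n : nat) : Type :=
  match n with 0 => unit | S n => (env X n * X)%type end.

Fixpoint emap {X Y : Type} (f : X -> Y) {n} : env X n -> env Y n :=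
  match n with 0 => fun _ => tt | S n => fun r => (emap f (fst r), f (snd r)) end.

(** Higher-order syntax admits families that inspect [X] or their arguments. Restricting terms to
    projections of the environment, given for all [X] at once, is what makes it possible to move a
    formula to another model by induction. *)
Inductive pvar : forall n, (forall X, env X n -> X) -> Prop :=
| pvar0 n : pvar (S n) (fun X r => snd r)
| pvarS n t : pvar n t -> pvar (S n) (fun X r => t X (fst r)).

(** Formulas given uniformly in the type of variables.  The flag tells whether
    [Ground] may occur. *)
Inductive uniform (g : bool) : forall n, (forall X, env X n -> fm X) -> Prop :=
| u_In n s t : pvar n s -> pvar n t -> uniform g n (fun X r => In (s X r) (t X r))
| u_Eq n s t : pvar n s -> pvar n t -> uniform g n (fun X r => Eq (s X r) (t X r))
| u_Ground n s : g = true -> pvar n s -> uniform g n (fun X r => Ground (s X r))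
| u_Not n A : uniform g n A -> uniform g n (fun X r => Not (A X r))
| u_And n A B : uniform g n A -> uniform g n B -> uniform g n (fun X r => And (A X r) (B X r))
| u_All n A : uniform g (S n) A -> uniform g n (fun X r => All (fun x => A X (r, x))).

Ltac pv_at c e :=
  lazymatch e with
  | (fun X r => r) => exact c
  | (fun X r => fst (@?e' X r)) => pv_at uconstr:(pvarS _ _ c) e'
  end.
Ltac pv :=
  first
  [ assumption | exact (pvar0 _) | exact (pvarS _ _ (pvar0 _))
  | lazymatch goal with |- pvar _ (fun X r => snd (@?e X r)) => pv_at uconstr:(pvar0 _) e end
  | match goal with H : pvar _ ?s |- pvar _ (fun X r => ?s X (@?e X r)) => pv_at H e end ].

Create HintDb unif.
Ltac unif_lemma := fail.
Ltac unif :=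
  lazymatch goal with
  | |- pvar _ _ => pv
  | |- uniform _ _ (fun X r => In _ _) => apply u_In; pv
  | |- uniform _ _ (fun X r => Eq _ _) => apply u_Eq; pv
  | |- uniform _ _ (fun X r => Ground _) => apply u_Ground; [reflexivity | pv]
  | |- uniform _ _ (fun X r => Not _) => apply u_Not; unif
  | |- uniform _ _ (fun X r => And _ _) => apply u_And; unif
  | |- uniform ?g ?n (fun X r => All (@?F X r)) =>
      refine (u_All g n (fun X r' => F X (fst r') (snd r')) _); cbv beta; unif
  | |- _ => first [ solve [assumption]
                  | unif_lemma; pv
                  | (progress autounfold with unif); cbv beta; unif
                  | fail 1 ]
  end.

#[global] Hint Unfold Or Imp Iff Ex sub isPair isOPair tripleIn isInjection cardLe cardLt
  Defs.transitive ordinal cardinal isEmpty isSucc isNat isOmega isTrcl inH isH inPω1 isUnion isChain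
  isClub stationarilyMany forcingPoset compatible isGlb hasGlbs denseInTrace predenseBelow
  stronglyGeneric antichain maximalAntichain regularSuborder starProperty uncountableCardinalOver isLambda
  nonDiagStronglyProper isCheck isGenericName memClause subClause forceIn forceGround
  countableInGround approximatedInGround isQuotient : unif.

Lemma u_pairIn g n x y r : pvar n x -> pvar n y -> pvar n r ->
  uniform g n (fun X v => pairIn (x X v) (y X v) (r X v)).
Proof. intros. unfold pairIn. unif. Qed.
Ltac unif_lemma ::= apply u_pairIn.
Lemma u_countable g n x : pvar n x ->
  uniform g n (fun X v => countable (x X v)).
Proof. intros. unfold countable. unif. Qed.
Ltac unif_lemma ::= first [apply u_pairIn | apply u_countable].

Lemma u_forceEq n R le p a b : pvar n R -> pvar n le -> pvar n p -> pvar n a -> pvar n b ->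
  uniform false n (fun X r => forceEq (R X r) (le X r) (p X r) (a X r) (b X r)).
Proof. intros; unfold forceEq, subClause, memClause; unif. Qed.

Ltac unif_lemma ::= first [apply u_pairIn | apply u_countable | apply u_forceEq].

Fixpoint pren m n : (forall X, env X m -> env X n) -> Prop :=
  match n return (forall X, env X m -> env X n) -> Prop with
  | 0 => fun _ => True
  | S n => fun s => pren m n (fun X r => fst (s X r)) /\ pvar m (fun X r => snd (s X r))
  end.

Lemma pvar_ren m n t s : pvar n t -> pren m n s -> pvar m (fun X r => t X (s X r)).
Proof.
move=> H; elim: H s => {n t} [n | n t _ IH] s [s1 s2] //.
by apply: (IH (fun X r => fst (s X r))).
Qed.

Lemma pren_S m n s : pren m n s -> pren (S m) n (fun X r => s X (fst r)).
Proof.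
elim: n s => [//|n IH] s [s1 s2]; split; first exact: IH s1.
exact: pvarS s2.
Qed.

Lemma pren_lift m n s : pren m n s -> pren (S m) (S n) (fun X r => (s X (fst r), snd r)).
Proof. move=> H; split; [exact: pren_S | exact: pvar0]. Qed.

Lemma u_ren g m n A s : uniform g n A -> pren m n s -> uniform g m (fun X r => A X (s X r)).
Proof.
move=> H; elim: H m s => {n A}.
- move=> n a b Ha Hb m s Hs; apply: u_In; exact: pvar_ren.
- move=> n a b Ha Hb m s Hs; apply: u_Eq; exact: pvar_ren.
- move=> n a Hg Ha m s Hs; apply: u_Ground => //; exact: pvar_ren.
- move=> n A HA IH m s Hs; apply: u_Not; exact: IH.
- move=> n A B HA IHA HB IHB m s Hs; apply: u_And; [exact: IHA | exact: IHB].
- move=> n A HA IH m s Hs.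
  refine (u_All g m (fun X r => A X (s X (fst r), snd r)) _).
  exact: (IH _ _ (pren_lift _ _ _ Hs)).
Qed.

Lemma u_forceIn n R le p a b : pvar n R -> pvar n le -> pvar n p -> pvar n a -> pvar n b ->
  uniform false n (fun X r => forceIn (R X r) (le X r) (p X r) (a X r) (b X r)).
Proof. intros; unif. Qed.

Lemma u_forceGround n R le p a : pvar n R -> pvar n le -> pvar n p -> pvar n a ->
  uniform false n (fun X r => forceGround (R X r) (le X r) (p X r) (a X r)).
Proof. intros; unif. Qed.

(** Forcing a formula is again a formula, in which [Ground] has been translated away; it can
    therefore be evaluated in any model, or forced once more. The renaming [s] makes room for the
    variables that the translation adds. *)
Lemma u_force g n A : uniform g n A -> forall m s R le p, pren m n s ->
  pvar m R -> pvar m le -> pvar m p ->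
  uniform false m (fun X r => force (R X r) (le X r) (p X r) (A X (s X r))).
Proof.
move=> H; elim: H => {n A}.
- move=> n a b Ha Hb m s R le p Hs HR Hle Hp /=.
  exact: (u_forceIn m R le p _ _ HR Hle Hp (pvar_ren _ _ _ _ Ha Hs) (pvar_ren _ _ _ _ Hb Hs)).
- move=> n a b Ha Hb m s R le p Hs HR Hle Hp /=.
  exact: (u_forceEq m R le p _ _ HR Hle Hp (pvar_ren _ _ _ _ Ha Hs) (pvar_ren _ _ _ _ Hb Hs)).
- move=> n a _ Ha m s R le p Hs HR Hle Hp /=.
  exact: (u_forceGround m R le p _ HR Hle Hp (pvar_ren _ _ _ _ Ha Hs)).
- move=> n A HA IH m s R le p Hs HR Hle Hp /=.
  have := IH (S m) (fun X r => s X (fst r)) (fun X r => R X (fst r)) (fun X r => le X (fst r))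
    (fun X r => snd r) (pren_S _ _ _ Hs) (pvarS _ _ HR) (pvarS _ _ Hle) (pvar0 _).
  move=> K; unif.
- move=> n A B HA IHA HB IHB m s R le p Hs HR Hle Hp /=.
  by apply: u_And; [exact: IHA | exact: IHB].
- move=> n A HA IH m s R le p Hs HR Hle Hp /=.
  have := IH (S m) (fun X r => (s X (fst r), snd r)) (fun X r => R X (fst r)) (fun X r => le X (fst r))
    (fun X r => p X (fst r)) (pren_lift _ _ _ Hs) (pvarS _ _ HR) (pvarS _ _ Hle) (pvarS _ _ Hp).
  move=> K; exact: (u_All _ _ _ K).
Qed.

Fixpoint sem {X} (inr eqr : X -> X -> Prop) (a : fm X) : Prop :=
  match a with
  | In x y => inr x y
  | Eq x y => eqr x y
  | Ground _ => True
  | Not a => ~ sem inr eqr a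
  | And a b => sem inr eqr a /\ sem inr eqr b
  | All f => forall x, sem inr eqr (f x)
  end.

Lemma holds_sem a : holds a <-> sem setin seteq a.
Proof.
elim: a => //= [a IH|a IHa b IHb|f IH]; [tauto | tauto |].
by split=> H x; apply/IH.
Qed.

Lemma pvar_emap {X Y} (f : X -> Y) n t : pvar n t -> forall r, t Y (emap f r) = f (t X r).
Proof. by move=> H; elim: H => {n t} //= n t _ IH r. Qed.

(** A map that preserves and reflects both relations preserves truth once it is surjective, which
    handles the quantifier. This allows [seteq] on [ZF] to be replaced by Leibniz equality on a
    quotient. *)
Lemma sem_map {X Y} (f : X -> Y) inx eqx iny eqy g n A :
  (forall y, exists x, y = f x) ->
  (forall x x', inx x x' <-> iny (f x) (f x')) ->
  (forall x x', eqx x x' <-> eqy (f x) (f x')) ->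
  uniform g n A -> forall r, sem inx eqx (A X r) <-> sem iny eqy (A Y (emap f r)).
Proof.
move=> sf Hin Heq H; elim: H => {n A} /=.
- move=> n s t Hs Ht r; rewrite (pvar_emap f n s Hs) (pvar_emap f n t Ht); exact: Hin.
- move=> n s t Hs Ht r; rewrite (pvar_emap f n s Hs) (pvar_emap f n t Ht); exact: Heq.
- by [].
- move=> n A _ IH r; have := IH r; tauto.
- move=> n A B _ IHA _ IHB r; have := IHA r; have := IHB r; tauto.
- move=> n A _ IH r; split=> H.
  + by move=> y; have [x ->] := sf y; apply/(IH (r, x)).
  + by move=> x; apply/(IH (r, x)).
Qed.

Lemma u_ω1Approximation n R le : pvar n R -> pvar n le ->
  uniform false n (fun X r => ω1Approximation (R X r) (le X r)).
Proof.
move=> HR Hle; have U : uniform true 0 (fun X r => @approximatedInGround X) by unif.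
have K := u_force true 0 _ U (S n) (fun X r => tt) (fun X r => R X (fst r)) (fun X r => le X (fst r))
  (fun X r => snd r) I (pvarS _ _ HR) (pvarS _ _ Hle) (pvar0 _).
unfold ω1Approximation, forced; unif.
Qed.

Lemma u_nonDiagStronglyProper n R le : pvar n R -> pvar n le ->
  uniform false n (fun X r => nonDiagStronglyProper (R X r) (le X r)).
Proof. intros; unif. Qed.

(** The first conjunct concerns the statement under the forcing relation, to which completeness is
    applied; the second concerns the whole formula and serves its transfer from [ZF] to the quotient
    [V]. *)
Lemma u_quotientForced (phi : forall X, X -> X -> fm X) :
  uniform false 2 (fun X r => phi X (snd (fst r)) (snd r)) ->
  uniform false 3 (fun X r => Ex (fun R => And
     (isQuotient R (snd (fst (fst r))) (snd (fst r)) (snd r)) (phi X R (snd (fst r))))) /\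
  uniform false 3 (fun X r => quotientForced (snd (fst (fst r))) (snd (fst r)) (snd r) (phi X)).
Proof.
move=> Hphi.
have U : uniform false 3 (fun X r => Ex (fun R => And
     (isQuotient R (snd (fst (fst r))) (snd (fst r)) (snd r)) (phi X R (snd (fst r))))).
  have K : uniform false 4 (fun X r => phi X (snd r) (snd (fst (fst r)))).
    refine (u_ren _ 4 2 _ (fun X r => (tt, snd r, snd (fst (fst r)))) Hphi _).
    by repeat split; cbn; pv.
  unif.
split=> //.
(* The seven variables are, from the oldest, [P], [Q], [le], [Qc], [lec], [G] and [p]. *)
have K := u_force _ _ _ U 7 (fun X r => (tt, snd (fst (fst (fst r))), snd (fst (fst r)), snd (fst r)))
  (fun X r => snd (fst (fst (fst (fst (fst (fst r)))))))
  (fun X r => snd (fst (fst (fst (fst r))))) (fun X r => snd r).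
have {}K : uniform false 7 _ := K ltac:(by repeat split; cbn; pv) ltac:(pv) ltac:(pv) ltac:(pv).
unfold quotientForced, forced; unif.
Qed.

(** * Models of ZFC with definable relations *)

Inductive atm {M : Type} : forall n, (env M n -> M) -> Prop :=
| atm_c n c : atm n (fun _ => c)
| atm_0 n : atm (S n) snd
| atm_S n t : atm n t -> atm (S n) (fun r => t (fst r)).

Fixpoint ren {M : Type} m n : (env M m -> env M n) -> Prop :=
  match n return (env M m -> env M n) -> Prop with
  | 0 => fun _ => True
  | S n => fun s => ren m n (fun r => fst (s r)) /\ atm m (fun r => snd (s r))
  end.

(** A model of ZFC, given with a collection [Def] of "definable" relations for
    which it satisfies the axiom schemas.  [m_choice] says that every set is
    mapped injectively into the ordinals. *)
Class Model (M : Type) := {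
  mem : M -> M -> Prop;
  Def : forall n, (env M n -> Prop) -> Prop;
  Def_mem : Def 2 (fun r => mem (snd (fst r)) (snd r));
  Def_not : forall n A, Def n A -> Def n (fun r => ~ A r);
  Def_and : forall n A B, Def n A -> Def n B -> Def n (fun r => A r /\ B r);
  Def_all0 : forall n A, Def (S n) A -> Def n (fun r => forall x, A (r, x));
  Def_ren : forall m n s A, ren m n s -> Def n A -> Def m (fun r => A (s r));
  m_ext : forall x y, (forall z, mem z x <-> mem z y) -> x = y;
  m_ind : forall A, Def 1 (fun r => A (snd r)) ->
    (forall x, (forall y, mem y x -> A y) -> A x) -> forall x, A x;
  m_sep : forall A, Def 1 (fun r => A (snd r)) ->
    forall a, exists b, forall x, mem x b <-> mem x a /\ A x;
  m_pair : forall a b, exists c, forall x, mem x c <-> x = a \/ x = b;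
  m_union : forall a, exists u, forall x, mem x u <-> exists y, mem x y /\ mem y a;
  m_power : forall a, exists u, forall x, (forall z, mem z x -> mem z a) -> mem x u;
  m_coll : forall A, Def 2 (fun r => A (snd (fst r)) (snd r)) ->
    forall a, (forall x, mem x a -> exists y, A x y) ->
    exists b, forall x, mem x a -> exists y, mem y b /\ A x y;
  m_inf : exists w, (exists e, mem e w /\ forall z, ~ mem z e) /\
    forall k, mem k w -> exists m, mem m w /\ forall z, mem z m <-> mem z k \/ z = k;
  m_choice : forall a, exists A : M -> M -> Prop,
    Def 2 (fun r => A (snd (fst r)) (snd r)) /\
    (forall x, mem x a -> exists o, A x o /\
       (forall y, mem y o -> forall z, mem z y -> mem z o) /\
       (forall w, mem w o -> forall y, mem y w -> forall z, mem z y -> mem z w)) /\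
    (forall x x' o, A x o -> A x' o -> x = x')
}.

Declare Scope set_scope.
Delimit Scope set_scope with set.
Notation "x ∈ y" := (mem x y) (at level 70, no associativity) : set_scope.

Section Definability.
Context {M : Type} {HM : Model M}.

(** The language has no function symbols: a function is definable through its graph, and [Def_app]
    eliminates a term by quantifying over its value. *)
Definition Tm n (t : env M n -> M) := Def (S n) (fun r => snd r = t (fst r)).
Class Def1 (A : M -> Prop) := def1 : Def 1 (fun r => A (snd r)).
Class Def2 (A : M -> M -> Prop) := def2 : Def 2 (fun r => A (snd (fst r)) (snd r)).
Class Def3 (A : M -> M -> M -> Prop) :=
  def3 : Def 3 (fun r => A (snd (fst (fst r))) (snd (fst r)) (snd r)).
Class Fn1 (F : M -> M) := fn1 : Tm 1 (fun r => F (snd r)).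
Class Fn2 (F : M -> M -> M) := fn2 : Tm 2 (fun r => F (snd (fst r)) (snd r)).
Class Fn3 (F : M -> M -> M -> M) :=
  fn3 : Tm 3 (fun r => F (snd (fst (fst r))) (snd (fst r)) (snd r)).

Lemma Def_ext n (A B : env M n -> Prop) : Def n A -> (forall r, A r <-> B r) -> Def n B.
Proof. by move=> HA /pred_ext <-. Qed.

Lemma Def_all n (B : env M n -> M -> Prop) :
  Def (S n) (fun r => B (fst r) (snd r)) -> Def n (fun r => forall x, B r x).
Proof. exact: (Def_all0 n (fun r => B (fst r) (snd r))). Qed.

Lemma Def_ex n (B : env M n -> M -> Prop) :
  Def (S n) (fun r => B (fst r) (snd r)) -> Def n (fun r => exists x, B r x).
Proof.
move=> H; have := Def_not _ _ (Def_all n (fun r x => ~ B r x) (Def_not _ _ H)) => K.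
apply: (Def_ext _ _ _ K) => r; split; first exact: not_all_not_ex.
by move=> [x Hx] /(_ x).
Qed.

Lemma Def_or n A B : Def n A -> Def n B -> Def n (fun r => A r \/ B r).
Proof.
move=> HA HB; apply: (Def_ext _ _ _ (Def_not _ _ (Def_and _ _ _ (Def_not _ _ HA) (Def_not _ _ HB)))) => r.
tauto.
Qed.

Lemma Def_imp n A B : Def n A -> Def n B -> Def n (fun r => A r -> B r).
Proof.
move=> HA HB; apply: (Def_ext _ _ _ (Def_not _ _ (Def_and _ _ _ HA (Def_not _ _ HB)))) => r.
tauto.
Qed.

Lemma Def_iff n A B : Def n A -> Def n B -> Def n (fun r => A r <-> B r).
Proof.
move=> HA HB; exact: (Def_and _ _ _ (Def_imp _ _ _ HA HB) (Def_imp _ _ _ HB HA)).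
Qed.

Definition c0 : M :=
  epsilon (let: ex_intro w _ := m_inf in inhabits w) (fun _ => True).

(** By excluded middle an arbitrary proposition of the metatheory is equivalent to a tautology or to
    a contradiction built from [c0 ∈ c0]. *)
Lemma Def_const n (C : Prop) : Def n (fun _ => C).
Proof.
have D0 : Def n (fun _ => mem c0 c0).
  apply: (Def_ren n 2 (fun _ => (tt, c0, c0)) _ _ Def_mem); split; [split|] => //; exact: atm_c.
case: (classic C) => HC.
- apply: (Def_ext _ _ _ (Def_imp _ _ _ D0 D0)); tauto.
- apply: (Def_ext _ _ _ (Def_and _ _ _ D0 (Def_not _ _ D0))); tauto.
Qed.

Lemma ren_S m n (s : env M m -> env M n) : ren m n s -> ren (S m) n (fun r => s (fst r)).
Proof.
elim: n s => [//|n IH] s [s1 s2]; split; [exact: IH s1 | exact: (atm_S _ _ s2)].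
Qed.

Lemma ren_id n : ren n n (fun r : env M n => r).
Proof.
elim: n => [//|n IH]; split; last exact: atm_0.
exact: (ren_S n n (fun r => r)).
Qed.

Lemma Def_eq2 : Def2 (@eq M).
Proof.
have K : Def 2 (fun r : env M 2 => forall z, mem z (snd (fst r)) <-> mem z (snd r)).
  apply: Def_all; apply: Def_iff.
  - apply: (Def_ren 3 2 (fun r => (tt, snd r, snd (fst (fst r)))) _ _ Def_mem).
    split; [split|] => //=; [exact: atm_0 | exact: (atm_S _ _ (atm_S _ _ (atm_0 _)))].
  - apply: (Def_ren 3 2 (fun r => (tt, snd r, snd (fst r))) _ _ Def_mem).
    split; [split|] => //=; [exact: atm_0 | exact: (atm_S _ _ (atm_0 _))].
by apply: (Def_ext _ _ _ K) => r; split=> [H|->//]; apply: m_ext.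
Qed.

Lemma Tm_atm n (t : env M n -> M) : atm n t -> Tm n t.
Proof.
move=> Ht; apply: (Def_ren (S n) 2 (fun r => (tt, snd r, t (fst r))) _ _ Def_eq2).
by split; [split|] => //=; [exact: atm_0 | exact: atm_S].
Qed.

Lemma Tm_const n (c : M) : Tm n (fun _ => c).
Proof. apply: Tm_atm; exact: atm_c. Qed.

Lemma Tm_weak n (t : env M n -> M) : Tm n t -> Tm (S n) (fun r => t (fst r)).
Proof.
move=> H; apply: (Def_ren (S (S n)) (S n) (fun r => (fst (fst r), snd r)) _ _ H).
split; last exact: atm_0.
exact: (ren_S _ _ _ (ren_S _ _ _ (ren_id n))).
Qed.

Lemma Def_app n (A : env M (S n) -> Prop) t : Def (S n) A -> Tm n t -> Def n (fun r => A (r, t r)).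
Proof.
move=> HA Ht; apply: (Def_ext _ (fun r => exists x, x = t r /\ A (r, x))).
  apply: Def_ex; apply: Def_and; first exact: Ht.
  by apply: (Def_ext _ _ _ HA) => -[].
by move=> r; split=> [[x [-> //]]|H]; exists (t r).
Qed.

Lemma Def_app1 n A s : Def1 A -> Tm n s -> Def n (fun r => A (s r)).
Proof.
move=> HA Hs; refine (Def_app n (fun r => A (snd r)) s _ Hs).
by apply: (Def_ren (S n) 1 (fun r => (tt, snd r)) _ _ HA); split=> //; exact: atm_0.
Qed.

Lemma Def_app2 n A s t : Def2 A -> Tm n s -> Tm n t -> Def n (fun r => A (s r) (t r)).
Proof.
move=> HA Hs Ht; refine (Def_app n (fun r => A (s (fst r)) (snd r)) t _ Ht).
refine (Def_app (S n) (fun r => A (snd r) (snd (fst r))) (fun r => s (fst r)) _ (Tm_weak _ _ Hs)).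
apply: (Def_ren (S (S n)) 2 (fun r => (tt, snd r, snd (fst r))) _ _ HA).
by split=> /=; [split => //=; exact: atm_0 | exact: (atm_S _ _ (atm_0 _))].
Qed.

Lemma Def_app3 n A s t u : Def3 A -> Tm n s -> Tm n t -> Tm n u ->
  Def n (fun r => A (s r) (t r) (u r)).
Proof.
move=> HA Hs Ht Hu; refine (Def_app n (fun r => A (s (fst r)) (t (fst r)) (snd r)) u _ Hu).
refine (Def_app (S n) (fun r => A (s (fst (fst r))) (snd r) (snd (fst r))) (fun r => t (fst r)) _ (Tm_weak _ _ Ht)).
refine (Def_app (S (S n)) (fun r => A (snd r) (snd (fst r)) (snd (fst (fst r)))) (fun r => s (fst (fst r))) _
  (Tm_weak _ _ (Tm_weak _ _ Hs))).
apply: (Def_ren (S (S (S n))) 3 (fun r => (tt, snd r, snd (fst r), snd (fst (fst r)))) _ _ HA).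
split=> /=; [split; [split=> //=; exact: atm_0 | exact: (atm_S _ _ (atm_0 _))]
  | exact: (atm_S _ _ (atm_S _ _ (atm_0 _)))].
Qed.

Lemma Tm_app1 n F s : Fn1 F -> Tm n s -> Tm n (fun r => F (s r)).
Proof.
move=> HF Hs; apply: (Def_app2 (S n) (fun x y => y = F x) (fun r => s (fst r)) snd).
- exact: HF.
- exact: Tm_weak.
- apply: Tm_atm; exact: atm_0.
Qed.

Lemma Tm_app2 n F s t : Fn2 F -> Tm n s -> Tm n t -> Tm n (fun r => F (s r) (t r)).
Proof.
move=> HF Hs Ht.
apply: (Def_app3 (S n) (fun x y z => z = F x y) (fun r => s (fst r)) (fun r => t (fst r)) snd).
- exact: HF.
- exact: Tm_weak.
- exact: Tm_weak.
- apply: Tm_atm; exact: atm_0.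
Qed.

Definition uniq_ex (A : M -> Prop) (y : M) := A y /\ forall z, A z -> z = y.
(** The default [c0] makes the selected element unique in every case. A bare [epsilon] would be an
    arbitrary choice with no reason to have a definable graph; here [Tm_iota] can describe it. *)
Definition iota (A : M -> Prop) : M :=
  epsilon (inhabits c0) (fun y => uniq_ex A y \/ (~ (exists y, uniq_ex A y) /\ y = c0)).

Lemma iota_spec A : uniq_ex A (iota A) \/ (~ (exists y, uniq_ex A y) /\ iota A = c0).
Proof.
apply (epsilon_spec (inhabits c0) (fun y => uniq_ex A y \/ (~ (exists y, uniq_ex A y) /\ y = c0))); case: (classic (exists y, uniq_ex A y)) => [[y Hy]|H].
- by exists y; left.
- by exists c0; right.
Qed.

Lemma iota_unique (A : M -> Prop) y : A y -> (forall z, A z -> z = y) -> iota A = y.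
Proof.
move=> Ay Hy; case: (iota_spec A) => [[A1 _]|[K _]]; first exact: Hy.
by case: K; exists y.
Qed.

Lemma Tm_iota n (A : env M n -> M -> Prop) :
  Def (S n) (fun r => A (fst r) (snd r)) -> Tm n (fun r => iota (A r)).
Proof.
move=> HA.
have A2 : Def (S (S n)) (fun r => A (fst (fst r)) (snd r)).
  apply: (Def_ren (S (S n)) (S n) (fun r => (fst (fst r), snd r)) _ _ HA); split; last exact: atm_0.
  exact: (ren_S _ _ _ (ren_S _ _ _ (ren_id n))).
have A3 : Def (S (S (S n))) (fun r => A (fst (fst (fst r))) (snd r)).
  apply: (Def_ren (S (S (S n))) (S n) (fun r => (fst (fst (fst r)), snd r)) _ _ HA); split; last exact: atm_0.
  exact: (ren_S _ _ _ (ren_S _ _ _ (ren_S _ _ _ (ren_id n)))).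
have U1 : Def (S n) (fun r => uniq_ex (A (fst r)) (snd r)).
  apply: Def_and => //; apply: Def_all; apply: Def_imp => //.
  apply: (Def_app2 _ (@eq M)); [exact: Def_eq2 | |]; apply: Tm_atm; [exact: atm_0 | exact: (atm_S _ _ (atm_0 _))].
have U2 : Def (S (S n)) (fun r => uniq_ex (A (fst (fst r))) (snd r)).
  apply: Def_and => //; apply: Def_all; apply: Def_imp => //.
  apply: (Def_app2 _ (@eq M)); [exact: Def_eq2 | |]; apply: Tm_atm; [exact: atm_0 | exact: (atm_S _ _ (atm_0 _))].
have K : Def (S n) (fun r => uniq_ex (A (fst r)) (snd r) \/
    (~ (exists y, uniq_ex (A (fst r)) y) /\ snd r = c0)).
  apply: Def_or => //; apply: Def_and.
    apply: Def_not; exact: (Def_ex (S n) (fun r y => uniq_ex (A (fst r)) y)).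
  apply: (Def_app2 _ (@eq M)); [exact: Def_eq2 | |]; apply: Tm_atm; [exact: atm_0 | exact: atm_c].
apply: (Def_ext _ _ _ K) => r; case: (iota_spec (A (fst r))) => [[H1 H2]|[H1 H2]]; split.
- by case=> [[H3 H4]|[H3 _]]; [apply: H2 | case: H3; exists (iota (A (fst r)))].
- by move=> ->; left.
- by case=> [H3|[_ ->]]; [case: H1; exists (snd r) | rewrite H2].
- by move=> ->; right.
Qed.

Definition cset (A : M -> Prop) : M := iota (fun b => forall x, mem x b <-> A x).

Lemma cset_in A a x : Def1 A -> (forall x, A x -> mem x a) -> (mem x (cset A) <-> A x).
Proof.
move=> HA Ha; have [b Hb] := m_sep A HA a.
have Hb' z : mem z b <-> A z by rewrite Hb; split=> [[]//|H]; split=> //; exact: Ha.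
rewrite /cset (iota_unique _ b) //.
by move=> c Hc; apply: m_ext => z; rewrite Hb' Hc.
Qed.

Lemma cset_eq A b : (forall x, mem x b <-> A x) -> cset A = b.
Proof.
by move=> Hb; apply: iota_unique => // c Hc; apply: m_ext => z; rewrite Hb Hc.
Qed.

Lemma Tm_cset n (A : env M n -> M -> Prop) :
  Def (S n) (fun r => A (fst r) (snd r)) -> Tm n (fun r => cset (A r)).
Proof.
move=> HA; apply: Tm_iota; apply: Def_all; apply: Def_iff.
- apply: (Def_app2 _ mem); [exact: Def_mem | |]; apply: Tm_atm; [exact: atm_0 | exact: (atm_S _ _ (atm_0 _))].
- apply: (Def_ren (S (S n)) (S n) (fun r => (fst (fst r), snd r)) _ _ HA); split; last exact: atm_0.
  exact: (ren_S _ _ _ (ren_S _ _ _ (ren_id n))).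
Qed.
End Definability.

#[global] Existing Instance Def_eq2.
#[global] Instance Def_mem2 {M} {HM : Model M} : Def2 mem := Def_mem.

Ltac atm_at c e :=
  lazymatch e with
  | (fun r => r) => exact c
  | (fun r => fst (@?e' r)) => atm_at uconstr:(atm_S _ _ c) e'
  end.
Ltac atm_tac :=
  first [ exact (atm_0 _) | exact (atm_S _ _ (atm_0 _))
        | lazymatch goal with |- atm _ (fun r => snd (@?e r)) => atm_at uconstr:(atm_0 _) e end ].

Ltac def_lemma := fail.
Ltac inst := solve [assumption | typeclasses eauto].
Ltac def :=
  cbv beta;
  lazymatch goal with
  | |- Def1 _ => unfold Def1; def
  | |- Def2 _ => unfold Def2; def
  | |- Def3 _ => unfold Def3; def
  | |- Fn1 _ => unfold Fn1; def
  | |- Fn2 _ => unfold Fn2; def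
  | |- Fn3 _ => unfold Fn3; def
  | |- Tm _ _ =>
    first
    [ apply Tm_const
    | apply Tm_atm; atm_tac
    | lazymatch goal with
      | |- Tm _ (fun r => cset (@?A r)) => apply (Tm_cset _ A); def
      | |- Tm _ (fun r => iota (@?A r)) => apply (Tm_iota _ A); def
      | |- Tm _ (fun r => ?F (@?s r) (@?t r)) => apply (Tm_app2 _ F s t); [inst | def | def]
      end
    | lazymatch goal with
      | |- Tm _ (fun r => ?F (@?s r)) => apply (Tm_app1 _ F s); [inst | def]
      end
    | def_lemma; def
    | match goal with |- Tm _ (fun r => ?t) => let h := eval hnf in t in fail end ]
  | |- Def _ _ =>
    first
    [ assumption
    | apply Def_const
    | lazymatch goal with
      | |- Def _ (fun r => ~ (@?A r)) => apply (Def_not _ A); def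
      | |- Def _ (fun r => @?A r /\ @?B r) => apply (Def_and _ A B); def
      | |- Def _ (fun r => @?A r \/ @?B r) => apply (Def_or _ A B); def
      | |- Def _ (fun r => @?A r <-> @?B r) => apply (Def_iff _ A B); def
      | |- Def _ (fun r => @?A r -> @?B r) => apply (Def_imp _ A B); def
      | |- Def _ (fun r => forall x, @?B r x) => apply (Def_all _ B); def
      | |- Def _ (fun r => exists x, @?B r x) => apply (Def_ex _ B); def
      | |- Def _ (fun r => ?F (@?s r) (@?t r)) => apply (Def_app2 _ F s t); [inst | def | def]
      end
    | lazymatch goal with
      | |- Def _ (fun r => ?F (@?s r) (@?t r) (@?u r)) => apply (Def_app3 _ F s t u); [inst | def | def | def]
      end
    | lazymatch goal with
      | |- Def _ (fun r => ?F (@?s r)) => apply (Def_app1 _ F s); [inst | def]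
      end
    | def_lemma; def ]
  | |- _ => first [assumption | def_lemma; def]
  end.

#[global] Hint Extern 1 (Def1 (fun _ => _)) => solve [def] : typeclass_instances.
#[global] Hint Extern 1 (Def2 (fun _ => _)) => solve [def] : typeclass_instances.
#[global] Hint Extern 1 (Def3 (fun _ => _)) => solve [def] : typeclass_instances.
#[global] Hint Extern 1 (Fn1 (fun _ => _)) => solve [def] : typeclass_instances.
#[global] Hint Extern 1 (Fn2 (fun _ => _)) => solve [def] : typeclass_instances.

Local Open Scope set_scope.

(** * Set theory in a model *)

Section SetTheory.
Context {M : Type} {HM : Model M}.
Implicit Types (a b c x y z u v w f t : M).

Definition Sub x y := forall z, z ∈ x -> z ∈ y.
#[export] Instance Def_Sub : Def2 Sub. Proof. unfold Sub; def. Qed.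

Lemma ext x y : (forall z, z ∈ x <-> z ∈ y) -> x = y.
Proof. exact: m_ext. Qed.

Lemma mem_ind (A : M -> Prop) : Def1 A ->
  (forall x, (forall y, y ∈ x -> A y) -> A x) -> forall x, A x.
Proof. exact: m_ind. Qed.

Lemma mem_irrefl x : x ∈ x -> False.
Proof.
move: x; apply: mem_ind.
by move=> x IH xx; exact: (IH x xx).
Qed.

Lemma mem_asym x y : x ∈ y -> ~ y ∈ x.
Proof.
have K : forall x y, y ∈ x -> ~ x ∈ y.
  apply: (mem_ind (fun x => forall y, y ∈ x -> ~ x ∈ y)).
  by move=> u IH v vu uv; exact: (IH v vu u uv).
by move=> xy yx; exact: (K x y yx xy).
Qed.

Definition pair a b := cset (fun x => x = a \/ x = b).
#[export] Instance Fn_pair : Fn2 pair. Proof. unfold pair; def. Qed.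
Lemma in_pair a b x : x ∈ pair a b <-> x = a \/ x = b.
Proof.
have [c Hc] := m_pair a b; apply: (cset_in _ c).
by move=> z; rewrite Hc.
Qed.

Definition opair a b := pair (pair a a) (pair a b).
#[export] Instance Fn_opair : Fn2 opair. Proof. unfold opair; def. Qed.

Lemma pair_inj a b c d : pair a b = pair c d -> (a = c /\ b = d) \/ (a = d /\ b = c).
Proof.
move=> H.
have H1 : a ∈ pair c d by rewrite -H; apply/in_pair; left.
have H2 : b ∈ pair c d by rewrite -H; apply/in_pair; right.
have H3 : c ∈ pair a b by rewrite H; apply/in_pair; left.
have H4 : d ∈ pair a b by rewrite H; apply/in_pair; right.
move: H1 H2 H3 H4; rewrite !in_pair; intuition congruence.
Qed.

Lemma opair_inj a b c d : opair a b = opair c d -> a = c /\ b = d.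
Proof.
rewrite /opair => /pair_inj [[H1 H2]|[H1 H2]].
- have ac : a = c by case: (pair_inj _ _ _ _ H1) => [[]|[]].
  by subst c; case: (pair_inj _ _ _ _ H2) => [[]|[]] // -> ->.
- by case: (pair_inj _ _ _ _ H1) => [[e1 e2]|[e1 e2]]; case: (pair_inj _ _ _ _ H2) => [[e3 e4]|[e3 e4]];
  split; congruence.
Qed.

Definition Un a := cset (fun x => exists y, x ∈ y /\ y ∈ a).
#[export] Instance Fn_Un : Fn1 Un. Proof. unfold Un; def. Qed.
Lemma in_Un a x : x ∈ Un a <-> exists y, x ∈ y /\ y ∈ a.
Proof.
have [c Hc] := m_union a; apply: (cset_in _ c).
by move=> z; rewrite Hc.
Qed.

Definition cup a b := Un (pair a b).
#[export] Instance Fn_cup : Fn2 cup. Proof. unfold cup; def. Qed.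
Lemma in_cup a b x : x ∈ cup a b <-> x ∈ a \/ x ∈ b.
Proof.
rewrite /cup in_Un; split=> [[y []]|[H|H]].
- by rewrite in_pair => H [] <-; tauto.
- by exists a; rewrite in_pair; tauto.
- by exists b; rewrite in_pair; tauto.
Qed.

Definition pow a := cset (fun x => Sub x a).
#[export] Instance Fn_pow : Fn1 pow. Proof. unfold pow; def. Qed.
Lemma in_pow a x : x ∈ pow a <-> Sub x a.
Proof.
have [c Hc] := m_power a; apply: (cset_in _ c).
by move=> z; exact: Hc.
Qed.

Definition sep a (A : M -> Prop) := cset (fun x => x ∈ a /\ A x).
Lemma in_sep a (A : M -> Prop) : Def1 A -> forall x, x ∈ sep a A <-> x ∈ a /\ A x.
Proof. by move=> HA x; apply: (cset_in _ a); move=> ? []. Qed.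

Lemma cset_sub (A : M -> Prop) a : Def1 A -> (forall x, A x -> x ∈ a) ->
  forall x, x ∈ cset A <-> A x.
Proof. by move=> HA Ha x; exact: (cset_in _ a). Qed.

(** Replacement: a definable class covered by the
    values of a definable relation, unique in its second argument, on a set. *)
Lemma repl_bound (A : M -> M -> Prop) a : Def2 A ->
  (forall x y y', A x y -> A x y' -> y = y') ->
  exists b, forall x y, x ∈ a -> A x y -> y ∈ b.
Proof.
move=> HA Hu; have [||b Hb] := m_coll (fun x y => A x y \/ ~ exists z, A x z) _ a.
- by def.
- move=> x _; case: (classic (exists z, A x z)) => [[z H]|H]; first by exists z; left.
  by exists a; right.
- exists b => x y xa Axy; have [y' [y'b [H|[]]]] := Hb x xa; last by exists y.
  by rewrite (Hu _ _ _ Axy H).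
Qed.

Definition repl a (F : M -> M) := cset (fun y => exists x, x ∈ a /\ y = F x).
Lemma in_repl a F : Fn1 F -> forall y, y ∈ repl a F <-> exists x, x ∈ a /\ y = F x.
Proof.
move=> HF y.
have [b Hb] := repl_bound (fun x y => y = F x) a _ (fun x y y' e e' => eq_trans e (eq_sym e')).
apply: (cset_sub _ b).
by move=> z [x [xa e]]; exact: (Hb x z).
Qed.

Definition emp := cset (fun _ => False).
Lemma in_emp x : x ∈ emp -> False.
Proof.
have -> : x ∈ emp <-> False by apply: (cset_sub _ x).
by [].
Qed.

Definition prod a b := cset (fun u => exists x y, x ∈ a /\ y ∈ b /\ u = opair x y).
#[export] Instance Fn_prod : Fn2 prod. Proof. unfold prod; def. Qed.
Lemma in_prod a b u : u ∈ prod a b <-> exists x y, x ∈ a /\ y ∈ b /\ u = opair x y.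
Proof.
apply: (cset_sub _ (pow (pow (cup a b)))).
move=> z [x [y [xa [yb ->]]]]; apply/in_pow => v /in_pair Hv; apply/in_pow => t.
by case: Hv => -> /in_pair [] ->; apply/in_cup; tauto.
Qed.
Lemma opair_in_prod a b x y : opair x y ∈ prod a b <-> x ∈ a /\ y ∈ b.
Proof.
rewrite in_prod; split=> [[x' [y' [xa [yb /opair_inj [-> ->]]]]]//|[xa yb]].
by exists x, y.
Qed.

Definition succ k := cup k (pair k k).
#[export] Instance Fn_succ : Fn1 succ. Proof. unfold succ; def. Qed.
Lemma in_succ k x : x ∈ succ k <-> x ∈ k \/ x = k.
Proof. rewrite /succ in_cup in_pair; tauto. Qed.
End SetTheory.

Ltac def_lemma ::= progress unfold sep, repl.

(** * Recursion along a definable function giving the set of predecessors *)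

Section Recursion.
Context {M : Type} {HM : Model M}.

Context (pr : M -> M).
Context (Hpr : Fn1 pr).
Context (pr_ind : forall A : M -> Prop, Def1 A ->
  (forall u, (forall v, v ∈ pr u -> A v) -> A u) -> forall u, A u).
Context (G : M -> M -> M).
Context (HG : Fn2 G).

Definition restr (f a : M) := cset (fun w => w ∈ f /\ exists v y, v ∈ a /\ w = opair v y).
#[export] Instance Fn_restr : Fn2 restr. Proof. unfold restr; def. Qed.
Lemma in_restr f a w : w ∈ restr f a <-> w ∈ f /\ exists v y, v ∈ a /\ w = opair v y.
Proof. by apply: (cset_sub _ f); move=> ? []. Qed.

Definition attempt (f d : M) :=
  (forall v, v ∈ d -> Sub (pr v) d) /\
  (forall v, v ∈ d -> opair v (G v (restr f (pr v))) ∈ f) /\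
  (forall w, w ∈ f -> exists v, v ∈ d /\ w = opair v (G v (restr f (pr v)))).
#[export] Instance Def_attempt : Def2 attempt. Proof. unfold attempt; def. Qed.

Definition value u y := exists f d, attempt f d /\ opair u y ∈ f.
#[export] Instance Def_value : Def2 value. Proof. unfold value; def. Qed.
Definition rec u := iota (value u).
#[export] Instance Fn_rec : Fn1 rec. Proof. unfold rec; def. Qed.

Lemma attempt_fun f d v y : attempt f d -> opair v y ∈ f -> v ∈ d /\ y = G v (restr f (pr v)).
Proof. by move=> [_ [_ H]] /H [v' [vd e]]; case: (opair_inj _ _ _ _ e) => -> ->. Qed.

Lemma restr_agree f f' a : (forall v y, v ∈ a -> (opair v y ∈ f <-> opair v y ∈ f')) ->
  restr f a = restr f' a.
Proof.
move=> H; apply: ext => w; rewrite !in_restr; split=> -[wf [v [y [va e]]]]; subst w.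
- by split; [apply/H | exists v, y].
- by split; [apply/H | exists v, y].
Qed.

Lemma attempt_agree f d f' d' : attempt f d -> attempt f' d' ->
  forall u, u ∈ d -> u ∈ d' -> forall y, opair u y ∈ f <-> opair u y ∈ f'.
Proof.
move=> Hf Hf'.
apply: (pr_ind (fun u => u ∈ d -> u ∈ d' -> forall y, opair u y ∈ f <-> opair u y ∈ f')).
move=> u IH ud ud' y.
have E : restr f (pr u) = restr f' (pr u).
  apply: restr_agree => v z vu; apply: IH => //.
  - by case: Hf => /(_ u ud v vu).
  - by case: Hf' => /(_ u ud' v vu).
split=> H.
- have [_ ->] := attempt_fun _ _ _ _ Hf H; rewrite E; by case: Hf' => _ [/(_ u ud')].
- have [_ ->] := attempt_fun _ _ _ _ Hf' H; rewrite -E; by case: Hf => _ [/(_ u ud)].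
Qed.

Lemma value_fun u y y' : value u y -> value u y' -> y = y'.
Proof.
move=> [f [d [H1 H2]]] [f' [d' [H1' H2']]].
have [ud _] := attempt_fun _ _ _ _ H1 H2; have [ud' _] := attempt_fun _ _ _ _ H1' H2'.
move: H2; rewrite (attempt_agree _ _ _ _ H1 H1' u ud ud') => H2.
have [_ ->] := attempt_fun _ _ _ _ H1' H2; by have [_ ->] := attempt_fun _ _ _ _ H1' H2'.
Qed.

(** Two attempts agree on the common part of their domains, by induction along [pr]; hence the union
    of a set of attempts is again a function obeying the recursion. *)
Lemma attempt_union B : (forall c, c ∈ B -> exists f d, c = opair f d /\ attempt f d) ->
  exists f d, attempt f d /\ forall f' d', opair f' d' ∈ B -> Sub d' d.
Proof.
move=> HB.
pose (ff := cset (fun w => exists f d, opair f d ∈ B /\ w ∈ f)).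
pose (dd := cset (fun w => exists f d, opair f d ∈ B /\ w ∈ d)).
have Hopl f d : opair f d ∈ B -> f ∈ Un (Un B).
  move=> H; apply/in_Un; exists (pair f f); split; first by apply/in_pair; left.
  by apply/in_Un; exists (opair f d); split=> //; apply/in_pair; left.
have Hopr f d : opair f d ∈ B -> d ∈ Un (Un B).
  move=> H; apply/in_Un; exists (pair f d); split; first by apply/in_pair; right.
  by apply/in_Un; exists (opair f d); split=> //; apply/in_pair; right.
have in_ff w : w ∈ ff <-> exists f d, opair f d ∈ B /\ w ∈ f.
  apply: (cset_sub _ (Un (Un (Un B)))).
  by move=> x [f [d [H xf]]]; apply/in_Un; exists f; split=> //; exact: Hopl H.
have in_dd w : w ∈ dd <-> exists f d, opair f d ∈ B /\ w ∈ d.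
  apply: (cset_sub _ (Un (Un (Un B)))).
  by move=> x [f [d [H xf]]]; apply/in_Un; exists d; split=> //; exact: Hopr H.
have BA f d : opair f d ∈ B -> attempt f d.
  by move=> /HB [f' [d' [e ?]]]; case: (opair_inj _ _ _ _ e) => -> ->.
have same f d v : opair f d ∈ B -> v ∈ d -> restr ff (pr v) = restr f (pr v).
  move=> fB vd; apply: restr_agree => z y zv.
  have zd : z ∈ d by case: (BA _ _ fB) => /(_ v vd z zv).
  split=> [/in_ff [f' [d' [fB' H]]]|H]; last by apply/in_ff; exists f, d.
  have [zd' _] := attempt_fun _ _ _ _ (BA _ _ fB') H.
  by apply/(attempt_agree _ _ _ _ (BA _ _ fB) (BA _ _ fB') z zd zd').
exists ff, dd; split; last by move=> f' d' H x xd; apply/in_dd; exists f', d'.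
split; [|split].
- move=> v /in_dd [f [d [fB vd]]] z zv; apply/in_dd; exists f, d; split=> //.
  by case: (BA _ _ fB) => /(_ v vd z zv).
- move=> v /in_dd [f [d [fB vd]]]; rewrite (same f d) //.
  by apply/in_ff; exists f, d; split=> //; case: (BA _ _ fB) => _ [/(_ v vd)].
- move=> w /in_ff [f [d [fB wf]]]; case: (BA _ _ fB) => _ [_ /(_ w wf) [v [vd e]]].
  exists v; split; first by apply/in_dd; exists f, d.
  by rewrite (same f d).
Qed.

Lemma value_total u : exists y, value u y.
Proof.
move: u; apply: (pr_ind (fun u => exists y, value u y)).
move=> u IH.
(* Attempts with a given point in their domain are not unique, so collection is used in place of
   replacement; [B] then discards what is not an attempt. *)
have [||b Hb] := m_coll (fun v c => exists f d, c = opair f d /\ attempt f d /\ v ∈ d) _ (pr u).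
- by def.
- move=> v /IH [y [f [d [H1 H2]]]]; exists (opair f d), f, d; split=> //; split=> //.
  by case: (attempt_fun _ _ _ _ H1 H2).
pose (B := sep b (fun c => exists f d, c = opair f d /\ attempt f d)).
have in_B c : c ∈ B <-> c ∈ b /\ exists f d, c = opair f d /\ attempt f d.
  exact: in_sep.
have [|f [d [Hf Hd]]] := attempt_union B.
  by move=> c /in_B [].
have pd : Sub (pr u) d.
  move=> v /Hb [c [cb [f' [d' [e [Hf' vd']]]]]]; apply: (Hd f' d') => //.
  by rewrite -e; apply/in_B; split=> //; exists f', d'.
case: (classic (u ∈ d)) => ud.
  by exists (G u (restr f (pr u))); exists f, d; split=> //; case: Hf => _ [/(_ u ud)].
pose (y := G u (restr f (pr u))).
pose (f1 := cup f (pair (opair u y) (opair u y))); pose (d1 := cup d (pair u u)).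
(* The domain [d] is closed and omits [u], and it contains [pr u]; so nothing in [d1] has [u] as a
   predecessor, and adding the new pair changes no restriction. *)
have nup v : v ∈ d1 -> ~ u ∈ pr v.
  move=> /in_cup [vd uv|/in_pair H]; first by case: Hf => /(_ v vd u uv).
  have -> : v = u by tauto.
  by move=> /pd.
have E v : v ∈ d1 -> restr f1 (pr v) = restr f (pr v).
  move=> vd; apply: restr_agree => z t zv; rewrite in_cup in_pair; split; last by tauto.
  case=> // H; have e : opair z t = opair u y by tauto.
  case: (opair_inj _ _ _ _ e) => ? _; subst z; case: (nup v vd zv).
exists y, f1, d1; split; last by apply/in_cup; right; apply/in_pair; left.
split; [|split].
- move=> v /in_cup [vd|/in_pair H] z zv; apply/in_cup; left.
  + by case: Hf => /(_ v vd z zv).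
  + by apply: pd; have <- : v = u by tauto.
- move=> v vd1; rewrite E //; apply/in_cup; move/in_cup: vd1 => [vd|/in_pair H].
  + by left; case: Hf => _ [/(_ v vd)].
  + by right; apply/in_pair; left; have -> : v = u by tauto.
- move=> w /in_cup [wf|/in_pair H].
  + case: Hf => _ [_ /(_ w wf) [v [vd e]]]; exists v.
    have vd1 : v ∈ d1 by apply/in_cup; left.
    by rewrite E.
  + exists u; have ud1 : u ∈ d1 by apply/in_cup; right; apply/in_pair; left.
    by rewrite E //; split=> //; rewrite -/y; tauto.
Qed.

Lemma value_rec u : value u (rec u).
Proof.
have [y Hy] := value_total u; rewrite /rec (iota_unique _ y) // => z Hz.
exact: (value_fun _ _ _ Hz Hy).
Qed.

Lemma rec_eq u : rec u = G u (repl (pr u) (fun v => opair v (rec v))).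
Proof.
have [f [d [Hf Huf]]] := value_rec u; have [ud e] := attempt_fun _ _ _ _ Hf Huf.
rewrite {1}e; congr (G u _); apply: ext => w.
rewrite in_restr in_repl.
split.
- move=> [wf [v [y [vu e']]]]; subst w; exists v; split=> //; congr (opair v _).
  by apply: (value_fun v) (value_rec v); exists f, d.
- move=> [v [vu e']]; subst w; split; last by exists v, (rec v).
  have vd : v ∈ d by case: (Hf) => /(_ u ud v vu).
  have [_ [/(_ v vd) H _]] := Hf.
  by have -> : rec v = G v (restr f (pr v)) by apply: (value_fun v (rec v) _ (value_rec v)); exists f, d.
Qed.
End Recursion.

Section MemRec.
Context {M : Type} {HM : Model M}.
Context (G : M -> M -> M).
Context (HG : Fn2 G).

Definition ran (g : M) := cset (fun y => exists v, opair v y ∈ g).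
Lemma ran_graph a F : Fn1 F -> ran (repl a (fun v => opair v (F v))) = repl a F.
Proof.
move=> HF; apply: cset_eq => y; rewrite in_repl; split.
- by move=> [x [xa ->]]; exists x; apply/in_repl; exists x.
- move=> [v]; rewrite in_repl.
  by move=> [x [xa e]]; case: (opair_inj _ _ _ _ e) => _ ->; exists x.
Qed.

#[export] Instance Fn_ran : Fn1 ran. Proof. unfold ran; def. Qed.

(** The step sees the set of earlier values but not the arguments at which they are taken. When the
    arguments matter, as for [tri], [rec] is used directly. *)
Definition mrec : M -> M := rec (fun x => x) (fun x g => G x (ran g)).
#[export] Instance Fn_mrec : Fn1 mrec.
Proof. apply: Fn_rec. Qed.

Lemma mrec_eq x : mrec x = G x (repl x mrec).
Proof.
rewrite /mrec {1}rec_eq; last by move=> A HA; apply: mem_ind.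
by rewrite (ran_graph _ _ Fn_mrec).
Qed.
End MemRec.

(** * Ordinals, injections and natural numbers *)

Notation sat := (sem mem eq).

Section Ordinals.
Context {M : Type} {HM : Model M}.
Implicit Types (a b c x y z u v w f t : M).

Definition Tr t := forall x, x ∈ t -> Sub x t.
#[export] Instance Def_Tr : Def1 Tr. Proof. unfold Tr; def. Qed.
Definition Ord a := Tr a /\ forall x, x ∈ a -> Tr x.
#[export] Instance Def_Ord : Def1 Ord. Proof. unfold Ord; def. Qed.

Lemma Ord_in a x : Ord a -> x ∈ a -> Ord x.
Proof. by move=> [H1 H2] xa; split=> [|y yx]; [exact: H2 | apply: H2; exact: (H1 x xa y yx)]. Qed.

Lemma Ord_trich a b : Ord a -> Ord b -> a ∈ b \/ a = b \/ b ∈ a.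
Proof.
move=> Ha Hb; move: a Ha b Hb.
apply: (mem_ind (fun a => Ord a -> forall b, Ord b -> a ∈ b \/ a = b \/ b ∈ a)).
move=> a IHa Ha; apply: (mem_ind (fun b => Ord b -> a ∈ b \/ a = b \/ b ∈ a)).
move=> b IHb Hb; case: (classic (a ∈ b)) => nab; first by left.
case: (classic (b ∈ a)) => nba; first by right; right.
right; left; apply: ext => z; split=> H.
- case: (IHa z H (Ord_in _ _ Ha H) b Hb) => [//|[e|bz]].
  + by case: nba; rewrite -e.
  + by case: nba; case: Ha => /(_ z H b bz).
- case: (IHb z H (Ord_in _ _ Hb H)) => [az|[e|//]].
  + by case: nab; case: Hb => /(_ z H a az).
  + by case: nab; rewrite e.
Qed.

Lemma Ord_least (A : M -> Prop) : Def1 A -> (exists a, Ord a /\ A a) ->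
  exists a, Ord a /\ A a /\ forall b, Ord b -> A b -> a = b \/ a ∈ b.
Proof.
move=> HA [a [Ha Aa]].
have K : exists a, Ord a /\ A a /\ forall b, b ∈ a -> ~ A b.
  apply: NNPP => nK.
  have : forall a, ~ (Ord a /\ A a).
    apply: (mem_ind (fun a => ~ (Ord a /\ A a))) => x IH [Hx Ax].
    apply: nK; exists x; split=> //; split=> // b bx Ab; apply: (IH b bx); split=> //.
    exact: (Ord_in _ _ Hx bx).
  by move/(_ a); apply.
case: K => x [Hx [Ax nx]]; exists x; split=> //; split=> // b Hb Ab.
by case: (Ord_trich _ _ Hx Hb) => [?|[?|/nx//]]; [right | left].
Qed.

Lemma Ord_Un a : (forall x, x ∈ a -> Ord x) -> Ord (Un a).
Proof.
move=> H; split.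
- move=> x /in_Un [y [xy ya]] z zx; apply/in_Un; exists y; split=> //.
  by case: (H y ya) => /(_ x xy z zx).
- by move=> x /in_Un [y [xy ya]]; case: (H y ya) => _ /(_ x xy).
Qed.

Lemma Ord_succ a : Ord a -> Ord (succ a).
Proof.
move=> [H1 H2]; split.
- move=> x /in_succ [xa|->] z zx; apply/in_succ; left=> //; exact: (H1 x xa).
- by move=> x /in_succ [/H2|->].
Qed.

Lemma Ord_cup a b : Ord a -> Ord b -> Ord (cup a b).
Proof. by move=> Ha Hb; apply: Ord_Un => x /in_pair [] ->. Qed.

Definition Inj f a b :=
  (forall u, u ∈ f -> exists x, x ∈ a /\ exists y, y ∈ b /\ u = opair x y) /\
  (forall x, x ∈ a -> exists y, y ∈ b /\ opair x y ∈ f /\ forall z, opair x z ∈ f -> z = y) /\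
  (forall x y z, opair x z ∈ f -> opair y z ∈ f -> x = y).
#[export] Instance Def_Inj : Def3 Inj. Proof. unfold Inj; def. Qed.
Definition Le a b := exists f, Inj f a b.
#[export] Instance Def_Le : Def2 Le. Proof. unfold Le; def. Qed.

Lemma Inj_intro F a b : Fn1 F -> (forall x, x ∈ a -> F x ∈ b) ->
  (forall x y, x ∈ a -> y ∈ a -> F x = F y -> x = y) ->
  Inj (repl a (fun x => opair x (F x))) a b.
Proof.
move=> HF Hab Hinj.
have K x y : opair x y ∈ repl a (fun x => opair x (F x)) <-> x ∈ a /\ y = F x.
  rewrite in_repl; split=> [[x' [xa e]]|[xa ->]]; last by exists x.
  by case: (opair_inj _ _ _ _ e) => -> ->.
split; [|split].
- move=> u /in_repl [x [xa ->]]; exists x; split=> //; exists (F x); split=> //; exact: Hab.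
- move=> x xa; exists (F x); split; first exact: Hab.
  by split=> [|z /K []//]; apply/K.
- by move=> x y z /K [xa ->] /K [ya e]; apply: Hinj.
Qed.

Lemma Le_intro F a b : Fn1 F -> (forall x, x ∈ a -> F x ∈ b) ->
  (forall x y, x ∈ a -> y ∈ a -> F x = F y -> x = y) -> Le a b.
Proof. by move=> HF H1 H2; exists (repl a (fun x => opair x (F x))); exact: Inj_intro. Qed.

Definition app f x := iota (fun y => opair x y ∈ f).
#[export] Instance Fn_app : Fn2 app. Proof. unfold app; def. Qed.

Lemma Inj_app f a b x : Inj f a b -> x ∈ a -> forall y, opair x y ∈ f <-> y = app f x.
Proof.
move=> [_ [H _]] xa; have [y [yb [H1 H2]]] := H x xa.
have -> : app f x = y by apply: iota_unique.
by move=> z; split=> [/H2//|->].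
Qed.

Lemma Inj_elim f a b : Inj f a b ->
  (forall x, x ∈ a -> app f x ∈ b) /\
  (forall x y, x ∈ a -> y ∈ a -> app f x = app f y -> x = y).
Proof.
move=> H; split.
- move=> x xa; have := proj2 (Inj_app _ _ _ _ H xa (app f x)) eq_refl.
  case: (H) => [H1 _] /H1 [x' [_ [y [yb e]]]].
  by case: (opair_inj _ _ _ _ e) => _ ->.
- move=> x y xa ya e; case: (H) => [_ [_]]; apply.
  + by apply/(Inj_app _ _ _ _ H xa).
  + by rewrite e; apply/(Inj_app _ _ _ _ H ya).
Qed.

Lemma Le_elim a b : Le a b -> exists F, Fn1 F /\ (forall x, x ∈ a -> F x ∈ b) /\
  (forall x y, x ∈ a -> y ∈ a -> F x = F y -> x = y).
Proof. by move=> [f /Inj_elim H]; exists (app f); split=> //; def. Qed.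

Lemma Le_trans a b c : Le a b -> Le b c -> Le a c.
Proof.
move=> /Le_elim [F [HF [F1 F2]]] /Le_elim [G [HG [G1 G2]]].
apply: (Le_intro (fun x => G (F x))); first by auto.
by move=> x y xa ya /G2 H; apply: F2 => //; apply: H; apply: F1.
Qed.

Lemma Le_sub a b : Sub a b -> Le a b.
Proof. by move=> H; apply: (Le_intro (fun x => x)). Qed.

(** [m_choice] may relate an element to many ordinals, but never two elements to the same one.
    Taking the least related ordinal gives an injective function, and the union of the successors
    bounds its values. *)
Lemma Le_Ord a : exists o, Ord o /\ Le a o.
Proof.
have [A [DA [A1 A2]]] := m_choice a; have HA : Def2 A := DA.
pose (F := fun x => iota (fun o => (Ord o /\ A x o) /\ forall o', Ord o' -> A x o' -> o = o' \/ o ∈ o')).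
have HF : Fn1 F by unfold F; def.
have FP x : x ∈ a -> Ord (F x) /\ A x (F x).
  move=> xa; have [o [Ao Oo]] := A1 x xa.
  have [|o' [H1 [H2 H3]]] := Ord_least (fun o => A x o); first by exists o.
  rewrite /F (iota_unique _ o'); [by split | by split |].
  move=> z [[Oz Az] Hz]; case: (H3 z Oz Az) => [->//|oz]; case: (Hz o' H1 H2) => // zo.
  by case: (mem_asym _ _ oz zo).
exists (Un (repl a (fun x => succ (F x)))); split.
  apply: Ord_Un => y /in_repl [x [xa ->]]; apply: Ord_succ; by case: (FP x xa).
apply: (Le_intro F).
- move=> x xa; apply/in_Un; exists (succ (F x)); split; first by apply/in_succ; right.
  by apply/in_repl; exists x.
- by move=> x y xa ya e; apply: (A2 x y (F x)); [case: (FP x xa) | rewrite e; case: (FP y ya)].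
Qed.

(** Collection bounds the witnesses by a set, and an injection of that set into an ordinal singles
    out the first one. The resulting function is definable, so it may enter separation and
    replacement; a choice function of the metatheory could not. *)
Lemma definable_choice (A : M -> M -> Prop) a : Def2 A -> (forall x, x ∈ a -> exists y, A x y) ->
  exists F, Fn1 F /\ forall x, x ∈ a -> A x (F x).
Proof.
move=> HA H; have [b Hb] := m_coll A HA a H.
have [o [Oo /Le_elim [K [HK [K1 K2]]]]] := Le_Ord b.
pose (F := fun x => iota (fun y => (y ∈ b /\ A x y) /\ forall z, z ∈ b -> A x z -> K y = K z \/ K y ∈ K z)).
exists F; split; first by unfold F; def.
move=> x xa; have [y [yb Axy]] := Hb x xa.
have [|k [Ok [[z [zb [Az e]]] Hk]]] := Ord_least (fun k => exists y, y ∈ b /\ A x y /\ k = K y).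
  by exists (K y); split; [apply: (Ord_in _ _ Oo); exact: K1 | exists y].
subst k; suff -> : F x = z by [].
apply: iota_unique.
- split=> // w wb Aw; apply: Hk; last by exists w.
  by apply: (Ord_in _ _ Oo); exact: K1.
- move=> w [[wb Aw] Hw]; apply: K2 => //.
  have [e|k1] := Hw z zb Az; first by [].
  have [//|k2] := Hk (K w) (Ord_in _ _ Oo (K1 _ wb)) (ex_intro _ w (conj wb (conj Aw eq_refl))).
  by case: (mem_asym _ _ k1 k2).
Qed.

Definition Emp x := forall z, ~ z ∈ x.
#[export] Instance Def_Emp : Def1 Emp. Proof. unfold Emp; def. Qed.
Lemma EmpE x : Emp x <-> x = emp.
Proof.
split=> [H|-> z]; last exact: in_emp.
by apply: ext => z; split=> K; [case: (H z K) | case: (in_emp z K)].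
Qed.
Definition Nat n := Ord n /\ forall m, m ∈ n \/ m = n -> Emp m \/ exists k, m = succ k.
#[export] Instance Def_Nat : Def1 Nat. Proof. unfold Nat; def. Qed.

Lemma Nat_emp : Nat emp.
Proof.
split; first by split=> x H; case: (in_emp x H).
by move=> m [H|->]; [case: (in_emp m H) | left; exact: in_emp].
Qed.

Lemma Nat_succ n : Nat n -> Nat (succ n).
Proof.
move=> [H1 H2]; split; first exact: Ord_succ.
move=> m [/in_succ H|->]; first exact: H2.
by right; exists n.
Qed.

Lemma Nat_in n k : Nat n -> k ∈ n -> Nat k.
Proof.
move=> [H1 H2] kn; split; first exact: (Ord_in _ _ H1).
move=> m [mk|->]; apply: H2; left=> //.
by case: H1 => /(_ k kn m mk).
Qed.

Lemma Nat_cases n : Nat n -> n = emp \/ exists k, Nat k /\ n = succ k.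
Proof.
move=> Hn; have [_ H] := Hn; case: (H n (or_intror eq_refl)) => [/EmpE|[k e]]; first by left.
by right; exists k; split=> //; apply: (Nat_in _ _ Hn); rewrite e; apply/in_succ; right.
Qed.

Definition ω := cset Nat.
Lemma Nat_ind (A : M -> Prop) : Def1 A -> A emp -> (forall k, Nat k -> A k -> A (succ k)) ->
  forall n, Nat n -> A n.
Proof.
move=> HA A0 AS; apply: (mem_ind (fun n => Nat n -> A n)) => n IH Hn.
case: (Nat_cases n Hn) => [->//|[k [Hk e]]]; subst n.
by apply: AS => //; apply: IH => //; apply/in_succ; right.
Qed.

Lemma in_ω n : n ∈ ω <-> Nat n.
Proof.
have [w [[e [ew /EmpE He]] Hw]] := @m_inf M HM; subst e.
apply: (cset_sub _ w); apply: Nat_ind => // k Hk kw.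
have [m [mw Hm]] := Hw k kw; have -> // : succ k = m.
by apply: ext => z; rewrite in_succ Hm.
Qed.

Lemma Ord_ω : Ord ω.
Proof.
split=> x /in_ω Hx; last by case: Hx => [[]].
by move=> z zx; apply/in_ω; exact: (Nat_in _ _ Hx zx).
Qed.

Definition Ctbl a := Le a ω.
#[export] Instance Def_Ctbl : Def1 Ctbl. Proof. unfold Ctbl; def. Qed.
End Ordinals.

(** * Countable sets and transitive closures *)

Section Countable.
Context {M : Type} {HM : Model M}.
Implicit Types (a b c d h k m n x y z u v w f t : M).

(** Ordinal addition: [m + k = m ∪ {m + j : j ∈ k}]. *)
Definition oadd m := mrec (fun _ I => cup m I).
Lemma Fn_oadd1 m : Fn1 (oadd m). Proof. unfold oadd; apply: Fn_mrec. Qed.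
Lemma oaddE m k x : x ∈ oadd m k <-> x ∈ m \/ exists j, j ∈ k /\ x = oadd m j.
Proof.
by rewrite {1}/oadd mrec_eq in_cup -/(oadd m) (in_repl _ _ (Fn_oadd1 m)).
Qed.
#[export] Instance Fn_oadd : Fn2 oadd.
Proof. unfold oadd, mrec, rec, value, attempt, restr, ran; def. Qed.

Lemma oadd_lt m j k : j ∈ k -> oadd m j ∈ oadd m k.
Proof. by move=> jk; apply/oaddE; right; exists j. Qed.

Lemma oadd_succ m k : oadd m (succ k) = succ (oadd m k).
Proof.
apply: ext => x; rewrite in_succ !oaddE; split.
- move=> [xm|[j [/in_succ [jk|->] ->]]]; [by left; left | by left; right; exists j | by right].
- move=> [[xm|[j [jk ->]]]|->]; first by left.
  + by right; exists j; rewrite in_succ; split=> //; left.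
  + by right; exists k; rewrite in_succ; split=> //; right.
Qed.

Lemma oadd_emp m : oadd m emp = m.
Proof.
apply: ext => x; rewrite oaddE; split; last by left.
by move=> [//|[j [H _]]]; case: (in_emp j H).
Qed.

Lemma Nat_oadd m k : Nat m -> Nat k -> Nat (oadd m k).
Proof.
move=> Hm; move: k; apply: Nat_ind; first by rewrite oadd_emp.
by move=> k _ H; rewrite oadd_succ; exact: Nat_succ.
Qed.

Lemma oadd_inj m j k : Nat j -> Nat k -> oadd m j = oadd m k -> j = k.
Proof.
move=> [Oj _] [Ok _] e; case: (Ord_trich _ _ Oj Ok) => [H|[//|H]]; move: (oadd_lt m _ _ H);
by rewrite e => K; case: (mem_irrefl _ K).
Qed.

Lemma succ_inj j k : succ j = succ k -> j = k.
Proof.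
move=> e; have: j ∈ succ k by rewrite -e; apply/in_succ; right.
have: k ∈ succ j by rewrite e; apply/in_succ; right.
move=> /in_succ [H1|//] /in_succ [H2|//]; case: (mem_asym _ _ H1 H2).
Qed.

(** [tri 0 = 0] and [tri (k + 1) = tri k + (k + 1)], so that
    [(a, b) ↦ tri (a + b) + a] is injective. *)
Definition trig n g := Un (cset (fun s => exists j y, opair j y ∈ g /\ n = succ j /\ s = oadd y (succ j))).
Definition tri := rec (fun x => x) trig.
Instance Fn_trig : Fn2 trig. Proof. unfold trig; def. Qed.
Instance Fn_tri : Fn1 tri. Proof. apply: Fn_rec. Qed.

Lemma tri_graph n : tri n = trig n (repl n (fun v => opair v (tri v))).
Proof. by rewrite {1}/tri rec_eq // => A HA; apply: mem_ind. Qed.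

Lemma tri_succ k : tri (succ k) = oadd (tri k) (succ k).
Proof.
rewrite tri_graph /trig.
have -> : cset (fun s => exists j y, opair j y ∈ repl (succ k) (fun v => opair v (tri v)) /\
    succ k = succ j /\ s = oadd y (succ j)) = pair (oadd (tri k) (succ k)) (oadd (tri k) (succ k)).
  apply: cset_eq => s; rewrite in_pair; split.
  - move=> H; have -> : s = oadd (tri k) (succ k) by tauto.
    exists k, (tri k); split=> //; apply/in_repl; exists k; split=> //; apply/in_succ; by right.
  - move=> [j [y [/in_repl [v [_ e]] [/succ_inj e' ->]]]]; subst j.
    by case: (opair_inj _ _ _ _ e) => <- ->; left.
by apply: ext => x; rewrite in_Un; split=> [[y [xy /in_pair [] <-]]//|H]; exists (oadd (tri k) (succ k)); rewrite in_pair; tauto.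
Qed.

Lemma tri_emp : tri emp = emp.
Proof.
apply: ext => x; split=> [|H]; last by case: (in_emp x H).
rewrite tri_graph /trig in_Un => -[y [_]].
rewrite (cset_sub _ emp) => [[j [z [/in_repl [v [H _]]]]]|j]; first by case: (in_emp v H).
by move=> [v [z [/in_repl [t [H _]]]]]; case: (in_emp t H).
Qed.

Lemma Nat_tri n : Nat n -> Nat (tri n).
Proof.
move: n; apply: Nat_ind; first by rewrite tri_emp; exact: Nat_emp.
by move=> k Hk H; rewrite tri_succ; apply: Nat_oadd => //; exact: Nat_succ.
Qed.

Lemma tri_lt n n' : Nat n' -> n ∈ n' -> Sub (oadd (tri n) (succ n)) (tri n').
Proof.
move=> Hn'; move: n' Hn' n; apply: (Nat_ind (fun n' => forall n, n ∈ n' -> Sub (oadd (tri n) (succ n)) (tri n'))).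
  by move=> n H; case: (in_emp n H).
move=> k Hk IH n /in_succ [nk|->]; rewrite tri_succ => // x xn.
by apply/oaddE; left; apply: (IH n nk).
Qed.

(** Cantor pairing. As [a] is below [a + b + 1], the code of [(a, b)] is below [tri (a + b + 1)];
    distinct sums thus give codes in disjoint intervals, and within one interval the offset is
    [a]. *)
Lemma ω_prod : Le (prod ω ω) ω.
Proof.
pose (F := fun u => iota (fun w => exists a b, u = opair a b /\ w = oadd (tri (oadd a b)) a)).
have HF : Fn1 F by unfold F; def.
have FE a b : F (opair a b) = oadd (tri (oadd a b)) a.
  apply: iota_unique; first by exists a, b.
  by move=> z [a' [b' [e ->]]]; case: (opair_inj _ _ _ _ e) => -> ->.
have lt a b a' b' : Nat a -> Nat b -> Nat a' -> Nat b' -> oadd a b ∈ oadd a' b' ->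
    oadd (tri (oadd a b)) a ∈ oadd (tri (oadd a' b')) a'.
  move=> Ha Hb Ha' Hb' H; apply/oaddE; left; apply: (tri_lt (oadd a b)) => //; first exact: Nat_oadd.
  apply: oadd_lt; apply/in_succ.
  move: b Hb {H}; apply: Nat_ind; first by right; rewrite oadd_emp.
  move=> k Hk; rewrite oadd_succ in_succ => -[H|e]; first by left; left.
  by left; right.
apply: (Le_intro F).
- move=> u /in_prod [a [b [/in_ω Ha [/in_ω Hb ->]]]]; rewrite FE; apply/in_ω.
  apply: Nat_oadd => //; apply: Nat_tri; exact: Nat_oadd.
- move=> u v /in_prod [a [b [/in_ω Ha [/in_ω Hb ->]]]] /in_prod [a' [b' [/in_ω Ha' [/in_ω Hb' ->]]]].
  rewrite !FE => e.
  have [O1 _] := Nat_oadd _ _ Ha Hb; have [O2 _] := Nat_oadd _ _ Ha' Hb'.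
  case: (Ord_trich _ _ O1 O2) => [H|[e'|H]].
  + by move: (lt _ _ _ _ Ha Hb Ha' Hb' H); rewrite e => K; case: (mem_irrefl _ K).
  + rewrite e' in e; have ea := oadd_inj _ _ _ Ha Ha' e; subst a'.
    by rewrite (oadd_inj _ _ _ Hb Hb' e').
  + by move: (lt _ _ _ _ Ha' Hb' Ha Hb H); rewrite e => K; case: (mem_irrefl _ K).
Qed.

(** An element may have many indices as long as an index determines its element; choice then fixes
    one index each. This form suits names, whose indices are not unique. *)
Lemma Ctbl_cover (A : M -> M -> Prop) d : Def2 A ->
  (forall x, x ∈ d -> exists k, k ∈ ω /\ A k x) ->
  (forall k x x', x ∈ d -> x' ∈ d -> A k x -> A k x' -> x = x') -> Ctbl d.
Proof.
move=> HA H1 H2; have [F [HF HF']] := definable_choice (fun x k => k ∈ ω /\ A k x) d _ H1.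
apply: (Le_intro F); first by move=> x /HF' [].
by move=> x y xd yd e; apply: (H2 (F x)) => //; [case: (HF' x xd) | rewrite e; case: (HF' y yd)].
Qed.

Lemma Ctbl_image a F : Fn1 F -> Ctbl a -> Ctbl (repl a F).
Proof.
move=> HF Ca; have [K [HK [K1 K2]]] := Le_elim _ _ Ca.
apply: (Ctbl_cover (fun k x => exists z, z ∈ a /\ k = K z /\ x = F z)).
- move=> x /in_repl [z [za ->]]; exists (K z); split; first exact: K1.
  by exists z.
- by move=> k x x' _ _ [z [za [e1 ->]]] [z' [za' [e2 ->]]]; rewrite (K2 z z') // -e1.
Qed.

Lemma Ctbl_sub a b : Sub a b -> Ctbl b -> Ctbl a.
Proof. move=> H; exact: (Le_trans _ _ _ (Le_sub _ _ H)). Qed.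

Lemma Ctbl_Un d : Ctbl d -> (forall n, n ∈ d -> Ctbl n) -> Ctbl (Un d).
Proof.
move=> Cd H; have [g [Hg [g1 g2]]] := Le_elim _ _ Cd.
have [f [Hf f1]] := definable_choice (fun n f => Inj f n ω) d _ H.
have [|N [HN N1]] := definable_choice (fun x n => x ∈ n /\ n ∈ d) (Un d) _.
  by move=> x /in_Un.
apply: Le_trans ω_prod; apply: (Le_intro (fun x => opair (g (N x)) (app (f (N x)) x))).
- move=> x /N1 [xN Nd]; apply/opair_in_prod; split; first exact: g1.
  by case: (Inj_elim _ _ _ (f1 _ Nd)) => K _; exact: K.
- move=> x y /N1 [xN Nd] /N1 [yN Nd'] e; case: (opair_inj _ _ _ _ e) => {}e e2.
  have e1 := g2 _ _ Nd Nd' e; rewrite -e1 in e2 yN.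
  by case: (Inj_elim _ _ _ (f1 _ Nd)) => _; apply.
Qed.

Lemma Ctbl_emp : Ctbl emp.
Proof. by apply: Le_sub => x H; case: (in_emp x H). Qed.

Lemma Ctbl_pair a b : Ctbl (pair a b).
Proof.
apply: (Ctbl_cover (fun k x => (k = emp /\ x = a) \/ (k <> emp /\ x = b))).
- move=> x /in_pair [->|->].
  + by exists emp; split; [apply/in_ω; exact: Nat_emp | left].
  + exists (succ emp); split; first by apply/in_ω; apply: Nat_succ; exact: Nat_emp.
    right; split=> // e; case: (in_emp emp); rewrite -{2}e; apply/in_succ; by right.
- move=> k x x' _ _; intuition congruence.
Qed.

Lemma Ctbl_cup a b : Ctbl a -> Ctbl b -> Ctbl (cup a b).
Proof. by move=> Ha Hb; apply: Ctbl_Un; [exact: Ctbl_pair | move=> x /in_pair [] ->]. Qed.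

Lemma Ctbl_closure F h m : Fn1 F -> Ctbl m -> Sub m h ->
  (forall x, x ∈ h -> Ctbl (F x) /\ Sub (F x) h) ->
  exists n, Ctbl n /\ Sub m n /\ Sub n h /\ forall x, x ∈ n -> Sub (F x) n.
Proof.
move=> HF Cm mh Hh.
pose (st := fun y => cup y (Un (repl y F))).
have Hst : Fn1 st by unfold st; def.
have stE y x : x ∈ st y <-> x ∈ y \/ exists z, z ∈ y /\ x ∈ F z.
  rewrite in_cup in_Un; split=> [[?|[w [xw /in_repl [z [zy e]]]]]|[?|[z [zy H]]]].
  - by left.
  - by subst w; right; exists z.
  - by left.
  - by right; exists (F z); split=> //; apply/in_repl; exists z.
pose (G := fun _ I : M => cup m (Un (repl I st))).
have HG : Fn2 G by unfold G; def.
pose (S := mrec G); have HS : Fn1 S by exact: Fn_mrec.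
have SE k x : x ∈ S k <-> x ∈ m \/ exists j, j ∈ k /\ x ∈ st (S j).
  rewrite {1}/S mrec_eq -/S {1}/G in_cup in_Un; split=> [[?|[y [xy]]]|[?|[j [jk H]]]].
  - by left.
  - rewrite in_repl => -[z [/in_repl [j [jk ->]] e]]; subst y; by right; exists j.
  - by left.
  - right; exists (st (S j)); split=> //; apply/in_repl; exists (S j); split=> //.
    by apply/in_repl; exists j.
have Sh k : Sub (S k) h.
  move: k; apply: (mem_ind (fun k => Sub (S k) h)) => k IH x /SE [/mh//|[j [jk /stE]]].
  by move=> [/(IH j jk)//|[z [/(IH j jk) zh xz]]]; case: (Hh z zh) => _; apply.
have CS k : Nat k -> Ctbl (S k).
  move: k; apply: (mem_ind (fun k => Nat k -> Ctbl (S k))) => k IH Hk.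
  rewrite /S mrec_eq -/S /G; apply: Ctbl_cup => //; apply: Ctbl_Un.
    apply: Ctbl_image; apply: Ctbl_image; apply: Ctbl_sub (Le_sub _ _ (fun x H => H)).
    by move=> x xk; apply/in_ω; exact: (Nat_in _ _ Hk xk).
  move=> y /in_repl [z [/in_repl [j [jk ->]] ->]].
  have Cj := IH j jk (Nat_in _ _ Hk jk).
  apply: Ctbl_cup => //; apply: Ctbl_Un; first exact: Ctbl_image.
  by move=> w /in_repl [x [/Sh xh ->]]; case: (Hh x xh).
exists (Un (repl ω S)); split; [|split; [|split]].
- apply: Ctbl_Un; first by apply: Ctbl_image; exact: Le_sub.
  by move=> n /in_repl [k [/in_ω Hk ->]]; exact: CS.
- move=> x xm; apply/in_Un; exists (S emp); split; first by apply/SE; left.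
  by apply/in_repl; exists emp; split=> //; apply/in_ω; exact: Nat_emp.
- by move=> x /in_Un [y [xy /in_repl [k [_ e]]]]; subst y; exact: (Sh k).
- move=> x /in_Un [y [xy /in_repl [k [/in_ω Hk e]]]] w wx; subst y.
  apply/in_Un; exists (S (succ k)); split.
    apply/SE; right; exists k; split; first by apply/in_succ; right.
    by apply/stE; right; exists x.
  by apply/in_repl; exists (succ k); split=> //; apply/in_ω; exact: Nat_succ.
Qed.

Definition trc := mrec (fun x I => cup x (Un I)).
#[export] Instance Fn_trc : Fn1 trc. Proof. exact: Fn_mrec. Qed.
Lemma trcE x z : z ∈ trc x <-> z ∈ x \/ exists y, y ∈ x /\ z ∈ trc y.
Proof.
rewrite /trc {1}mrec_eq -/trc in_cup in_Un; split=> [[?|[y [zy /in_repl [w [wx e]]]]]|[?|[y [yx zy]]]].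
- by left.
- by subst y; right; exists w.
- by left.
- by right; exists (trc y); split=> //; apply/in_repl; exists y.
Qed.

Lemma trc_sub x : Sub x (trc x).
Proof. by move=> z zx; apply/trcE; left. Qed.

Lemma trc_Tr x : Tr (trc x).
Proof.
move: x; apply: (mem_ind (fun x => Tr (trc x))) => x IH z /trcE [zx|[y [yx zy]]] w wz.
- by apply/trcE; right; exists z; split=> //; exact: trc_sub.
- by apply/trcE; right; exists y; split=> //; exact: (IH y yx z zy).
Qed.

Lemma trc_min x s : Tr s -> Sub x s -> Sub (trc x) s.
Proof.
move=> Hs; move: x; apply: (mem_ind (fun x => Sub x s -> Sub (trc x) s)) => x IH xs z /trcE [/xs//|[y [yx]]].
by apply: IH => //; apply: Hs; exact: xs.
Qed.
End Countable.

(** * The sets of hereditary cardinality below a cardinal *)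

Section Hereditary.
Context {M : Type} {HM : Model M}.
Implicit Types (a b c d h k l m n x y z u v w f t : M).

(** A transitive set is determined by the relation [u ∈ w \/ u = w] on it, up to
    isomorphism. *)
Definition code f t := cset (fun v => exists u w, u ∈ t /\ w ∈ t /\ (u ∈ w \/ u = w) /\
  v = opair (app f u) (app f w)).
Instance Fn_code : Fn2 code. Proof. unfold code; def. Qed.

Lemma in_code f t l v : Inj f t l ->
  v ∈ code f t <-> exists u w, u ∈ t /\ w ∈ t /\ (u ∈ w \/ u = w) /\ v = opair (app f u) (app f w).
Proof.
move=> Hf; have [H _] := Inj_elim _ _ _ Hf; apply: (cset_sub _ (prod l l)).
by move=> z [u [w [ut [wt [_ ->]]]]]; apply/opair_in_prod; split; exact: H.
Qed.

Lemma code_mem f t f' t' l : Tr t -> Tr t' -> Inj f t l -> Inj f' t' l -> code f t = code f' t' ->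
  forall u, u ∈ t -> forall u', u' ∈ t' -> app f u = app f' u' -> u = u'.
Proof.
move=> Tt Tt' Hf Hf' e.
have [_ I1] := Inj_elim _ _ _ Hf; have [_ I2] := Inj_elim _ _ _ Hf'.
apply: (mem_ind (fun u => u ∈ t -> forall u', u' ∈ t' -> app f u = app f' u' -> u = u')).
move=> u IH ut u' ut' eu.
have K1 z : z ∈ u -> z ∈ u'.
  move=> zu; have zt := Tt u ut z zu.
  have: opair (app f z) (app f u) ∈ code f t.
    by apply/(in_code _ _ _ _ Hf); exists z, u; do 3 (split; [by auto|]).
  rewrite e => /(in_code _ _ _ _ Hf') [z' [w' [zt' [wt' [zw e']]]]].
  case: (opair_inj _ _ _ _ e') => ez ew.
  have ? : w' = u' by apply: I2 => //; rewrite -ew.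
  subst w'; have ? : z = z' by exact: IH.
  subst z'; case: zw => // ?; subst z.
  have K : u = u' by apply: I1 => //; congruence.
  by case: (mem_irrefl u); rewrite {1}K.
have K2 z : z ∈ u' -> z ∈ u.
  move=> zu; have zt := Tt' u' ut' z zu.
  have: opair (app f' z) (app f' u') ∈ code f' t'.
    by apply/(in_code _ _ _ _ Hf'); exists z, u'; do 3 (split; [by auto|]).
  rewrite -e => /(in_code _ _ _ _ Hf) [z' [w' [zt' [wt' [zw e']]]]].
  case: (opair_inj _ _ _ _ e') => ez ew.
  have ? : w' = u by apply: I1 => //; rewrite -ew.
  subst w'; case: zw => H.
  - by have <- : z' = z by exact: IH.
  - subst z'; have K : z = u' by apply: I2 => //; congruence.
    by case: (mem_irrefl u'); rewrite -{1}K.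
by apply: ext => z; split; [exact: K1 | exact: K2].
Qed.

(** [code_mem] identifies elements having the same index, by ∈-induction. The reflexive pairs in the
    code make every element of the set visible, even one that is related to no other by
    membership. *)
Lemma code_inj f t f' t' l : Tr t -> Tr t' -> Inj f t l -> Inj f' t' l -> code f t = code f' t' -> t = t'.
Proof.
have sub f1 t1 f2 t2 : Tr t1 -> Tr t2 -> Inj f1 t1 l -> Inj f2 t2 l -> code f1 t1 = code f2 t2 -> Sub t1 t2.
  move=> T1 T2 H1 H2 e u ut.
  have: opair (app f1 u) (app f1 u) ∈ code f1 t1.
    by apply/(in_code _ _ _ _ H1); exists u, u; do 3 (split; [by auto|]).
  rewrite e => /(in_code _ _ _ _ H2) [u' [w [ut' [_ [_ e']]]]]; case: (opair_inj _ _ _ _ e') => eu _.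
  by rewrite (code_mem _ _ _ _ _ T1 T2 H1 H2 e u ut u' ut' eu).
move=> T1 T2 H1 H2 e; apply: ext => z; split; [exact: (sub f t f' t') | exact: (sub f' t' f t)].
Qed.

(** A transitive set that injects into [l] can be recovered from a subset of [prod l l], so
    replacement over the power set of that product bounds all of them. [H(k)] becomes a set in this
    way, without the cumulative hierarchy. *)
Lemma transitive_bound l : exists T, forall t, Tr t -> Le t l -> t ∈ T.
Proof.
have [|b Hb] := repl_bound (fun e t => Tr t /\ exists f, Inj f t l /\ e = code f t) (pow (prod l l)).
- move=> e t t' [T1 [f [H1 e1]]] [T2 [f' [H2 e2]]]; apply: (code_inj f t f' t' l) => //; congruence.
- exists b => t Tt [f Hf]; apply: (Hb (code f t)); last by split=> //; exists f.
  apply/in_pow => v /(in_code _ _ _ _ Hf) [u [w [ut [wt [_ ->]]]]].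
  by have [H _] := Inj_elim _ _ _ Hf; apply/opair_in_prod; split; exact: H.
Qed.

Definition InH k x := Le (trc x) k /\ ~ Le k (trc x).
#[export] Instance Def_InH : Def2 InH. Proof. unfold InH; def. Qed.

Lemma H_exists k : exists h, forall x, x ∈ h <-> InH k x.
Proof.
have [T HT] := transitive_bound k.
exists (sep (Un (repl T pow)) (fun x => InH k x)) => x; rewrite in_sep; split=> [[]//|H]; split=> //.
apply/in_Un; exists (pow (trc x)); split; first by apply/in_pow; exact: trc_sub.
apply/in_repl; exists (trc x); split=> //; apply: HT; first exact: trc_Tr.
by case: H.
Qed.

Definition Card k := Ord k /\ forall a, a ∈ k -> ~ Le k a.
#[export] Instance Def_Card : Def1 Card. Proof. unfold Card; def. Qed.
Definition UCO R l := Card l /\ ~ Ctbl l /\ forall x, x ∈ R -> InH l x.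
#[export] Instance Def_UCO : Def2 UCO. Proof. unfold UCO; def. Qed.
Definition IsLam l R := UCO R l /\ forall k, UCO R k -> l ∈ k \/ l = k.

(** The Hartogs construction: [κ] consists of the ordinals that inject into [α], and an injection of
    [κ] into [α] would put [κ] into itself. Joining [ω] to [o] makes [κ] uncountable. *)
Lemma UCO_exists R : exists l, UCO R l.
Proof.
have [o [Oo So]] := Le_Ord (trc R).
pose (α := cup o ω); have Oα : Ord α by exact: (Ord_cup _ _ Oo Ord_ω).
have [T HT] := transitive_bound α.
pose (κ := sep T (fun b => Ord b /\ Le b α)).
have Hκ b : b ∈ κ <-> Ord b /\ Le b α.
  by rewrite in_sep; split=> [[]//|H]; split=> //; apply: HT; case: H => [[]].
have Oκ : Ord κ.
  split=> b /Hκ [Ob Lb]; last by case: Ob.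
  move=> c cb; apply/Hκ; split; first exact: (Ord_in _ _ Ob cb).
  by apply: Le_trans Lb; apply: Le_sub; case: Ob => /(_ c cb).
have nκ : ~ Le κ α by move=> H; apply: (mem_irrefl κ); apply/Hκ.
have ακ : α ∈ κ by apply/Hκ; split=> //; exact: Le_sub.
exists κ; split; [split=> // b /Hκ [_ Lb] H; apply: nκ; exact: Le_trans Lb | split].
- by move=> H; apply: nκ; apply: Le_trans H _; apply: Le_sub => x ?; apply/in_cup; right.
- move=> x xR; have Lx : Le (trc x) α.
    apply: (Le_trans _ o); last by apply: Le_sub => z ?; apply/in_cup; left.
    by apply: Le_trans So; apply: Le_sub => z ?; apply/trcE; right; exists x.
  split; last by move=> H; apply: nκ; exact: (Le_trans _ _ _ H Lx).
  by apply: (Le_trans _ _ _ Lx); apply: Le_sub; case: Oκ => /(_ _ ακ).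
Qed.

Lemma Lam_exists R : exists l, IsLam l R.
Proof.
have [l0 H0] := UCO_exists R.
have [|l [_ [H1 H2]]] := Ord_least (fun l => UCO R l); first by exists l0; split=> //; case: (H0) => [[]].
exists l; split=> // k Hk; case: (H2 k _ Hk); first by case: (Hk) => [[]].
- by right.
- by left.
Qed.
End Hereditary.

(** * Satisfaction of the formulas *)

Section SemIff.
Context {M : Type} (inr eqr : M -> M -> Prop).
Notation sm := (sem inr eqr).
Lemma SI_Imp (a b : fm M) P Q : (sm a <-> P) -> (sm b <-> Q) -> (sm (Imp a b) <-> (P -> Q)).
Proof. cbn; tauto. Qed.
Lemma SI_Iff (a b : fm M) P Q : (sm a <-> P) -> (sm b <-> Q) -> (sm (Iff a b) <-> (P <-> Q)).
Proof. cbn; tauto. Qed.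
Lemma SI_Or (a b : fm M) P Q : (sm a <-> P) -> (sm b <-> Q) -> (sm (Or a b) <-> (P \/ Q)).
Proof. cbn; tauto. Qed.
Lemma SI_And (a b : fm M) P Q : (sm a <-> P) -> (sm b <-> Q) -> (sm (And a b) <-> (P /\ Q)).
Proof. cbn; tauto. Qed.
Lemma SI_Not (a : fm M) P : (sm a <-> P) -> (sm (Not a) <-> ~ P).
Proof. cbn; tauto. Qed.
Lemma SI_All (F : M -> fm M) P : (forall x, sm (F x) <-> P x) -> (sm (All F) <-> forall x, P x).
Proof. by move=> H; split=> K x; apply/H; apply: K. Qed.
Lemma SI_Ex (F : M -> fm M) P : (forall x, sm (F x) <-> P x) -> (sm (Ex F) <-> exists x, P x).
Proof.
move=> H; split=> [K|[x Hx] K]; last by apply: (K x); apply/H.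
by apply: NNPP => nK; apply: K => x /H Hx; apply: nK; exists x.
Qed.
Lemma SI_In x y : sm (In x y) <-> inr x y. Proof. by []. Qed.
Lemma SI_Eq x y : sm (Eq x y) <-> eqr x y. Proof. by []. Qed.
End SemIff.

Ltac sat_lemma := fail.
(** The right-hand side is usually an existential variable: the meaning is synthesised from the
    syntax, derived connectives being read classically and known formulas through [sat_lemma]. *)
Ltac sati := cbv beta;
  lazymatch goal with
  | |- sem _ _ (Imp _ _) <-> _ => eapply SI_Imp; [sati | sati]
  | |- sem _ _ (Iff _ _) <-> _ => eapply SI_Iff; [sati | sati]
  | |- sem _ _ (Or _ _) <-> _ => eapply SI_Or; [sati | sati]
  | |- sem _ _ (And _ _) <-> _ => eapply SI_And; [sati | sati]
  | |- sem _ _ (Not _) <-> _ => eapply SI_Not; sati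
  | |- sem _ _ (All _) <-> _ => eapply SI_All; intro; sati
  | |- sem _ _ (Ex _) <-> _ => eapply SI_Ex; intro; sati
  | |- sem _ _ (In _ _) <-> _ => eapply SI_In
  | |- sem _ _ (Eq _ _) <-> _ => eapply SI_Eq
  | |- sem _ _ _ <-> _ => first [sat_lemma | reflexivity]
  end.
Ltac satn := eapply iff_trans; [sati | cbv beta].

Create HintDb sat.
Section Sat.
Ltac sat_lemma ::= solve [auto 1 with sat nocore].
Context {M : Type} {HM : Model M}.
Implicit Types (a b c d h k l m n p q x y z u v w f t R le : M).

Lemma sat_sub x y : sat (sub x y) <-> Sub x y.
Proof. unfold sub; satn. reflexivity. Qed.
#[local] Hint Extern 0 (sem _ _ (sub _ _) <-> _) => refine (sat_sub _ _) : sat.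

Lemma sat_isOPair u x y : sat (isOPair u x y) <-> u = opair x y.
Proof.
have P v a b : (forall z, z ∈ v <-> z = a \/ z = b) <-> v = pair a b.
  split=> [H|-> z]; last exact: in_pair.
  by apply: ext => z; rewrite H in_pair.
unfold isOPair, isPair. satn. setoid_rewrite P.
split=> [[a [b [-> [-> ->]]]] //|->].
by exists (pair x x), (pair x y).
Qed.
#[local] Hint Extern 0 (sem _ _ (isOPair _ _ _) <-> _) => refine (sat_isOPair _ _ _) : sat.

Lemma sat_pairIn x y r : sat (pairIn x y r) <-> opair x y ∈ r.
Proof.
unfold pairIn; satn.
by split=> [[u [-> //]]|H]; exists (opair x y).
Qed.
#[local] Hint Extern 0 (sem _ _ (pairIn _ _ _) <-> _) => refine (sat_pairIn _ _ _) : sat.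

Lemma sat_tripleIn x y z r : sat (tripleIn x y z r) <-> opair x (opair y z) ∈ r.
Proof.
unfold tripleIn; satn.
by split=> [[u [-> //]]|H]; exists (opair y z).
Qed.
#[local] Hint Extern 0 (sem _ _ (tripleIn _ _ _ _) <-> _) => refine (sat_tripleIn _ _ _ _) : sat.

Lemma sat_isInjection f a b : sat (isInjection f a b) <-> Inj f a b.
Proof.
unfold isInjection; satn.
reflexivity.
Qed.
#[local] Hint Extern 0 (sem _ _ (isInjection _ _ _) <-> _) => refine (sat_isInjection _ _ _) : sat.

Lemma sat_cardLe a b : sat (cardLe a b) <-> Le a b.
Proof. unfold cardLe; satn; reflexivity. Qed.
#[local] Hint Extern 0 (sem _ _ (cardLe _ _) <-> _) => refine (sat_cardLe _ _) : sat.

Lemma sat_transitive t : sat (Defs.transitive t) <-> Tr t.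
Proof. unfold Defs.transitive; satn; reflexivity. Qed.
#[local] Hint Extern 0 (sem _ _ (Defs.transitive _) <-> _) => refine (sat_transitive _) : sat.

Lemma sat_ordinal t : sat (ordinal t) <-> Ord t.
Proof. unfold ordinal; satn; reflexivity. Qed.
#[local] Hint Extern 0 (sem _ _ (ordinal _) <-> _) => refine (sat_ordinal _) : sat.

Lemma sat_isNat n : sat (isNat n) <-> Nat n.
Proof.
unfold isNat, isEmpty, isSucc; satn.
have K m k : (forall z, z ∈ m <-> z ∈ k \/ z = k) <-> m = succ k.
  split=> [H|->] //; last exact: in_succ.
  by apply: ext => z; rewrite H in_succ.
setoid_rewrite K; reflexivity.
Qed.
#[local] Hint Extern 0 (sem _ _ (isNat _) <-> _) => refine (sat_isNat _) : sat.

Lemma sat_isOmega w : sat (isOmega w) <-> w = ω.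
Proof.
unfold isOmega; satn; split=> [H|-> n]; last exact: in_ω.
by apply: ext => z; rewrite H in_ω.
Qed.
#[local] Hint Extern 0 (sem _ _ (isOmega _) <-> _) => refine (sat_isOmega _) : sat.

Lemma sat_countable a : sat (countable a) <-> Ctbl a.
Proof.
unfold countable; satn.
by split=> [[w [-> //]]|H]; exists ω.
Qed.
#[local] Hint Extern 0 (sem _ _ (countable _) <-> _) => refine (sat_countable _) : sat.

Lemma sat_isTrcl t x : sat (isTrcl t x) <-> t = trc x.
Proof.
unfold isTrcl; satn.
split=> [[H1 [H2 H3]]|->].
- apply: ext => z; split; last exact: trc_min.
  by apply: H3; [exact: trc_Tr | exact: trc_sub].
- by split; [exact: trc_Tr | split; [exact: trc_sub | move=> s; exact: trc_min]].
Qed.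
#[local] Hint Extern 0 (sem _ _ (isTrcl _ _) <-> _) => refine (sat_isTrcl _ _) : sat.

Lemma sat_inH k x : sat (inH k x) <-> InH k x.
Proof.
unfold inH, cardLt; satn.
by split=> [[t [-> //]]|H]; exists (trc x).
Qed.
#[local] Hint Extern 0 (sem _ _ (inH _ _) <-> _) => refine (sat_inH _ _) : sat.

Lemma sat_isH h k : sat (isH h k) <-> forall x, x ∈ h <-> InH k x.
Proof. unfold isH; satn; reflexivity. Qed.
#[local] Hint Extern 0 (sem _ _ (isH _ _) <-> _) => refine (sat_isH _ _) : sat.

Lemma sat_uncountableCardinalOver R l : sat (uncountableCardinalOver R l) <-> UCO R l.
Proof.
unfold uncountableCardinalOver, cardinal; satn.
reflexivity.
Qed.
#[local] Hint Extern 0 (sem _ _ (uncountableCardinalOver _ _) <-> _) => refine (sat_uncountableCardinalOver _ _) : sat.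

Lemma sat_isLambda l R : sat (isLambda l R) <-> IsLam l R.
Proof. unfold isLambda; satn; reflexivity. Qed.
#[local] Hint Extern 0 (sem _ _ (isLambda _ _) <-> _) => refine (sat_isLambda _ _) : sat.

Definition Pw1 h n := Sub n h /\ Ctbl n.
#[export] Instance Def_Pw1 : Def2 Pw1. Proof. unfold Pw1; def. Qed.
Lemma sat_inPω1 h n : sat (inPω1 h n) <-> Pw1 h n.
Proof. unfold inPω1; satn; reflexivity. Qed.
#[local] Hint Extern 0 (sem _ _ (inPω1 _ _) <-> _) => refine (sat_inPω1 _ _) : sat.

Definition Club c h :=
  (forall n, n ∈ c -> Pw1 h n) /\
  (forall m, Pw1 h m -> exists n, n ∈ c /\ Sub m n) /\
  (forall d, Sub d c -> ~ Emp d -> Ctbl d ->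
    (forall m, m ∈ d -> forall n, n ∈ d -> Sub m n \/ Sub n m) -> Un d ∈ c).
Lemma sat_isClub c h : sat (isClub c h) <-> Club c h.
Proof.
unfold isClub, isUnion, isChain, isEmpty; satn.
have K u d : (forall z, z ∈ u <-> exists n, n ∈ d /\ z ∈ n) <-> u = Un d.
  split=> [H|-> z].
  - apply: ext => z; rewrite H in_Un; firstorder.
  - rewrite in_Un; firstorder.
setoid_rewrite K; unfold Club, Emp; split=> -[H1 [H2 H3]]; split=> //; split=> // d A1 A2 A3 A4.
- exact: (H3 d).
- by move=> u ->; apply: H3.
Qed.
#[local] Hint Extern 0 (sem _ _ (isClub _ _) <-> _) => refine (sat_isClub _ _) : sat.

Definition lep le p q := opair p q ∈ le.
#[export] Instance Def_lep : Def3 lep. Proof. unfold lep; def. Qed.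
Definition Poset R le :=
  (exists p, p ∈ R) /\ (forall p, p ∈ R -> lep le p p) /\
  (forall p q r, p ∈ R -> q ∈ R -> r ∈ R -> lep le p q -> lep le q r -> lep le p r).
Lemma sat_forcingPoset R le : sat (forcingPoset R le) <-> Poset R le.
Proof.
unfold forcingPoset, isEmpty; satn.
unfold Poset, lep; split=> -[H1 [H2 H3]]; split.
- by apply: NNPP => H; apply: H1 => z zR; apply: H; exists z.
- by split=> // p q r Hp Hq Hr; apply: H3.
- by case: H1 => p Hp /(_ p).
- by split=> // p Hp q Hq r Hr; apply: H3.
Qed.
#[local] Hint Extern 0 (sem _ _ (forcingPoset _ _) <-> _) => refine (sat_forcingPoset _ _) : sat.

Definition Cmp R le p q := exists r, r ∈ R /\ lep le r p /\ lep le r q.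
#[export] Instance Def_Cmp R le : Def2 (Cmp R le). Proof. unfold Cmp; def. Qed.
Lemma sat_compatible R le p q : sat (compatible R le p q) <-> Cmp R le p q.
Proof. unfold compatible; satn; reflexivity. Qed.
#[local] Hint Extern 0 (sem _ _ (compatible _ _ _ _) <-> _) => refine (sat_compatible _ _ _ _) : sat.

Definition Glb R le r p q := r ∈ R /\ lep le r p /\ lep le r q /\
  forall s, s ∈ R -> lep le s p -> lep le s q -> lep le s r.
Lemma sat_isGlb R le r p q : sat (isGlb R le r p q) <-> Glb R le r p q.
Proof. unfold isGlb; satn; reflexivity. Qed.
#[local] Hint Extern 0 (sem _ _ (isGlb _ _ _ _ _) <-> _) => refine (sat_isGlb _ _ _ _ _) : sat.

Lemma sat_hasGlbs R le : sat (hasGlbs R le) <->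
  forall p, p ∈ R -> forall q, q ∈ R -> Cmp R le p q -> exists r, Glb R le r p q.
Proof. unfold hasGlbs; satn; reflexivity. Qed.
#[local] Hint Extern 0 (sem _ _ (hasGlbs _ _) <-> _) => refine (sat_hasGlbs _ _) : sat.

Definition DenseTr d n R le := (forall x, x ∈ d -> x ∈ n /\ x ∈ R) /\
  forall p, p ∈ R -> p ∈ n -> exists x, x ∈ d /\ lep le x p.
Definition SGen q n R le := q ∈ R /\ forall d, DenseTr d n R le ->
  forall r, r ∈ R -> lep le r q -> exists x, x ∈ d /\ Cmp R le x r.
Lemma sat_stronglyGeneric q n R le : sat (stronglyGeneric q n R le) <-> SGen q n R le.
Proof.
unfold stronglyGeneric, denseInTrace, predenseBelow; satn.
reflexivity.
Qed.
#[local] Hint Extern 0 (sem _ _ (stronglyGeneric _ _ _ _) <-> _) => refine (sat_stronglyGeneric _ _ _ _) : sat.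

Lemma sat_nonDiag R le : sat (nonDiagStronglyProper R le) <->
  Poset R le /\ exists l h, IsLam l R /\ (forall x, x ∈ h <-> InH l x) /\
  forall p, p ∈ R -> forall c, Club c h -> exists n, n ∈ c /\ Pw1 h n /\ p ∈ n /\
    exists q, q ∈ R /\ lep le q p /\ SGen q n R le.
Proof.
unfold nonDiagStronglyProper, stationarilyMany; satn.
reflexivity.
Qed.
#[local] Hint Extern 0 (sem _ _ (nonDiagStronglyProper _ _) <-> _) => refine (sat_nonDiag _ _) : sat.

Lemma sat_maximalAntichain a R le : sat (maximalAntichain a R le) <->
  (Sub a R /\ forall p, p ∈ a -> forall q, q ∈ a -> p <> q -> ~ Cmp R le p q) /\
  (forall b, (Sub b R /\ forall p, p ∈ b -> forall q, q ∈ b -> p <> q -> ~ Cmp R le p q) ->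
     Sub a b -> Sub b a).
Proof.
unfold maximalAntichain, antichain; satn.
reflexivity.
Qed.
#[local] Hint Extern 0 (sem _ _ (maximalAntichain _ _ _) <-> _) => refine (sat_maximalAntichain _ _ _) : sat.

Lemma sat_isQuotient R Q le G : sat (isQuotient R Q le G) <->
  forall q, q ∈ R <-> q ∈ Q /\ forall p, p ∈ G -> Cmp Q le q p.
Proof. unfold isQuotient; satn; reflexivity. Qed.
#[local] Hint Extern 0 (sem _ _ (isQuotient _ _ _ _) <-> _) => refine (sat_isQuotient _ _ _ _) : sat.

End Sat.
Ltac sat_lemma ::= first
  [ refine (sat_isQuotient _ _ _ _)
  | refine (sat_maximalAntichain _ _ _)
  | refine (sat_nonDiag _ _)
  | refine (sat_stronglyGeneric _ _ _ _)
  | refine (sat_hasGlbs _ _)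
  | refine (sat_isGlb _ _ _ _ _)
  | refine (sat_compatible _ _ _ _)
  | refine (sat_forcingPoset _ _)
  | refine (sat_isClub _ _)
  | refine (sat_inPω1 _ _)
  | refine (sat_isLambda _ _)
  | refine (sat_uncountableCardinalOver _ _)
  | refine (sat_isH _ _)
  | refine (sat_inH _ _)
  | refine (sat_isTrcl _ _)
  | refine (sat_countable _)
  | refine (sat_isOmega _)
  | refine (sat_isNat _)
  | refine (sat_ordinal _)
  | refine (sat_transitive _)
  | refine (sat_cardLe _ _)
  | refine (sat_isInjection _ _ _)
  | refine (sat_tripleIn _ _ _ _)
  | refine (sat_pairIn _ _ _)
  | refine (sat_isOPair _ _ _)
  | refine (sat_sub _ _)].

(** * The forcing relation *)

Section Forcing.
Context {M : Type} {HM : Model M}.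
Implicit Types (a b c d e n p q r s x y z u v w f t : M).
Context (R le : M).

Definition MemC (EQ : M -> M -> M -> Prop) p z b := forall q, q ∈ R -> lep le q p ->
  exists s, s ∈ R /\ lep le s q /\
    exists y r, r ∈ R /\ opair y r ∈ b /\ lep le s r /\ EQ s z y.
Definition SubC (EQ : M -> M -> M -> Prop) p a b := forall z r, r ∈ R -> opair z r ∈ a ->
  forall q, q ∈ R -> lep le q p -> lep le q r -> MemC EQ q z b.

Lemma MemC_ext (E1 E2 : M -> M -> M -> Prop) p z b :
  (forall s y r, s ∈ R -> opair y r ∈ b -> (E1 s z y <-> E2 s z y)) -> MemC E1 p z b <-> MemC E2 p z b.
Proof.
move=> H; split=> K q qR qp; have [s [sR [sq [y [r [rR [yr [sr Hs]]]]]]]] := K q qR qp;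
exists s; split=> //; split=> //; exists y, r; do 3 (split=> //); by apply/(H s y r).
Qed.

Lemma SubC_ext (E1 E2 : M -> M -> M -> Prop) p a b :
  (forall s z w r r', s ∈ R -> opair z r ∈ a -> opair w r' ∈ b -> (E1 s z w <-> E2 s z w)) ->
  SubC E1 p a b <-> SubC E2 p a b.
Proof.
move=> H.
have X z r q : opair z r ∈ a -> MemC E1 q z b <-> MemC E2 q z b.
  by move=> zr; apply: MemC_ext => s y r' sR yr; exact: (H s z y r r').
by split=> K z r rR zr q qR qp qr; apply/(X z r q zr); exact: (K z r rR zr q qR qp qr).
Qed.

Lemma Tr_dom t v z r : Tr t -> v ∈ t -> opair z r ∈ v -> z ∈ t.
Proof.
move=> Tt vt zv; have zz : pair z z ∈ t.
  by apply: (Tt (opair z r) (Tt v vt _ zv)); apply/in_pair; left.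
by apply: (Tt _ zz); apply/in_pair; left.
Qed.

(** An element [z] of the domain of a name lies several membership steps below it, because of the
    pair coding; so the ∈-induction is carried out for all of [trc x] at once. *)
Lemma dom_ind (A : M -> Prop) : Def1 A ->
  (forall x, (forall z r, opair z r ∈ x -> A z) -> A x) -> forall x, A x.
Proof.
move=> HA H.
have K x : forall y, y ∈ trc x -> A y.
  move: x; apply: (mem_ind (fun x => forall y, y ∈ trc x -> A y)) => x IH.
  have K y : y ∈ x -> A y.
    move=> yx; apply: H => z r zy; apply: (IH y yx).
    have zz : pair z z ∈ trc y.
      by apply: (trc_Tr y _ (trc_sub _ _ zy)); apply/in_pair; left.
    by apply: (trc_Tr y _ zz); apply/in_pair; left.
  by move=> y /trcE [yx|[z [zx yz]]]; [exact: K | exact: (IH z zx)].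
move=> x; apply: (K (pair x x)); apply: trc_sub; by apply/in_pair; left.
Qed.

Lemma opair_dom z r x : opair z r ∈ x -> z ∈ Un (Un x).
Proof.
move=> H; apply/in_Un; exists (pair z z); split; first by apply/in_pair; left.
by apply/in_Un; exists (opair z r); split=> //; apply/in_pair; left.
Qed.

(** The clause for [x = y] compares [z] with [w] in one inclusion and [w] with [z] in the other,
    where [z] and [w] range over the two domains; the predecessors therefore include both orders. *)
Definition prE u := cset (fun v => exists x y z w r r', u = opair x y /\ opair z r ∈ x /\ opair w r' ∈ y /\
  (v = opair z w \/ v = opair w z)).
Instance Fn_prE : Fn1 prE. Proof. unfold prE; def. Qed.

Lemma in_prE x y v : v ∈ prE (opair x y) <->
  exists z w r r', opair z r ∈ x /\ opair w r' ∈ y /\ (v = opair z w \/ v = opair w z).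
Proof.
rewrite /prE (cset_sub _ (prod (cup (Un (Un x)) (Un (Un y))) (cup (Un (Un x)) (Un (Un y))))).
- split; last by move=> [z [w [r [r' H]]]]; exists x, y, z, w, r, r'.
  move=> [x' [y' [z [w [r [r' [e H]]]]]]]; case: (opair_inj _ _ _ _ e) => ? ?; subst x' y'.
  by exists z, w, r, r'.
- move=> t [x' [y' [z [w [r [r' [e [Hz [Hw H]]]]]]]]]; case: (opair_inj _ _ _ _ e) => ? ?; subst x' y'.
  move: (opair_dom _ _ _ Hz) (opair_dom _ _ _ Hw) => Hz' Hw'.
  by case: H => ->; apply/opair_in_prod; rewrite !in_cup; tauto.
Qed.

Lemma prE_ind (A : M -> Prop) : Def1 A ->
  (forall u, (forall v, v ∈ prE u -> A v) -> A u) -> forall u, A u.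
Proof.
move=> HA H u.
have K x : forall y, A (opair x y) /\ A (opair y x).
  move: x; apply: (dom_ind (fun x => forall y, A (opair x y) /\ A (opair y x))) => x IH y.
  split; apply: H => v /in_prE [z [w [r [r' [Hz [Hw [] ->]]]]]].
  - by case: (IH z r Hz w).
  - by case: (IH z r Hz w).
  - by case: (IH w r' Hw z).
  - by case: (IH w r' Hw z).
case: (classic (exists x y, u = opair x y)) => [[x [y ->]]|nu]; first by case: (K x y).
apply: H => v; rewrite /prE (cset_sub _ emp) => [[x [y [z [w [r [r' [e _]]]]]]]|].
- by case: nu; exists x, y.
- by move=> t [x [y [z [w [r [r' [e _]]]]]]]; case: nu; exists x, y.
Qed.

Definition looked g s z w := exists V, opair (opair z w) V ∈ g /\ s ∈ V.
Ltac def_lemma ::= progress unfold sep, repl, SubC, MemC, looked.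
Definition GE u g := cset (fun q => q ∈ R /\ exists x y, u = opair x y /\
  SubC (looked g) q x y /\ SubC (looked g) q y x).
Instance Fn_GE : Fn2 GE. Proof. unfold GE; def. Qed.
Definition eqv := rec prE GE.
Instance Fn_eqv : Fn1 eqv. Proof. apply: Fn_rec. Qed.

Definition Feq q x y := q ∈ eqv (opair x y).
#[export] Instance Def_Feq : Def3 Feq. Proof. unfold Feq; def. Qed.

Lemma FeqE q x y : Feq q x y <-> q ∈ R /\ SubC Feq q x y /\ SubC Feq q y x.
Proof.
rewrite {1}/Feq {1}/eqv rec_eq; last by move=> A HA; apply: prE_ind.
rewrite -/eqv; set g := repl _ _.
have K z w r r' : (opair z r ∈ x /\ opair w r' ∈ y) \/ (opair z r ∈ y /\ opair w r' ∈ x) ->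
    forall s, looked g s z w <-> Feq s z w.
  move=> Hzw s; rewrite /looked /g /Feq.
  have pv : opair z w ∈ prE (opair x y).
    apply/in_prE; case: Hzw => [[H1 H2]|[H1 H2]]; last by exists w, z, r', r; tauto.
    by exists z, w, r, r'; tauto.
  split=> [[V [/in_repl [v [_ e]] sV]]|sV].
    by case: (opair_inj _ _ _ _ e) => e1 e2; rewrite e1 -e2.
  exists (eqv (opair z w)); split=> //; apply/in_repl; by exists (opair z w).
rewrite /GE (cset_sub _ R); last (by move=> t []); split.
- move=> [qR [x' [y' [e [H1 H2]]]]]; case: (opair_inj _ _ _ _ e) => ? ?; subst x' y'.
  split=> //; split.
  + move: H1; apply (SubC_ext _ _ _ _ _) => s z w r r' sR zr wr.
    by have := K z w r r' (or_introl (conj zr wr)) s; tauto.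
  + move: H2; apply (SubC_ext _ _ _ _ _) => s z w r r' sR zr wr.
    by have := K z w r r' (or_intror (conj zr wr)) s; tauto.
- move=> [qR [H1 H2]]; split=> //; exists x, y; split=> //; split.
  + move: H1; apply (SubC_ext _ _ _ _ _) => s z w r r' sR zr wr.
    by have := K z w r r' (or_introl (conj zr wr)) s; tauto.
  + move: H2; apply (SubC_ext _ _ _ _ _) => s z w r r' sR zr wr.
    by have := K z w r r' (or_intror (conj zr wr)) s; tauto.
Qed.

(** Any witness [e] agrees with [Feq] on the names in [t], by induction along [prE]; transitivity of
    [t] keeps the predecessors inside. Conversely, [Feq] restricted to the transitive closure of
    [{a, b}] is a witness. *)
Lemma sat_forceEq p a b : p ∈ R -> sat (forceEq R le p a b) <-> Feq p a b.
Proof.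
move=> pR; unfold forceEq, subClause, memClause; eapply iff_trans; [sati | cbv beta]; split.
- move=> [t [e [Tt [at_ [bt [H pe]]]]]].
  have K u : forall x y, u = opair x y -> x ∈ t -> y ∈ t -> forall q, q ∈ R ->
      opair q (opair x y) ∈ e <-> Feq q x y.
    move: u; apply: (prE_ind (fun u => forall x y, u = opair x y -> x ∈ t -> y ∈ t -> forall q, q ∈ R ->
      opair q (opair x y) ∈ e <-> Feq q x y)) => u IH x y ? xt yt q qR; subst u.
    have D z r v : v ∈ t -> opair z r ∈ v -> z ∈ t.
      by move=> vt; exact: (Tr_dom _ _ _ _ Tt vt).
    rewrite FeqE (H q qR x xt y yt).
    have E1 : SubC (fun s z w => opair s (opair z w) ∈ e) q x y <-> SubC Feq q x y.
      apply: SubC_ext => s z w r r' sR zr wr; apply: (IH (opair z w)) => //; [|exact: D zr|exact: D wr].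
      by apply/in_prE; exists z, w, r, r'; tauto.
    have E2 : SubC (fun s z w => opair s (opair z w) ∈ e) q y x <-> SubC Feq q y x.
      apply: SubC_ext => s z w r r' sR zr wr; apply: (IH (opair z w)) => //; [|exact: D zr|exact: D wr].
      by apply/in_prE; exists w, z, r', r; tauto.
    rewrite -E1 -E2 /SubC /MemC /lep; tauto.
  by apply/(K _ _ _ eq_refl).
- move=> Hp.
  pose (t := trc (pair a b)).
  pose (e := sep (prod R (prod t t)) (fun v => exists q x y, v = opair q (opair x y) /\ Feq q x y)).
  have Tt : Tr t by exact: trc_Tr.
  have at_ : a ∈ t by apply: trc_sub; apply/in_pair; left.
  have bt : b ∈ t by apply: trc_sub; apply/in_pair; right.
  have eE q x y : q ∈ R -> x ∈ t -> y ∈ t -> opair q (opair x y) ∈ e <-> Feq q x y.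
    move=> qR xt yt; rewrite /e in_sep !opair_in_prod; split.
    - move=> [_ [q' [x' [y' [e1 H]]]]]; case: (opair_inj _ _ _ _ e1) => -> e2.
      by case: (opair_inj _ _ _ _ e2) => -> ->.
    - by move=> H; split=> //; exists q, x, y.
  have D z r v : v ∈ t -> opair z r ∈ v -> z ∈ t.
    by move=> vt; exact: (Tr_dom _ _ _ _ Tt vt).
  exists t, e; do 3 (split=> //); split; last by apply/eE.
  move=> q qR x xt y yt; rewrite eE // FeqE.
  have E1 : SubC (fun s z w => opair s (opair z w) ∈ e) q x y <-> SubC Feq q x y.
    by apply: SubC_ext => s z w r r' sR zr wr; apply: eE => //; [exact: D zr|exact: D wr].
  have E2 : SubC (fun s z w => opair s (opair z w) ∈ e) q y x <-> SubC Feq q y x.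
    by apply: SubC_ext => s z w r r' sR zr wr; apply: eE => //; [exact: D zr|exact: D wr].
  rewrite -E1 -E2 /SubC /MemC /lep; tauto.
Qed.

Definition chk := mrec (fun _ I => prod I R).
#[export] Instance Fn_chk : Fn1 chk. Proof. exact: Fn_mrec. Qed.
Lemma chkE x : chk x = prod (repl x chk) R.
Proof. by rewrite {1}/chk mrec_eq. Qed.
Lemma in_chk x v : v ∈ chk x <-> exists z r, z ∈ x /\ r ∈ R /\ v = opair (chk z) r.
Proof.
rewrite chkE in_prod; split.
- by move=> [y [r [/in_repl [z [zx ->]] [rR ->]]]]; exists z, r.
- by move=> [z [r [zx [rR ->]]]]; exists (chk z), r; split=> //; apply/in_repl; exists z.
Qed.

Lemma sat_isCheck x c : sat (isCheck R x c) <-> c = chk x.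
Proof.
unfold isCheck; eapply iff_trans; [sati | cbv beta]; split.
- move=> [t [f [Tt [xt [Hf1 [Hf2 xc]]]]]].
  have K y : y ∈ t -> forall d, opair y d ∈ f -> d = chk y.
    move: y; apply: (mem_ind (fun y => y ∈ t -> forall d, opair y d ∈ f -> d = chk y)) => y IH yt d yd.
    have [_ Hd] := Hf2 y d yd; apply: ext => u; rewrite Hd in_chk; split.
    + move=> [z [zy [e [r [rR [ze ->]]]]]]; exists z, r; split=> //; split=> //.
      by rewrite (IH z zy (Tt y yt z zy) e ze).
    + move=> [z [r [zy [rR ->]]]]; exists z; split=> //.
      have [e He] := Hf1 z (Tt y yt z zy).
      by exists e, r; rewrite -(IH z zy (Tt y yt z zy) e He).
  exact: K.
- move=> ->; pose (t := trc (pair x x)).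
  have xt : x ∈ t by apply: trc_sub; apply/in_pair; left.
  have fE y d : opair y d ∈ repl t (fun y => opair y (chk y)) <-> y ∈ t /\ d = chk y.
    rewrite in_repl; split=> [[z [zt e]]|[yt ->]]; last by exists y.
    by case: (opair_inj _ _ _ _ e) => -> ->.
  exists t, (repl t (fun y => opair y (chk y))).
  split; first exact: trc_Tr.
  split=> //; split; first by move=> y yt; exists (chk y); apply/fE.
  split; last by apply/fE.
  move=> y d /fE [yt ->]; split=> // u; rewrite in_chk; split.
  + move=> [z [r [zy [rR ->]]]]; exists z; split=> //; exists (chk z), r; split=> //; split=> //.
    by apply/fE; split=> //; exact: (trc_Tr _ y).
  + by move=> [z [zy [e [r [rR [/fE [_ ->] ->]]]]]]; exists z, r.
Qed.

(** The reading of [force] in the metatheory: the witnesses of the internal recursions are replaced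
    by the definable relation [Feq] and the function [chk]. *)
Fixpoint fr (phi : fm M) (p : M) : Prop :=
  match phi with
  | In a b => MemC Feq p a b
  | Eq a b => Feq p a b
  | Ground a => forall q, q ∈ R -> lep le q p ->
      exists s, s ∈ R /\ lep le s q /\ exists x, Feq s a (chk x)
  | Not a => forall q, q ∈ R -> lep le q p -> ~ fr a q
  | And a b => fr a p /\ fr b p
  | All F => forall x, fr (F x) p
  end.

Lemma sat_force phi p : p ∈ R -> sat (force R le p phi) <-> fr phi p.
Proof.
elim: phi p => [a b|a b|a|a IH|a IHa b IHb|F IH] p pR.
- cbn [force fr]; unfold forceIn, memClause; eapply iff_trans; [sati | cbv beta].
  split=> H q qR qp; have [s [sR [sq [y [r [rR [yr [sr He]]]]]]]] := H q qR qp;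
  exists s; split=> //; split=> //; exists y, r; do 3 (split=> //); by apply/(sat_forceEq s a y sR).
- exact: sat_forceEq.
- cbn [force fr]; unfold forceGround; eapply iff_trans; [sati | cbv beta].
  split=> H q qR qp; have [s [sR [sq H']]] := H q qR qp; exists s; split=> //; split=> //.
  + by move: H' => [x [c [/sat_isCheck -> /(sat_forceEq _ _ _ sR) K]]]; exists x.
  + by move: H' => [x K]; exists x, (chk x); split; [exact/sat_isCheck | exact/sat_forceEq].
- cbn [force fr]; eapply iff_trans; [sati | cbv beta].
  by split=> H q qR qp /(IH q qR); apply: H.
- cbn [force fr sem]; have := IHa p pR; have := IHb p pR; tauto.
- by cbn [force fr sem]; split=> H x; apply/(IH x p pR).
Qed.
End Forcing.

Ltac def_lemma ::= progress unfold sep, repl, SubC, MemC, looked.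

(** * Regular open values, forced equality and the maximum principle *)

Section Names.
Context {M : Type} {HM : Model M}.
Implicit Types (a b c p q r s x y z w : M).
Context (R le : M) (HP : Poset R le).
Notation MemC := (MemC R le).
Notation SubC := (SubC R le).
Notation Feq := (Feq R le).
Notation fr := (fr R le).

Lemma lep_refl p : p ∈ R -> lep le p p.
Proof. by case: HP => _ [H _]; exact: H. Qed.
Lemma lep_trans p q r : p ∈ R -> q ∈ R -> r ∈ R -> lep le p q -> lep le q r -> lep le p r.
Proof. by case: HP => _ [_ H]; exact: H. Qed.

(** Regular open sets of conditions *)
Definition Reg (A : M -> Prop) :=
  (forall p q, p ∈ R -> q ∈ R -> lep le q p -> A p -> A q) /\
  (forall p, p ∈ R -> (forall q, q ∈ R -> lep le q p -> exists s, s ∈ R /\ lep le s q /\ A s) -> A p).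

Lemma Reg_MemC EQ z b : Reg (fun p => MemC EQ p z b).
Proof.
split.
- move=> p q pR qR qp H t tR tq; apply: H => //; exact: (lep_trans t q p).
- move=> p pR H q qR qp; have [s [sR [sq K]]] := H q qR qp.
  have [t [tR [ts H']]] := K s sR (lep_refl s sR); exists t; split=> //; split=> //.
  exact: (lep_trans t s q).
Qed.

Lemma Reg_SubC EQ a b : Reg (fun p => SubC EQ p a b).
Proof.
split.
- move=> p q pR qR qp H z r rR zr t tR tq tr; apply: (H z r) => //; exact: (lep_trans t q p).
- move=> p pR H z r rR zr q qR qp qr; apply: (proj2 (Reg_MemC EQ z b) q qR) => t tR tq.
  have [s [sR [st K]]] := H t tR (lep_trans _ _ _ tR qR pR tq qp); exists s; split=> //; split=> //.
  apply: (K z r) => //; first exact: lep_refl.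
  exact: (lep_trans s t r sR tR rR st (lep_trans t q r tR qR rR tq qr)).
Qed.

Lemma Reg_Feq a b : Reg (fun p => Feq p a b).
Proof.
split.
- move=> p q pR qR qp /FeqE [_ [H1 H2]]; apply/FeqE; split=> //.
  by split; [apply: (proj1 (Reg_SubC Feq a b) p) | apply: (proj1 (Reg_SubC Feq b a) p)].
- move=> p pR H; apply/FeqE; split=> //; split.
  + apply: (proj2 (Reg_SubC Feq a b) p pR) => q qR qp; have [s [sR [sq /FeqE [_ [K _]]]]] := H q qR qp.
    by exists s.
  + apply: (proj2 (Reg_SubC Feq b a) p pR) => q qR qp; have [s [sR [sq /FeqE [_ [_ K]]]]] := H q qR qp.
    by exists s.
Qed.

Lemma Reg_not A : Reg A -> Reg (fun p => forall q, q ∈ R -> lep le q p -> ~ A q).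
Proof.
move=> [H1 H2]; split.
- by move=> p q pR qR qp H t tR tq; apply: H => //; exact: (lep_trans t q p).
- move=> p pR H q qR qp Aq; have [s [sR [sq K]]] := H q qR qp.
  by apply: (K s sR (lep_refl s sR)); exact: (H1 q).
Qed.

Lemma Reg_and A B : Reg A -> Reg B -> Reg (fun p => A p /\ B p).
Proof.
move=> [A1 A2] [B1 B2]; split.
- by move=> p q pR qR qp [HA HB]; split; [exact: (A1 p) | exact: (B1 p)].
- move=> p pR H; split; [apply: A2 => // | apply: B2 => //] => q qR qp;
  have [s [sR [sq [? ?]]]] := H q qR qp; by exists s.
Qed.

Lemma Reg_all {T} (A : T -> M -> Prop) : (forall i, Reg (A i)) -> Reg (fun p => forall i, A i p).
Proof.
move=> H; split.
- by move=> p q pR qR qp K i; exact: (proj1 (H i) p).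
- move=> p pR K i; apply: (proj2 (H i)) => // q qR qp; have [s [sR [sq ?]]] := K q qR qp.
  by exists s.
Qed.

Lemma Reg_dense (A : M -> Prop) : (forall p q, p ∈ R -> q ∈ R -> lep le q p -> A p -> A q) ->
  Reg (fun p => forall q, q ∈ R -> lep le q p -> exists s, s ∈ R /\ lep le s q /\ A s).
Proof.
move=> HA; split.
- by move=> p q pR qR qp H t tR tq; apply: H => //; exact: (lep_trans t q p).
- move=> p pR H q qR qp; have [s [sR [sq K]]] := H q qR qp.
  have [t [tR [ts H']]] := K s sR (lep_refl s sR); exists t; split=> //; split=> //.
  exact: (lep_trans t s q).
Qed.

Lemma Reg_fr phi : Reg (fr phi).
Proof.
elim: phi => [a b|a b|a|a IH|a IHa b IHb|F IH] /=.
- exact: Reg_MemC.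
- exact: Reg_Feq.
- apply: Reg_dense => p q pR qR qp [x H]; exists x; exact: (proj1 (Reg_Feq _ _) p q).
- exact: Reg_not.
- exact: Reg_and.
- exact: Reg_all.
Qed.

Lemma fr_mono phi p q : p ∈ R -> q ∈ R -> lep le q p -> fr phi p -> fr phi q.
Proof. exact: (proj1 (Reg_fr phi)). Qed.

Lemma Feq_in p a b : Feq p a b -> p ∈ R.
Proof. by move=> /FeqE []. Qed.

Lemma Feq_sym p a b : Feq p a b -> Feq p b a.
Proof. by move=> /FeqE [pR [H1 H2]]; apply/FeqE. Qed.

Lemma Feq_mono p q a b : q ∈ R -> lep le q p -> Feq p a b -> Feq q a b.
Proof. by move=> qR qp H; apply: (proj1 (Reg_Feq a b) p) => //; exact: Feq_in H. Qed.

Lemma Feq_refl p a : p ∈ R -> Feq p a a.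
Proof.
move: a p; apply: (dom_ind (fun a => forall p, p ∈ R -> Feq p a a)) => a IH p pR.
have K : SubC Feq p a a.
  move=> z r rR zr q qR qp qr t tR tq; exists t; split=> //; split; first exact: lep_refl.
  exists z, r; split=> //; split=> //; split; first exact: (lep_trans t q r).
  exact: (IH z r).
by apply/FeqE.
Qed.

(** Transitivity for the names at hand is a premise, because the lemma is applied inside the
    induction that proves transitivity. *)
Lemma MemC_sub p a b c : MemC Feq p a b -> SubC Feq p b c -> p ∈ R ->
  (forall s y w, Feq s a y -> Feq s y w -> Feq s a w) -> MemC Feq p a c.
Proof.
move=> H K pR T q qR qp; have [s [sR [sq [y [r [rR [yr [sr Hs]]]]]]]] := H q qR qp.
have sp : lep le s p by exact: (lep_trans s q p).
have [t [tR [ts [w [r' [rR' [wr [tr Ht]]]]]]]] := K y r rR yr s sR sp sr s sR (lep_refl s sR).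
exists t; split=> //; split; first exact: (lep_trans t s q).
exists w, r'; do 3 (split=> //); apply: T Ht; exact: Feq_mono Hs.
Qed.

Lemma Feq_trans p a b c : Feq p a b -> Feq p b c -> Feq p a c.
Proof.
move: a p b c; apply: (dom_ind (fun a => forall p b c, Feq p a b -> Feq p b c -> Feq p a c)) => a IH p b c.
move=> /FeqE [pR [ab ba]] /FeqE [_ [bc cb]]; apply/FeqE; split=> //; split.
- move=> z r rR zr q qR qp qr; apply: (MemC_sub q z b c) => //.
  + exact: (ab z r).
  + exact: (proj1 (Reg_SubC Feq b c) p).
  + by move=> s y w; exact: (IH z r zr).
- move=> w r rR wr q qR qp qr t tR tq.
  have [s [sR [st [y [r1 [rR1 [yr [sr Hs]]]]]]]] := cb w r rR wr q qR qp qr t tR tq.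
  have sp : lep le s p by apply: (lep_trans s t p) => //; exact: (lep_trans t q p).
  have [s' [sR' [ss [z [r2 [rR2 [zr [sr2 Hs2]]]]]]]] := ba y r1 rR1 yr s sR sp sr s sR (lep_refl s sR).
  exists s'; split=> //; split; first exact: (lep_trans s' s t).
  exists z, r2; do 3 (split=> //); apply: Feq_sym.
  apply: (IH z r2 zr s' y w); first exact: Feq_sym.
  by apply: Feq_sym; exact: Feq_mono Hs.
Qed.

Lemma MemC_eql p a a' b : p ∈ R -> Feq p a a' -> MemC Feq p a b -> MemC Feq p a' b.
Proof.
move=> pR e H q qR qp; have [s [sR [sq [y [r [rR [yr [sr Hs]]]]]]]] := H q qR qp.
exists s; split=> //; split=> //; exists y, r; do 3 (split=> //).
apply: Feq_trans Hs; apply: Feq_sym; apply: (Feq_mono p) => //; exact: (lep_trans s q p).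
Qed.

Lemma MemC_eqr p a b b' : p ∈ R -> Feq p b b' -> MemC Feq p a b -> MemC Feq p a b'.
Proof.
move=> pR /FeqE [_ [bb _]] H; apply: (MemC_sub p a b b') => //.
by move=> s y w; exact: Feq_trans.
Qed.

Lemma MemC_intro p z r b : p ∈ R -> r ∈ R -> opair z r ∈ b -> lep le p r -> MemC Feq p z b.
Proof.
move=> pR rR zr pr q qR qp; exists q; split=> //; split; first exact: lep_refl.
exists z, r; do 2 (split=> //); split; first exact: (lep_trans q p r).
exact: Feq_refl.
Qed.

Fixpoint EnvEq p n : env M n -> env M n -> Prop :=
  match n with 0 => fun _ _ => True | S n => fun v v' => EnvEq p n (fst v) (fst v') /\ Feq p (snd v) (snd v') end.

Lemma EnvEq_refl p n (v : env M n) : p ∈ R -> EnvEq p n v v.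
Proof. by move=> pR; elim: n v => //= n IH v; split=> //; exact: Feq_refl. Qed.

Lemma EnvEq_sym p n (v v' : env M n) : EnvEq p n v v' -> EnvEq p n v' v.
Proof. by elim: n v v' => //= n IH v v' [H1 H2]; split; [exact: IH | exact: Feq_sym]. Qed.

Lemma EnvEq_mono p q n (v v' : env M n) : q ∈ R -> lep le q p -> EnvEq p n v v' -> EnvEq q n v v'.
Proof. by move=> qR qp; elim: n v v' => //= n IH v v' [H1 H2]; split; [exact: IH | exact: Feq_mono H2]. Qed.

(** A [Val n φ] is a definable relation on names with values in the regular open
    algebra. *)
Definition Val n (phi : env M n -> M -> Prop) :=
  Def (S n) (fun v => phi (fst v) (snd v)) /\ (forall v, Reg (phi v)) /\
  (forall v v' p, p ∈ R -> EnvEq p n v v' -> phi v p -> phi v' p).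

Definition Lift n (t : env M n -> M) :=
  Tm n t /\ forall v v' p, p ∈ R -> EnvEq p n v v' -> Feq p (t v) (t v').

Lemma Lift_atm n t : atm n t -> Lift n t.
Proof.
move=> H; split; first exact: Tm_atm.
elim: H => {n t} [n c|n|n t _ IH] v v' p pR /=; first by move=> _; exact: Feq_refl.
- by case.
- by move=> [H _]; exact: IH.
Qed.

Lemma Val_mem n (s t : env M n -> M) : Lift n s -> Lift n t -> Val n (fun v p => MemC Feq p (s v) (t v)).
Proof.
move=> [Ds Hs] [Dt Ht]; split; [|split].
- have D3 : Def3 (fun p a b => MemC Feq p a b) by def.
  apply: (Def_app3 (S n) (fun p a b => MemC Feq p a b) snd (fun v => s (fst v)) (fun v => t (fst v))).
  + apply: Tm_atm; exact: atm_0.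
  + exact: Tm_weak.
  + exact: Tm_weak.
- by move=> v; exact: Reg_MemC.
- move=> v v' p pR e H; apply: (MemC_eql p (s v)) => //; first exact: Hs.
  by apply: (MemC_eqr p _ (t v)) => //; exact: Ht.
Qed.

Lemma Val_eq n (s t : env M n -> M) : Lift n s -> Lift n t -> Val n (fun v p => Feq p (s v) (t v)).
Proof.
move=> [Ds Hs] [Dt Ht]; split; [|split].
- apply: (Def_app3 (S n) Feq snd (fun v => s (fst v)) (fun v => t (fst v))).
  + apply: Tm_atm; exact: atm_0.
  + exact: Tm_weak.
  + exact: Tm_weak.
- by move=> v; exact: Reg_Feq.
- move=> v v' p pR e H; apply: (Feq_trans p _ (t v)); last exact: Ht.
  by apply: Feq_trans H; apply: Feq_sym; exact: Hs.
Qed.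

Lemma Val_not n phi : Val n phi -> Val n (fun v p => forall q, q ∈ R -> lep le q p -> ~ phi v q).
Proof.
move=> [D [H1 H2]]; split; [|split].
- have D2 : Def (S (S n)) (fun v => phi (fst (fst v)) (snd v)).
    apply: (Def_ren (S (S n)) (S n) (fun v => (fst (fst v), snd v)) _ _ D); split; last exact: atm_0.
    exact: (ren_S _ _ _ (ren_S _ _ _ (ren_id n))).
  apply: Def_all; apply: Def_imp; first by def.
  by apply: Def_imp; [def | exact: Def_not].
- by move=> v; exact: Reg_not.
- move=> v v' p pR e H q qR qp K; apply: (H q qR qp); apply: (H2 v') => //.
  by apply: EnvEq_sym; exact: EnvEq_mono e.
Qed.

Lemma Val_and n phi psi : Val n phi -> Val n psi -> Val n (fun v p => phi v p /\ psi v p).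
Proof.
move=> [D [H1 H2]] [D' [H1' H2']]; split; [|split].
- exact: Def_and.
- by move=> v; apply: Reg_and.
- by move=> v v' p pR e [K1 K2]; split; [exact: (H2 v) | exact: (H2' v)].
Qed.

Lemma Val_all n phi : Val (S n) phi -> Val n (fun v p => forall x, phi (v, x) p).
Proof.
move=> [D [H1 H2]]; split; [|split].
- apply: Def_all.
  apply: (Def_ren (S (S n)) (S (S n)) (fun v => (fst (fst v), snd v, snd (fst v))) _ _ D).
  split; first split; last exact: (atm_S _ _ (atm_0 _)); last exact: atm_0.
  exact: (ren_S _ _ _ (ren_S _ _ _ (ren_id n))).
- by move=> v; apply: Reg_all.
- move=> v v' p pR e K x; apply: (H2 (v, x)) => //; split=> //; exact: Feq_refl.
Qed.

Lemma Val_fr n A : uniform false n A -> Val n (fun v p => fr (A M v) p).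
Proof.
have P k t : pvar k t -> Lift k (t M).
  move=> H; apply: Lift_atm; elim: H => {k t} [k|k t _ IH]; [exact: atm_0 | exact: atm_S].
move=> H; elim: H => {n A} //=.
- by move=> n a1 a2 Hs Ht; apply: Val_mem; exact: P.
- by move=> n a1 a2 Hs Ht; apply: Val_eq; exact: P.
- by move=> n A _ IH; apply: Val_not.
- by move=> n A B _ IHA _ IHB; apply: Val_and.
- by move=> n A _ IH; exact: Val_all IH.
Qed.

(** The maximum principle: a name obtained by mixing witnesses along a well-order
    of the conditions. *)
Lemma mixing (phi : M -> M -> Prop) : Def2 phi -> (forall x, Reg (phi x)) ->
  (forall x x' p, p ∈ R -> Feq p x x' -> phi x p -> phi x' p) ->
  exists x, forall p, p ∈ R -> (forall q, q ∈ R -> lep le q p -> exists s, s ∈ R /\ lep le s q /\ exists y, phi y s) ->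
    phi x p.
Proof.
move=> Dphi Rphi Ephi.
pose (D := sep R (fun s => exists x, phi x s)).
have inD s : s ∈ D <-> s ∈ R /\ exists x, phi x s by exact: in_sep.
have [|X [HX X1]] := definable_choice (fun s x => phi x s) D _; first by move=> s /inD [].
have [o [Oo Ro]] := Le_Ord R; have [K [HK [K1 K2]]] := Le_elim _ _ Ro.
(* Along the well-order given by [K], the condition [t] belongs to the first member of [D] with
   which it is compatible, and lies below that member. The regions of distinct owners are
   incompatible, so the names [X s] can be glued without choosing a maximal antichain. *)
pose (Own := fun t s => t ∈ R /\ s ∈ D /\ lep le t s /\ forall s', s' ∈ D -> K s' ∈ K s -> ~ Cmp R le t s').
have DOwn : Def2 Own by unfold Own; def.
pose (A := fun v => exists s y r t, Own t s /\ opair y r ∈ X s /\ r ∈ R /\ lep le t r /\ v = opair y t).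
have DA : Def1 A by unfold A; def.
pose (mix := cset A).
have inmix v : v ∈ mix <-> A v.
  apply: (cset_sub _ (prod (Un (Un (Un (repl D X)))) R)) => w [s [y [r [t [[tR [sD _]] [yr [_ [_ ->]]]]]]]].
  apply/opair_in_prod; split=> //; apply/in_Un; exists (pair y y); split; first by apply/in_pair; left.
  apply/in_Un; exists (opair y r); split; first by apply/in_pair; left.
  apply/in_Un; exists (X s); split=> //; apply/in_repl; by exists s.
have Kuniq s s' : s ∈ D -> s' ∈ D -> K s ∈ K s' \/ s = s' \/ K s' ∈ K s.
  move=> /inD [sR _] /inD [sR' _].
  have := Ord_trich _ _ (Ord_in _ _ Oo (K1 s sR)) (Ord_in _ _ Oo (K1 s' sR')).
  by move=> [|[/(K2 s s' sR sR')|]]; tauto.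
have own_eq t s : Own t s -> Feq t mix (X s).
  move=> Ht; case: (Ht) => tR [sD [ts Hs]]; case: (inD s) => /(_ sD) [sR _] _.
  apply/FeqE; split=> //; split.
  - move=> y t' tR' /inmix [s' [y' [r [t1 [Hown [yr [rR [tr e]]]]]]]] q qR qt qt'.
    case: (opair_inj _ _ _ _ e) => ? ?; subst y' t1.
    case: Hown => _ [sD' [ts' Hs']]; case: (inD s') => /(_ sD') [sR' _] _.
    have c1 : Cmp R le t' s by exists q; do 2 (split=> //); exact: (lep_trans q t s).
    have c2 : Cmp R le t s' by exists q; do 2 (split=> //); exact: (lep_trans q t' s').
    have ? : s = s' by case: (Kuniq s s' sD sD') => [/(Hs' s sD)|[//|/(Hs s' sD')]].
    subst s'; apply: (MemC_intro q y r) => //; exact: (lep_trans q t' r).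
  - move=> y r rR yr q qR qt qr; apply: (MemC_intro q y q) => //; last exact: lep_refl.
    apply/inmix; exists s, y, r, q; split; last by [].
    split=> //; split=> //; split; first exact: (lep_trans q t s).
    move=> s' sD' Hk [u [uR [uq us]]]; apply: (Hs s' sD' Hk); exists u; split=> //; split=> //.
    exact: (lep_trans u q t).
exists mix => p pR Hd; apply: (proj2 (Rphi mix)) => // q qR qp.
(* With [s] the first member of [D] compatible with [q], a common extension [t] is owned by [s],
   since whatever is compatible with [t] is compatible with [q]. *)
have [|k [Ok [[s [sD [e c]]] Hk]]] := Ord_least (fun k => exists s, s ∈ D /\ k = K s /\ Cmp R le q s).
  have [s [sR [sq Hs]]] := Hd q qR qp; exists (K s); split; first exact: (Ord_in _ _ Oo (K1 s sR)).
  exists s; split; first by apply/inD.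
  by split=> //; exists s; split=> //; split=> //; exact: lep_refl.
subst k; case: (inD s) => /(_ sD) [sR _] _.
case: c => t [tR [tq ts]]; exists t; split=> //; split=> //.
have Ht : Own t s.
  split=> //; split=> //; split=> // s' sD' Hs' [u [uR [ut us]]].
  case: (inD s') => /(_ sD') [sR' _] _.
  have [||e|H] := Hk (K s').
  - exact: (Ord_in _ _ Oo (K1 s' sR')).
  - by exists s'; split=> //; split=> //; exists u; split=> //; split=> //; exact: (lep_trans u t q).
  - by case: (mem_irrefl (K s)); rewrite {1}e.
  - by case: (mem_asym _ _ H).
apply: (Ephi (X s)) => //; first by apply: Feq_sym; exact: own_eq.
by apply: (proj1 (Rphi _) s) => //; exact: X1.
Qed.

Lemma fullness n phi : Val (S n) phi -> forall v, exists x, forall p, p ∈ R ->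
  (forall q, q ∈ R -> lep le q p -> exists s, s ∈ R /\ lep le s q /\ exists y, phi (v, y) s) ->
  phi (v, x) p.
Proof.
move=> [D [H1 H2]] v; apply: (mixing (fun x p => phi (v, x) p)) => //.
- have rc : forall m k (u : env M k), ren m k (fun _ => u).
    move=> m; elim=> [//|k IH] u; split; [exact: IH | exact: atm_c].
  refine (Def_ren 2 (S (S n)) (fun r : env M 2 => (v, snd (fst r), snd r)) _ _ D).
  split; [split|exact: atm_0] => /=; [exact: rc | exact: (atm_S _ _ (atm_0 _))].
- move=> x x' p pR e; apply: H2 => //; split=> //; exact: EnvEq_refl.
Qed.
End Names.

(** * Forcing of the derived connectives and of statements about check names *)

Section Connectives.
Context {M : Type} {HM : Model M}.
Implicit Types (a b c p q r s x y z w : M).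
Context (R le : M) (HP : Poset R le).
Notation MemC := (MemC R le).
Notation SubC := (SubC R le).
Notation Feq := (Feq R le).
Notation fr := (fr R le).
Notation chk := (chk R).

Lemma fr_Imp (A B : fm M) p : p ∈ R ->
  fr (Imp A B) p <-> forall q, q ∈ R -> lep le q p -> fr A q -> fr B q.
Proof.
move=> pR; rewrite /Imp /=; split=> H q qR qp.
- move=> Aq; apply: (proj2 (Reg_fr _ _ HP B) q qR) => s sR sq; apply: NNPP => nB.
  apply: (H s sR (lep_trans _ _ HP s q p sR qR pR sq qp)); split; first exact: (fr_mono _ _ HP _ q).
  move=> t tR ts Bt; apply: nB; exists t; split=> //; split=> //; exact: (lep_trans _ _ HP t s q).
- by move=> [Aq nB]; apply: (nB q qR (lep_refl _ _ HP q qR)); exact: H.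
Qed.

Lemma fr_Ex (F : M -> fm M) p : p ∈ R ->
  fr (Ex F) p <-> forall q, q ∈ R -> lep le q p -> exists s, s ∈ R /\ lep le s q /\ exists x, fr (F x) s.
Proof.
move=> pR; rewrite /Ex /=; split=> H q qR qp.
- apply: NNPP => nH; apply: (H q qR qp) => x s sR sq Hs; apply: nH.
  by exists s; split=> //; split=> //; exists x.
- by move=> K; have [s [sR [sq [x Hx]]]] := H q qR qp; exact: (K x s).
Qed.

Lemma fr_Or (A B : fm M) p : p ∈ R ->
  fr (Or A B) p <-> forall q, q ∈ R -> lep le q p -> exists s, s ∈ R /\ lep le s q /\ (fr A s \/ fr B s).
Proof.
move=> pR; rewrite /Or /=; split=> H q qR qp.
- apply: NNPP => nH; apply: (H q qR qp); split=> s sR sq Hs; apply: nH; exists s; tauto.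
- move=> [K1 K2]; have [s [sR [sq [Hs|Hs]]]] := H q qR qp; [exact: (K1 s) | exact: (K2 s)].
Qed.

Lemma fr_Iff (A B : fm M) p : p ∈ R ->
  fr (Iff A B) p <-> forall q, q ∈ R -> lep le q p -> (fr A q <-> fr B q).
Proof.
move=> pR; have := fr_Imp A B p pR; have := fr_Imp B A p pR => H1 H2; split.
- move=> [K1 K2] q qR qp; split; [move/H2: K1 | move/H1: K2]; by apply.
- by move=> K; split; [apply/H2 | apply/H1] => q qR qp; case: (K q qR qp).
Qed.

Lemma Ex_intro (F : M -> fm M) x p : p ∈ R -> fr (F x) p -> fr (Ex F) p.
Proof.
move=> pR H; apply/fr_Ex => // q qR qp; exists q; split=> //; split; first exact: (lep_refl _ _ HP).
exists x; exact: (fr_mono _ _ HP _ p).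
Qed.

Lemma chk_MemC p x a : p ∈ R ->
  MemC Feq p x (chk a) <->
  forall q, q ∈ R -> lep le q p -> exists s, s ∈ R /\ lep le s q /\ exists z, z ∈ a /\ Feq s x (chk z).
Proof.
move=> pR; split=> H q qR qp; have [s [sR [sq H']]] := H q qR qp; exists s; split=> //; split=> //.
- move: H' => [y [r [rR [/in_chk [z [r' [za [_ e]]]] [sr He]]]]]; case: (opair_inj _ _ _ _ e) => e1 _.
  by exists z; rewrite -e1.
- move: H' => [z [za He]]; exists (chk z), s; split=> //; split; last by split=> //; exact: (lep_refl _ _ HP).
  by apply/in_chk; exists z, s.
Qed.

Lemma chk_MemC_intro p z a : p ∈ R -> z ∈ a -> MemC Feq p (chk z) (chk a).
Proof.
move=> pR za; apply: (MemC_intro _ _ HP _ _ p) => //; last exact: (lep_refl _ _ HP).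
by apply/in_chk; exists z, p.
Qed.

Lemma chk_inj p x y : Feq p (chk x) (chk y) -> x = y.
Proof.
move: x p y; apply: (mem_ind (fun x => forall p y, Feq p (chk x) (chk y) -> x = y)) => x IH p y e.
have pR := Feq_in _ _ _ _ _ e; apply: ext => z; split=> H.
- have := MemC_eqr _ _ HP _ _ _ _ pR e (chk_MemC_intro p z x pR H).
  move=> /(chk_MemC _ _ _ pR) /(_ p pR (lep_refl _ _ HP p pR)) [s [sR [_ [w [wy e']]]]].
  by rewrite (IH z H s w e').
- have := MemC_eqr _ _ HP _ _ _ _ pR (Feq_sym _ _ _ _ _ e) (chk_MemC_intro p z y pR H).
  move=> /(chk_MemC _ _ _ pR) /(_ p pR (lep_refl _ _ HP p pR)) [s [sR [_ [w [wx e']]]]].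
  by rewrite -(IH w wx s z (Feq_sym _ _ _ _ _ e')).
Qed.

Lemma chk_mem p x y : p ∈ R -> MemC Feq p (chk x) (chk y) -> x ∈ y.
Proof.
move=> pR /(chk_MemC _ _ _ pR) /(_ p pR (lep_refl _ _ HP p pR)) [s [sR [_ [w [wy e]]]]].
by rewrite (chk_inj _ _ _ e).
Qed.

(** A condition forcing [x ∈ chk a] has densely many extensions at which [x] equals some [chk z].
    Values are regular and respect forced equality, so the instances at check names suffice. *)
Lemma chk_all n (A : forall X, env X (S n) -> fm X) a (v : env M n) p : p ∈ R -> uniform false (S n) A ->
  fr (All (fun x => Imp (In x (chk a)) (A M (v, x)))) p <-> forall z, z ∈ a -> fr (A M (v, chk z)) p.
Proof.
move=> pR HA; cbn [fr]; split=> H.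
- by move=> z za; apply: (proj1 (fr_Imp _ _ p pR) (H (chk z)) p pR (lep_refl _ _ HP p pR)); exact: chk_MemC_intro.
- move=> x; apply/fr_Imp => // q qR qp /(chk_MemC _ _ _ qR) Hx.
  apply: (proj2 (Reg_fr _ _ HP _) q qR) => t tR tq; have [s [sR [st [z [za e]]]]] := Hx t tR tq.
  exists s; split=> //; split=> //.
  case: (Val_fr _ _ HP _ _ HA) => _ [_ K]; apply: (K (v, chk z)) => //.
    by split; [exact: (EnvEq_refl _ _ HP) | exact: Feq_sym].
  apply: (fr_mono _ _ HP _ p) => //; last exact: H.
  by apply: (lep_trans _ _ HP s t p) => //; exact: (lep_trans _ _ HP t q p).
Qed.
End Connectives.

(** * Names modulo an ultrafilter *)

(** An ultrafilter on the conditions containing all dense open sets (of arbitrary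
    metatheoretic complexity): it need not be generic. *)
Record Ult {M : Type} {HM : Model M} (R le : M) (U : (M -> Prop) -> Prop) : Prop := {
  ult_up : forall A B : M -> Prop, (forall x, A x -> B x) -> U A -> U B;
  ult_and : forall A B, U A -> U B -> U (fun x => A x /\ B x);
  ult_not : forall A, U (fun x => ~ A x) <-> ~ U A;
  ult_dense : forall A : M -> Prop, (forall p q, p ∈ R -> q ∈ R -> lep le q p -> A p -> A q) ->
    (forall p, p ∈ R -> exists q, q ∈ R /\ lep le q p /\ A q) -> U (fun p => p ∈ R /\ A p)
}.

(** The sets that include, below [q], some open set dense below [q] form a filter; any ultrafilter
    extending it will do. *)
Lemma Ult_exists {M : Type} {HM : Model M} (R le q : M) : Poset R le -> q ∈ R ->
  exists U, Ult R le U /\ U (fun p => p ∈ R /\ lep le p q).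
Proof.
move=> HP qR.
pose (op := fun D : M -> Prop => forall p r, p ∈ R -> r ∈ R -> lep le r p -> D p -> D r).
pose (dn := fun D : M -> Prop => forall p, p ∈ R -> lep le p q -> exists r, r ∈ R /\ lep le r p /\ D r).
pose (F := fun A : M -> Prop => exists D, op D /\ dn D /\ forall p, p ∈ R -> lep le p q -> D p -> A p).
have [|||U [FU [U1 [U2 U3]]]] := ultrafilter_exists F.
- move=> A [D [Do [Dd DA]]]; have [r [rR [rq Dr]]] := Dd q qR (lep_refl _ _ HP q qR).
  by exists r; apply: DA.
- exists (fun _ => True); split=> //; split=> // p pR _; exists p; split=> //; split=> //.
  exact: (lep_refl _ _ HP).
- move=> A B [D [Do [Dd DA]]] [D' [Do' [Dd' DB]]].
  exists (fun p => D p /\ D' p); split; [|split].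
  + by move=> p r pR rR rp [H1 H2]; split; [exact: (Do p) | exact: (Do' p)].
  + move=> p pR pq; have [r [rR [rp Dr]]] := Dd p pR pq.
    have [s [sR [sr Ds]]] := Dd' r rR (lep_trans _ _ HP r p q rR pR qR rp pq).
    exists s; split=> //; split; first exact: (lep_trans _ _ HP s r p).
    by split=> //; exact: (Do r).
  + by move=> p pR pq [H1 H2]; split; [exact: DA | exact: DB].
- exists U; split.
  + split=> // A Ao Ad; apply: FU; exists A; split=> //; split; first by move=> p pR _; exact: Ad.
    by [].
  + apply: FU; exists (fun _ => True); split=> //; split; last by [].
    move=> p pR _; exists p; split=> //; split=> //; exact: (lep_refl _ _ HP).
Qed.

Section Ultrapower.
Context {M : Type} {HM : Model M}.
Implicit Types (a b c p q r s x y z w : M).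
Context (R le : M) (HP : Poset R le).
Context (U : (M -> Prop) -> Prop) (HU : Ult R le U).
Notation MemC := (MemC R le).
Notation SubC := (SubC R le).
Notation Feq := (Feq R le).
Notation fr := (fr R le).
Notation chk := (chk R).
Notation Reg := (Reg R le).
Notation Val := (Val R le).
Notation prefl := (lep_refl _ _ HP).
Notation ptrans := (lep_trans _ _ HP).

Definition Tv (A : M -> Prop) := U (fun p => p ∈ R /\ A p).

Lemma Tv_mono (A B : M -> Prop) : (forall p, p ∈ R -> A p -> B p) -> Tv A -> Tv B.
Proof. by move=> H; apply: (ult_up _ _ _ HU) => p [pR Ap]; split=> //; exact: H. Qed.

Lemma Tv_iff (A B : M -> Prop) : (forall p, p ∈ R -> (A p <-> B p)) -> Tv A <-> Tv B.
Proof. by move=> H; split; apply: Tv_mono => p pR; case: (H p pR). Qed.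

Lemma Tv_and (A B : M -> Prop) : Tv (fun p => A p /\ B p) <-> Tv A /\ Tv B.
Proof.
split=> [H|[HA HB]]; first by split; apply: Tv_mono H => p _ [].
by apply: (ult_up _ _ _ HU _ _ _ (ult_and _ _ _ HU _ _ HA HB)) => p; tauto.
Qed.

Lemma Tv_ex (A : M -> Prop) : Tv A -> exists p, p ∈ R /\ A p.
Proof.
move=> H; apply: NNPP => nH.
have K : U (fun x => ~ (x ∈ R /\ A x)).
  by apply: (ult_up _ _ _ HU _ _ _ H) => x [xR Ax] _; apply: nH; exists x.
by case: (ult_not _ _ _ HU (fun x => x ∈ R /\ A x)) => /(_ K).
Qed.

Lemma Tv_true (A : M -> Prop) : (forall p, p ∈ R -> A p) -> Tv A.
Proof.
move=> H.
have K : Tv (fun _ => True).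
  apply: (ult_dense _ _ _ HU) => // p pR; exists p; split=> //; split=> //; exact: prefl.
by apply: Tv_mono K => p pR _; exact: H.
Qed.

(** The conditions that satisfy [A] or have no extension satisfying it form a dense open set, so [U]
    contains it. *)
Lemma Tv_not (A : M -> Prop) : (forall p q, p ∈ R -> q ∈ R -> lep le q p -> A p -> A q) ->
  Tv (fun p => forall q, q ∈ R -> lep le q p -> ~ A q) <-> ~ Tv A.
Proof.
move=> HA; split.
- move=> H1 H2; have [p [pR [K1 K2]]] := Tv_ex _ (proj2 (Tv_and _ _) (conj H1 H2)).
  exact: (K1 p pR (prefl p pR)).
- move=> nA; have K := proj2 (ult_not _ _ _ HU _) nA.
  have D : Tv (fun p => A p \/ forall q, q ∈ R -> lep le q p -> ~ A q).
    apply: (ult_dense _ _ _ HU).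
    + move=> p q pR qR qp [Ap|H]; [left; exact: (HA p) | right=> t tR tq].
      by apply: H => //; exact: (ptrans t q p).
    + move=> p pR; case: (classic (exists q, q ∈ R /\ lep le q p /\ A q)) => [[q [qR [qp Aq]]]|nq].
        by exists q; split=> //; split=> //; left.
      exists p; split=> //; split; first exact: prefl.
      by right=> q qR qp Aq; apply: nq; exists q.
  apply: (ult_up _ _ _ HU _ _ _ (ult_and _ _ _ HU _ _ D K)) => p [[pR H] nH].
  by split=> //; case: H => // Ap; case: nH.
Qed.

Lemma Tv_dor (A B : M -> Prop) : Reg A -> Reg B ->
  Tv (fun p => forall q, q ∈ R -> lep le q p -> exists s, s ∈ R /\ lep le s q /\ (A s \/ B s)) ->
  Tv A \/ Tv B.
Proof.
move=> [A1 _] [B1 _] H; apply: NNPP => /not_or_and [/(Tv_not _ A1) nA /(Tv_not _ B1) nB].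
have [p [pR [[K1 K2] K3]]] := Tv_ex _ (proj2 (Tv_and _ _) (conj (proj2 (Tv_and _ _) (conj nA nB)) H)).
have [s [sR [sp [Hs|Hs]]]] := K3 p pR (prefl p pR); [exact: (K1 s) | exact: (K2 s)].
Qed.

(** An ultrafilter need not respect infinite meets, so universality is tested on one name: by
    fullness some [x] is a counterexample wherever counterexamples are dense. *)
Lemma Tv_all n phi v : Val (S n) phi -> (forall x, Tv (phi (v, x))) <-> Tv (fun p => forall x, phi (v, x) p).
Proof.
move=> V; split; last by move=> H x; apply: Tv_mono H => p _.
move=> H; apply: NNPP => nH.
have [x Hx] := fullness R le HP n _ (Val_not R le HP _ _ V) v.
have [D [Rphi E]] := V.
have Ra : Reg (fun p => forall x, phi (v, x) p) by apply: Reg_all.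
move: nH => /(Tv_not _ (proj1 Ra)) nH.
have K : Tv (fun p => forall q, q ∈ R -> lep le q p -> ~ phi (v, x) q).
  apply: Tv_mono nH => p pR nA; apply: (Hx p pR) => q qR qp; apply: NNPP => nE.
  apply: (nA q qR qp) => y; apply: (proj2 (Rphi _)) => // s sR sq; apply: NNPP => nF.
  apply: nE; exists s; split=> //; split=> //; exists y => t tR ts Ht; apply: nF.
  by exists t.
by move: K => /(Tv_not _ (proj1 (Rphi _))); apply; exact: H.
Qed.

Definition eqU a b := Tv (fun p => Feq p a b).
Definition MU : Type := quot eqU.
Definition nm : M -> MU := cls eqU.

Lemma nm_surj (X : MU) : exists a, X = nm a. Proof. exact: cls_surj. Qed.
Lemma nm_eq a b : nm a = nm b <-> Tv (fun p => Feq p a b).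
Proof.
apply: cls_eq.
- by move=> x; apply: Tv_true => p pR; exact: (Feq_refl _ _ HP).
- by move=> x y; apply: Tv_mono => p _; exact: Feq_sym.
- move=> x y z H1 H2; have := proj2 (Tv_and _ _) (conj H1 H2).
  by apply: Tv_mono => p _ [K1 K2]; exact: (Feq_trans _ _ HP _ _ _ _ K1 K2).
Qed.

Definition memU (X Y : MU) := exists a b, X = nm a /\ Y = nm b /\ Tv (fun p => MemC Feq p a b).
Lemma memU_nm a b : memU (nm a) (nm b) <-> Tv (fun p => MemC Feq p a b).
Proof.
split=> [[a' [b' [/nm_eq H1 [/nm_eq H2 H3]]]]|H]; last by exists a, b.
have := proj2 (Tv_and _ _) (conj (proj2 (Tv_and _ _) (conj H1 H2)) H3).
apply: Tv_mono => p pR [[K1 K2] K3].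
apply: (MemC_eql _ _ HP _ a') => //; first exact: Feq_sym.
by apply: (MemC_eqr _ _ HP _ _ b') => //; exact: Feq_sym.
Qed.

(** The theorem of Łoś for the Boolean ultrapower, with [Tv_all] as the quantifier case. *)
Lemma los n A : uniform false n A -> forall v : env M n,
  sem memU eq (A MU (emap nm v)) <-> Tv (fr (A M v)).
Proof.
move=> H; elim: H => {n A} //=.
- move=> n s t Hs Ht v; rewrite (pvar_emap nm n s Hs) (pvar_emap nm n t Ht); exact: memU_nm.
- move=> n s t Hs Ht v; rewrite (pvar_emap nm n s Hs) (pvar_emap nm n t Ht); exact: nm_eq.
- by move=> n A HA IH v; rewrite IH Tv_not //; exact: (proj1 (Reg_fr _ _ HP _)).
- by move=> n A B HA IHA HB IHB v; rewrite IHA IHB Tv_and.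
- move=> n A HA IH v; rewrite -(Tv_all n (fun v => fr (A M v)) v (Val_fr _ _ HP _ _ HA)).
  split=> H x; first by apply/(IH (v, x)); exact: (H (nm x)).
  by have [a ->] := nm_surj x; apply/(IH (v, a)).
Qed.

(** [Lv n A phi] : [phi] is the Boolean value of the relation [A] on the quotient. *)
Definition Lv n (A : env MU n -> Prop) (phi : env M n -> M -> Prop) :=
  Val n phi /\ forall v, A (emap nm v) <-> Tv (phi v).

Lemma Lv_not n A phi : Lv n A phi -> Lv n (fun v => ~ A v) (fun v p => forall q, q ∈ R -> lep le q p -> ~ phi v q).
Proof.
move=> [V H]; split; first exact: (Val_not _ _ HP).
by move=> v; rewrite H Tv_not //; case: V => _ [K _]; case: (K v).
Qed.

Lemma Lv_and n A B phi psi : Lv n A phi -> Lv n B psi ->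
  Lv n (fun v => A v /\ B v) (fun v p => phi v p /\ psi v p).
Proof.
move=> [V H] [V' H']; split; first exact: Val_and.
by move=> v; rewrite H H' Tv_and.
Qed.

Lemma Lv_all n A phi : Lv (S n) A phi -> Lv n (fun v => forall X : MU, A (v, X)) (fun v p => forall x, phi (v, x) p).
Proof.
move=> [V H]; split; first exact: (Val_all _ _ HP).
move=> v; rewrite -(Tv_all n phi v V); split=> K x; first by apply/(H (v, x)); exact: (K (nm x)).
by have [a ->] := nm_surj x; apply/(H (v, a)).
Qed.

Lemma Val_equiv n phi psi : Val n phi -> Def (S n) (fun v => psi (fst v) (snd v)) ->
  (forall v p, p ∈ R -> (phi v p <-> psi v p)) -> Val n psi.
Proof.
move=> [D [H1 H2]] D' E; split=> //; split.
- move=> v; split.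
  + by move=> p q pR qR qp /(E v p pR) K; apply/(E v q qR); case: (H1 v) => K' _; exact: (K' p).
  + move=> p pR K; apply/(E v p pR); case: (H1 v) => _ K'; apply: K' => // q qR qp.
    by have [s [sR [sq Hs]]] := K q qR qp; exists s; split=> //; split=> //; apply/(E v s sR).
- by move=> v v' p pR e /(E v p pR) K; apply/(E v' p pR); exact: (H2 v).
Qed.

Lemma Lv_equiv n A phi psi : Lv n A phi -> Def (S n) (fun v => psi (fst v) (snd v)) ->
  (forall v p, p ∈ R -> (phi v p <-> psi v p)) -> Lv n A psi.
Proof.
move=> [V H] D E; split; first exact: Val_equiv V D E.
by move=> v; rewrite H; apply: Tv_iff => p pR; exact: E.
Qed.

Lemma Def_below n (phi : env M n -> M -> Prop) : Def (S n) (fun v => phi (fst v) (snd v)) ->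
  Def (S (S n)) (fun v => phi (fst (fst v)) (snd v)).
Proof.
move=> D; apply: (Def_ren (S (S n)) (S n) (fun v => (fst (fst v), snd v)) _ _ D); split; last exact: atm_0.
exact: (ren_S _ _ _ (ren_S _ _ _ (ren_id n))).
Qed.

Lemma Lv_imp n A B phi psi : Lv n A phi -> Lv n B psi ->
  Lv n (fun v => A v -> B v) (fun v p => forall q, q ∈ R -> lep le q p -> phi v q -> psi v q).
Proof.
move=> HA HB; have [[D [R1 E1]] H1] := HA; have [[D' [R2 E2]] H2] := HB.
have := Lv_not _ _ _ (Lv_and _ _ _ _ _ HA (Lv_not _ _ _ HB)) => K.
have K' : Lv n (fun v => A v -> B v) (fun v p => forall q, q ∈ R -> lep le q p ->
    ~ (phi v q /\ (forall q0, q0 ∈ R -> lep le q0 q -> ~ psi v q0))).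
  by case: K => V KH; split=> // v; rewrite -KH; tauto.
apply: (Lv_equiv _ _ _ _ K').
- apply: Def_all; apply: Def_imp; first by def.
  by apply: Def_imp; [def | apply: Def_imp; exact: Def_below].
- move=> v p pR; split=> H q qR qp.
  + move=> Aq; apply: (proj2 (R2 v) q qR) => s sR sq; apply: NNPP => nB.
    apply: (H s sR (ptrans s q p sR qR pR sq qp)); split; first exact: (proj1 (R1 v) q).
    move=> t tR ts Bt; apply: nB; exists t; split=> //; split=> //; exact: (ptrans t s q).
  + by move=> [Aq nB]; apply: (nB q qR (prefl q qR)); exact: H.
Qed.

Lemma Lv_ex n A phi : Lv (S n) A phi -> Lv n (fun v => exists X : MU, A (v, X))
  (fun v p => forall q, q ∈ R -> lep le q p -> exists s, s ∈ R /\ lep le s q /\ exists x, phi (v, x) s).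
Proof.
move=> HA; have [[D [R1 E1]] H1] := HA.
have [V H] := Lv_not _ _ _ (Lv_all _ _ _ (Lv_not _ _ _ HA)).
have K : Lv n (fun v => exists X : MU, A (v, X)) (fun v p => forall q, q ∈ R -> lep le q p ->
    ~ (forall x, forall s, s ∈ R -> lep le s q -> ~ phi (v, x) s)).
  split=> // v; rewrite -H; split; first by move=> [x Hx] /(_ x).
  by move/not_all_ex_not => [x /NNPP Hx]; exists x.
apply: (Lv_equiv _ _ _ _ K).
- apply: Def_all; apply: Def_imp; first by def.
  apply: Def_imp; first by def.
  apply: Def_ex; apply: Def_and; first by def.
  apply: Def_and; first by def.
  apply: Def_ex.
  apply: (Def_ren (S (S (S (S n)))) (S (S n)) (fun v => (fst (fst (fst (fst v))), snd v, snd (fst v))) _ _ D).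
  split; first split; last exact: (atm_S _ _ (atm_0 _)); last exact: atm_0.
  exact: (ren_S _ _ _ (ren_S _ _ _ (ren_S _ _ _ (ren_S _ _ _ (ren_id n))))).
- move=> v p pR; split=> H' q qR qp.
  + apply: NNPP => nE; apply: (H' q qR qp) => x s sR sq Hs; apply: nE.
    by exists s; split=> //; split=> //; exists x.
  + by move=> K'; have [s [sR [sq [x Hx]]]] := H' q qR qp; exact: (K' x s).
Qed.

Lemma Lv_mem n (s t : env MU n -> MU) (s' t' : env M n -> M) :
  Lift R le n s' -> Lift R le n t' -> (forall v, s (emap nm v) = nm (s' v)) ->
  (forall v, t (emap nm v) = nm (t' v)) ->
  Lv n (fun v => memU (s v) (t v)) (fun v p => MemC Feq p (s' v) (t' v)).
Proof.
move=> Hs Ht es et; split; first exact: (Val_mem _ _ HP).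
by move=> v; rewrite es et memU_nm.
Qed.

Lemma atm_lift n (t : env MU n -> MU) : atm n t ->
  exists t' : env M n -> M, atm n t' /\ forall v, t (emap nm v) = nm (t' v).
Proof.
move=> H; elim: H => {n t} [n c|n|n t _ [t' [H1 H2]]].
- by have [a ->] := nm_surj c; exists (fun _ => a); split=> //; exact: atm_c.
- by exists snd; split=> //; exact: atm_0.
- by exists (fun v => t' (fst v)); split; [exact: atm_S | move=> v /=].
Qed.

Lemma ren_lift m n (s : env MU m -> env MU n) : ren m n s ->
  exists s' : env M m -> env M n, ren m n s' /\ forall v, s (emap nm v) = emap nm (s' v).
Proof.
elim: n s => [|n IH] s /=.
  by move=> _; exists (fun _ => tt); split=> // v; case: (s _).
move=> [/IH [s1 [H1 H2]] /atm_lift [t1 [H3 H4]]].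
exists (fun v => (s1 v, t1 v)); split=> // v /=.
by rewrite -H2 -H4; case: (s _).
Qed.

Lemma Lv_ren m n (s : env MU m -> env MU n) A phi : ren m n s -> Lv n A phi -> exists psi, Lv m (fun v => A (s v)) psi.
Proof.
move=> /ren_lift [s' [Hs e]] [[D [R1 E1]] H]; exists (fun v => phi (s' v)); split.
- split; [|split=> //].
  + apply: (Def_ren (S m) (S n) (fun v => (s' (fst v), snd v)) _ _ D); split; last exact: atm_0.
    exact: ren_S.
  + move=> v v' p pR ev; apply: E1 => //.
    move: s' Hs {e D R1 H}; elim: n {A phi s} => [//|n IH] s' [H1 H2] /=; split; first exact: (IH (fun v => fst (s' v))).
    by case: (Lift_atm R le HP _ _ H2) => _; apply.
- by move=> v; rewrite e H.
Qed.

(** A relation on the quotient is definable when its Boolean value is definable in [M]; this is the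
    collection for which the axiom schemas are proved below. *)
Definition DefU n (A : env MU n -> Prop) := exists phi, Lv n A phi.
End Ultrapower.

(** * The extension is a model of ZFC *)

Section UltrapowerModel.
Context {M : Type} {HM : Model M}.
Implicit Types (a b c p q r x y z w : M).
Context (R le : M) (HP : Poset R le).
Context (U : (M -> Prop) -> Prop) (HU : Ult R le U).
Notation MemC := (MemC R le).
Notation SubC := (SubC R le).
Notation Feq := (Feq R le).
Notation fr := (fr R le).
Notation chk := (chk R).
Notation Reg := (Reg R le).
Notation Val := (Val R le).
Notation prefl := (lep_refl _ _ HP).
Notation ptrans := (lep_trans _ _ HP).
Notation Tv := (Tv R U).
Notation MU := (MU R le U).
Notation nm := (nm R le U).
Notation memU := (memU R le U).
Notation Lv := (Lv R le U).
Notation DefU := (DefU R le U).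
Notation memU_nm := (memU_nm _ _ HP _ HU).
Notation nm_eq := (nm_eq _ _ HP _ HU).
Notation Tv_mono := (Tv_mono R le U HU).
Notation Tv_iff := (Tv_iff R le U HU).
Notation Tv_and := (Tv_and R le U HU).
Notation Tv_true := (Tv_true R le HP U HU).
Notation MemC_refl := (fun z r b p pR rR zr pr => MemC_intro R le HP p z r b pR rR zr pr).

Notation Lv_not := (Lv_not R le HP U HU).
Notation Lv_and := (Lv_and R le U HU).
Notation Lv_all := (Lv_all R le HP U HU).
Notation Lv_imp := (Lv_imp R le HP U HU).
Notation Lv_ex := (Lv_ex R le HP U HU).
Notation Lv_mem := (Lv_mem R le HP U HU).
Notation Lv_ren := (Lv_ren R le HP U).

Lemma Lv_memv n (i j : forall X, env X n -> X) : pvar n i -> pvar n j ->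
  Lv n (fun v => memU (i _ v) (j _ v)) (fun v p => MemC Feq p (i _ v) (j _ v)).
Proof.
have P k t : pvar k t -> Lift R le k (t M).
  move=> H; apply: (Lift_atm _ _ HP); elim: H => {k t} [k|k t _ IH]; [exact: atm_0 | exact: atm_S].
move=> Hi Hj; apply: (Lv_mem); [exact: P | exact: P | |]; move=> v; exact: pvar_emap.
Qed.

Lemma DefU_E : DefU 2 (fun v => memU (snd (fst v)) (snd v)).
Proof. exists (fun v p => MemC Feq p (snd (fst v)) (snd v)); apply: (Lv_memv 2 (fun X v => snd (fst v)) (fun X v => snd v)); pv. Qed.

Lemma DefU_not n A : DefU n A -> DefU n (fun v => ~ A v).
Proof. move=> [phi H]; eexists; exact: (Lv_not _ _ _ H). Qed.

Lemma DefU_and n A B : DefU n A -> DefU n B -> DefU n (fun v => A v /\ B v).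
Proof. move=> [phi H] [psi H']; eexists; exact: (Lv_and _ _ _ _ _ H H'). Qed.

Lemma DefU_all n A : DefU (S n) A -> DefU n (fun v => forall X, A (v, X)).
Proof. move=> [phi H]; eexists; exact: (Lv_all _ _ _ H). Qed.

Lemma DefU_ren m n (s : env MU m -> env MU n) A : ren m n s -> DefU n A -> DefU m (fun v => A (s v)).
Proof. move=> Hs [phi H]; exact: (Lv_ren _ _ _ _ _ Hs H). Qed.

Lemma MU_ext (X Y : MU) : (forall Z, memU Z X <-> memU Z Y) -> X = Y.
Proof.
have [a ->] := nm_surj _ _ _ X; have [b ->] := nm_surj _ _ _ Y => H; apply/nm_eq.
have L1 := Lv_memv 3 (fun X v => snd v) (fun X v => snd (fst (fst v))) ltac:(pv) ltac:(pv).
have L2 := Lv_memv 3 (fun X v => snd v) (fun X v => snd (fst v)) ltac:(pv) ltac:(pv).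
have [_ L] := Lv_all 2 _ _ (Lv_and _ _ _ _ _ (Lv_imp _ _ _ _ _ L1 L2)
  (Lv_imp _ _ _ _ _ L2 L1)).
have K := proj1 (L (tt, a, b)) (fun X => conj (proj1 (H X)) (proj2 (H X))).
apply: Tv_mono K => p pR /= K; apply/FeqE; split=> //; split.
- move=> z r rR zr q qR qp qr; apply: (proj1 (K z) q qR qp); exact: MemC_refl qr.
- move=> z r rR zr q qR qp qr; apply: (proj2 (K z) q qR qp); exact: MemC_refl qr.
Qed.

(** The quotient may be ill-founded, so the induction is transferred to names: the inductive step
    has a Boolean value in [U], and below a condition in that value [dom_ind] runs in [M]. *)
Lemma MU_ind (A : MU -> Prop) : DefU 1 (fun v => A (snd v)) ->
  (forall X, (forall Y, memU Y X -> A Y) -> A X) -> forall X, A X.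
Proof.
move=> [phi H] HA X; have [a ->] := nm_surj _ _ _ X.
have [[D [Rphi E]] H1] := H.
have phi2 : Lv 2 (fun v => A (snd v)) (fun v p => phi (tt, snd v) p).
  split; [split; [|split] | ].
  - apply: (Def_ren 3 2 (fun v => (tt, snd (fst v), snd v)) _ _ D).
    by split; [split => //; exact: (atm_S _ _ (atm_0 _)) | exact: atm_0].
  - by move=> v; exact: Rphi.
  - by move=> v v' p pR [_ e]; apply: E => //; split.
  - by move=> v; exact: (H1 (tt, snd v)).
have L1 := Lv_memv 2 (fun X v => snd v) (fun X v => snd (fst v)) ltac:(pv) ltac:(pv).
have [_ L] := Lv_all 0 _ _ (Lv_imp 1 _ _ _ _
  (Lv_all 1 _ _ (Lv_imp 2 _ _ _ _ L1 phi2)) H).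
have {}L := proj1 (L tt) HA; apply/(H1 (tt, a)); apply: Tv_mono L => p pR /= L.
have Dphi : Def2 (fun x q => phi (tt, x) q).
  apply: (Def_ren 2 2 (fun v => (tt, snd (fst v), snd v)) _ _ D).
  by split; [split => //; exact: (atm_S _ _ (atm_0 _)) | exact: atm_0].
have K : forall x, forall q, q ∈ R -> lep le q p -> phi (tt, x) q.
  apply: (dom_ind (fun x => forall q, q ∈ R -> lep le q p -> phi (tt, x) q)) => x IH q qR qp.
  apply: (L x q qR qp) => y s sR sq Hy; apply: (proj2 (Rphi _) s sR) => t tR ts.
  have [u [uR [ut [z [r [rR [zr [ur e]]]]]]]] := Hy t tR ts; exists u; split=> //; split=> //.
  apply: (E (tt, z)) => //; first by split=> //; exact: Feq_sym.
  apply: (IH z r zr) => //; apply: (ptrans u q p) => //.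
  by apply: (ptrans u t q) => //; exact: (ptrans t s q).
exact: (K a p pR (prefl p pR)).
Qed.

(** The name [b] offers [z] at each [t] that is below some [r] with [(z, r)] in [a] and that lies in
    the Boolean value of the property at [z]. *)
Lemma MU_sep (A : MU -> Prop) : DefU 1 (fun v => A (snd v)) ->
  forall X, exists Y, forall Z, memU Z Y <-> memU Z X /\ A Z.
Proof.
move=> [phi [[D [Rphi E]] H1]] X; have [a ->] := nm_surj _ _ _ X.
pose (phi1 := fun x q => phi (tt, x) q).
have Dphi : Def2 phi1.
  apply: (Def_ren 2 2 (fun v => (tt, snd (fst v), snd v)) _ _ D).
  by split; [split => //; exact: (atm_S _ _ (atm_0 _)) | exact: atm_0].
pose (b := cset (fun v => exists z r t, opair z r ∈ a /\ r ∈ R /\ t ∈ R /\ lep le t r /\ phi1 z t /\ v = opair z t)).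
have inb v : v ∈ b <-> exists z r t, opair z r ∈ a /\ r ∈ R /\ t ∈ R /\ lep le t r /\ phi1 z t /\ v = opair z t.
  apply: (cset_sub _ (prod (Un (Un a)) R)) => w [z [r [t [zr [_ [tR [_ [_ ->]]]]]]]].
  by apply/opair_in_prod; split=> //; exact: opair_dom zr.
exists (nm b) => Z; have [x ->] := nm_surj _ _ _ Z.
rewrite !memU_nm (H1 (tt, x)) -Tv_and; apply: Tv_iff => p pR; split.
- move=> H; split.
  + move=> q qR qp; have [s [sR [sq [y [t [tR [/inb [z [r [t' [zr [rR [_ [tr [_ e]]]]]]]] [st Hs]]]]]]]] := H q qR qp.
    case: (opair_inj _ _ _ _ e) => ? ?; subst z t'.
    exists s; split=> //; split=> //; exists y, r; do 2 (split=> //); split=> //; exact: (ptrans s t r).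
  + apply: (proj2 (Rphi _)) => // q qR qp.
    have [s [sR [sq [y [t [tR [/inb [z [r [t' [zr [rR [_ [tr [Hz e]]]]]]]] [st Hs]]]]]]]] := H q qR qp.
    case: (opair_inj _ _ _ _ e) => ? ?; subst z t'.
    exists s; split=> //; split=> //; apply: (E (tt, y)) => //; first by split=> //; exact: Feq_sym.
    exact: (proj1 (Rphi _) t).
- move=> [H Hx] q qR qp; have [s [sR [sq [y [r [rR [yr [sr Hs]]]]]]]] := H q qR qp.
  exists s; split=> //; split=> //; exists y, s; split=> //; split; last by split=> //; exact: prefl.
  apply/inb; exists y, r, s; do 4 (split=> //); split=> //.
  apply: (E (tt, x)) => //; apply: (proj1 (Rphi _) p) => //; exact: (ptrans s q p).
Qed.

Lemma MU_pair (X Y : MU) : exists Z, forall W, memU W Z <-> W = X \/ W = Y.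
Proof.
have [a ->] := nm_surj _ _ _ X; have [b ->] := nm_surj _ _ _ Y.
exists (nm (prod (pair a b) R)) => W; have [x ->] := nm_surj _ _ _ W.
rewrite memU_nm !nm_eq; split.
- move=> H; apply: (Tv_dor _ _ HP _ HU); [exact: Reg_Feq | exact: Reg_Feq |].
  apply: Tv_mono H => p pR H q qR qp; have [s [sR [sq [y [r [rR [/opair_in_prod [/in_pair yr _] [sr Hs]]]]]]]] := H q qR qp.
  by exists s; split=> //; split=> //; case: yr => <-; [left | right].
- have K c p : c ∈ pair a b -> p ∈ R -> Feq p x c -> MemC Feq p x (prod (pair a b) R).
    move=> Hc pR e; apply: (MemC_eql _ _ HP _ c) => //; first exact: Feq_sym.
    by apply: (MemC_intro _ _ HP _ _ p) => //; [apply/opair_in_prod | exact: prefl].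
  by case; apply: Tv_mono => p pR; apply: K => //; apply/in_pair; [left | right].
Qed.

Lemma MU_union (X : MU) : exists Y, forall Z, memU Z Y <-> exists W, memU Z W /\ memU W X.
Proof.
have [a ->] := nm_surj _ _ _ X.
pose (A := fun v => exists z r y r' t, opair z r ∈ a /\ opair y r' ∈ z /\ r ∈ R /\ r' ∈ R /\ t ∈ R /\
  lep le t r /\ lep le t r' /\ v = opair y t).
pose (b := cset A).
have inb v : v ∈ b <-> A v.
  apply: (cset_sub _ (prod (Un (Un (Un (Un (Un a))))) R)); first by unfold A; def.
  move=> w [z [r [y [r' [t [zr [yr [_ [_ [tR [_ [_ ->]]]]]]]]]]]]; apply/opair_in_prod; split=> //.
  have zz := opair_dom _ _ _ zr; have yy := opair_dom _ _ _ yr.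
  move: yy => /in_Un [u [yu /in_Un [u' [uu uz]]]].
  apply/in_Un; exists u; split=> //; apply/in_Un; exists u'; split=> //; apply/in_Un; by exists z.
exists (nm b) => Z; have [x ->] := nm_surj _ _ _ Z; rewrite memU_nm.
have L1 := Lv_memv 3 (fun X v => snd (fst v)) (fun X v => snd v) ltac:(pv) ltac:(pv).
have L2 := Lv_memv 3 (fun X v => snd v) (fun X v => snd (fst (fst v))) ltac:(pv) ltac:(pv).
have [_ L] := Lv_ex 2 _ _ (Lv_and _ _ _ _ _ L1 L2).
have {L} := L (tt, a, x); cbn [emap fst snd] => ->; apply: Tv_iff => p pR; split=> H q qR qp.
- have [s [sR [sq [y [t [tR [/inb [z [r [y' [r' [t' [zr [yr [rR [rR' [_ [tr [tr' e]]]]]]]]]]]] [st Hs]]]]]]]] := H q qR qp.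
  case: (opair_inj _ _ _ _ e) => ? ?; subst y' t'.
  exists s; split=> //; split=> //; exists z; split.
  + apply: (MemC_eql _ _ HP _ y) => //; first exact: Feq_sym.
    apply: (MemC_intro _ _ HP _ _ r') => //; exact: (ptrans s t r').
  + apply: (MemC_intro _ _ HP _ _ r) => //; exact: (ptrans s t r).
- have [s [sR [sq [w [H1 H2]]]]] := H q qR qp.
  have [s1 [sR1 [ss1 [z [r [rR [zr [sr Hz]]]]]]]] := H2 s sR (prefl s sR).
  have H1' : MemC Feq s1 x z.
    by apply: (MemC_eqr _ _ HP _ _ w) => //; apply: (proj1 (Reg_MemC _ _ HP _ _ _) s).
  have [s2 [sR2 [ss2 [y [r' [rR' [yr [sr' Hy]]]]]]]] := H1' s1 sR1 (prefl s1 sR1).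
  exists s2; split=> //; split; first by apply: (ptrans s2 s1 q) => //; exact: (ptrans s1 s q).
  exists y, s2; split=> //; split; last by split=> //; exact: prefl.
  apply/inb; exists z, r, y, r', s2; do 5 (split=> //); split; first exact: (ptrans s2 s1 r).
  by split.
Qed.

(** Every subset of [X] has a name included in the product of the domain of [a] with [R]: [b']
    records which conditions put an element of that domain into [b]. These names form a set in
    [M]. *)
Lemma MU_power (X : MU) : exists Y, forall Z, (forall W, memU W Z -> memU W X) -> memU Z Y.
Proof.
have [a ->] := nm_surj _ _ _ X.
exists (nm (prod (pow (prod (Un (Un a)) R)) R)) => Z; have [b ->] := nm_surj _ _ _ Z => H.
pose (b' := sep (prod (Un (Un a)) R) (fun v => exists z t, v = opair z t /\ MemC Feq t z b)).
have inb z t : opair z t ∈ b' <-> z ∈ Un (Un a) /\ t ∈ R /\ MemC Feq t z b.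
  rewrite /b' in_sep opair_in_prod; split.
  - by move=> [[H1 H2] [z1 [t1 [e H3]]]]; case: (opair_inj _ _ _ _ e) => ? ?; subst z1 t1.
  - by move=> [H1 [H2 H3]]; split=> //; exists z, t.
have L1 := Lv_memv 3 (fun X v => snd v) (fun X v => snd (fst v)) ltac:(pv) ltac:(pv).
have L2 := Lv_memv 3 (fun X v => snd v) (fun X v => snd (fst (fst v))) ltac:(pv) ltac:(pv).
have [_ L] := Lv_all 2 _ _ (Lv_imp _ _ _ _ _ L1 L2).
have {}L := proj1 (L (tt, a, b)) H.
have -> : nm b = nm b'.
  apply/nm_eq; apply: Tv_mono L => p pR /= L; apply/FeqE; split=> //; split.
  - move=> z r rR zr q qR qp qr t tR tq.
    have Hz : MemC Feq q z b by exact: (MemC_intro _ _ HP _ _ r).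
    have [s [sR [st [y [r' [rR' [yr [sr Hs]]]]]]]] := L z q qR qp Hz t tR tq.
    exists s; split=> //; split=> //; exists y, s; split=> //; split; last by split=> //; exact: prefl.
    apply/inb; split; first exact: opair_dom yr.
    split=> //; apply: (MemC_eql _ _ HP _ z) => //.
    by apply: (proj1 (Reg_MemC _ _ HP _ _ _) q) => //; exact: (ptrans s t q).
  - move=> z t tR /inb [_ [_ Hz]] q qR qp qt; exact: (proj1 (Reg_MemC _ _ HP _ _ _) t).
apply/memU_nm; apply: Tv_true => p pR; apply: (MemC_intro _ _ HP _ _ p) => //; last exact: prefl.
apply/opair_in_prod; split=> //; apply/in_pow => v; by rewrite /b' in_sep => -[].
Qed.

(** [B x y] says that [y] is a witness for [x] at every condition below which witnesses are dense.
    Fullness makes [B] total, so choice in [M] selects one name for each [z] in the domain of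
    [a]. *)
Lemma MU_coll (A : MU -> MU -> Prop) : DefU 2 (fun v => A (snd (fst v)) (snd v)) ->
  forall X, (forall Z, memU Z X -> exists Y, A Z Y) ->
  exists B, forall Z, memU Z X -> exists Y, memU Y B /\ A Z Y.
Proof.
move=> [phi H] X; have [a ->] := nm_surj _ _ _ X => HX.
have [V H1] := H; have [D [Rphi E]] := V.
pose (phi1 := fun x y q => phi (tt, x, y) q).
have Dphi : Def3 phi1.
  apply: (Def_ren 3 3 (fun v => (tt, snd (fst (fst v)), snd (fst v), snd v)) _ _ D).
  by split; [split; [split=> //|] |]; [exact: (atm_S _ _ (atm_S _ _ (atm_0 _))) | exact: (atm_S _ _ (atm_0 _)) | exact: atm_0].
pose (B := fun x y => forall p, p ∈ R -> (forall q, q ∈ R -> lep le q p -> exists s, s ∈ R /\ lep le s q /\ exists y', phi1 x y' s) ->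
  phi1 x y p).
have DB : Def2 B by unfold B; def.
have [|Y [HY HY']] := definable_choice B (Un (Un a)) _.
  by move=> x _; exact: (fullness _ _ HP _ _ V (tt, x)).
exists (nm (prod (repl (Un (Un a)) Y) R)) => Z; have [x ->] := nm_surj _ _ _ Z => xa.
have [_ Lx] := Lv_ex 1 _ _ H.
have K := proj1 (Lx (tt, x)) (HX _ xa).
have Lb : Lv 1 (fun v => memU (snd v) (nm (prod (repl (Un (Un a)) Y) R)))
   (fun v p => MemC Feq p (snd v) (prod (repl (Un (Un a)) Y) R)).
  by apply: (Lv_mem) => //; apply: (Lift_atm _ _ HP); [exact: atm_0 | exact: atm_c].
have Lb2 : Lv 2 (fun v => memU (snd v) (nm (prod (repl (Un (Un a)) Y) R)))
   (fun v p => MemC Feq p (snd v) (prod (repl (Un (Un a)) Y) R)).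
  by apply: (Lv_mem) => //; apply: (Lift_atm _ _ HP); [exact: atm_0 | exact: atm_c].
have [_ L] := Lv_ex 1 _ _ (Lv_and 2 _ _ _ _ Lb2 H).
apply: (proj2 (L (tt, x))).
have := proj2 (Tv_and _ _) (conj (proj1 (memU_nm _ _) xa) K).
apply: Tv_mono => p pR [K1 K2] q qR qp.
have [s [sR [sq [z [r [rR [zr [sr e]]]]]]]] := K1 q qR qp.
have sp : lep le s p by exact: (ptrans s q p).
exists s; split=> //; split=> //; exists (Y z); split.
- apply: (MemC_intro _ _ HP _ _ s) => //; last exact: prefl.
  apply/opair_in_prod; split=> //; apply/in_repl; exists z; split=> //; exact: opair_dom zr.
- apply: (E (tt, z, Y z)) => //.
    by split; [split=> //; exact: Feq_sym | exact: (Feq_refl _ _ HP)].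
  apply: (HY' z (opair_dom _ _ _ zr) s sR) => t tR ts.
  have [u [uR [ut [y Hy]]]] := K2 t tR (ptrans t s p tR sR pR ts sp).
  exists u; split=> //; split=> //; exists y; apply: (E (tt, x, y)) => //.
  split; [split=> // |exact: (Feq_refl _ _ HP)].
  by apply: (Feq_mono _ _ HP s) => //; exact: (ptrans u t s).
Qed.

Lemma MU_inf : exists W, (exists X, memU X W /\ forall Z, ~ memU Z X) /\
  forall K, memU K W -> exists N, memU N W /\ forall Z, memU Z N <-> memU Z K \/ Z = K.
Proof.
exists (nm (chk ω)); split.
  exists (nm (chk emp)); split.
    apply/memU_nm; apply: Tv_true => p pR; apply: (chk_MemC_intro _ _ HP) => //; apply/in_ω; exact: Nat_emp.
  move=> Z; have [z ->] := nm_surj _ _ _ Z => /memU_nm /(Tv_ex _ _ _ HU) [p [pR]].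
  move=> /(chk_MemC _ _ HP _ _ _ pR) /(_ p pR (prefl p pR)) [s [_ [_ [w [we _]]]]].
  exact: (in_emp w we).
move=> K; have [k ->] := nm_surj _ _ _ K => /memU_nm H.
have Un : uniform false 2 (fun X v => Ex (fun m => And (In m (snd (fst v))) (isSucc m (snd v)))) by unif.
have L := los _ _ HP _ HU _ _ Un (tt, chk ω, k).
have S : sem memU eq (Ex (fun m => And (In m (nm (chk ω))) (isSucc m (nm k)))) <->
  exists N, memU N (nm (chk ω)) /\ forall Z, memU Z N <-> memU Z (nm k) \/ Z = nm k.
  by unfold isSucc; sati.
apply/S/L; apply: Tv_mono H => p pR H; change (fr (Ex (fun m => And (In m (chk ω)) (isSucc m k))) p).
apply/(fr_Ex R le) => // q qR qp.
have [s [sR [sq [j [/in_ω jω e]]]]] := proj1 (chk_MemC _ _ HP _ _ _ pR) H q qR qp.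
exists s; split=> //; split=> //; exists (chk (succ j)); split.
  by apply: (chk_MemC_intro _ _ HP) => //; apply/in_ω; exact: Nat_succ.
move=> z; apply/(fr_Iff _ _ HP) => // t tR ts; have e' := Feq_mono _ _ HP _ _ _ _ tR ts e; split.
- move=> Hz; apply/(fr_Or R le) => // t' tR' tt'.
  have [u [uR [ut [i [/in_succ ij ei]]]]] := proj1 (chk_MemC _ _ HP _ _ _ tR) Hz t' tR' tt'.
  have e2 := Feq_mono _ _ HP _ _ _ _ uR (ptrans u t' t uR tR' tR ut tt') e'.
  exists u; split=> //; split=> //; case: ij => [ij|?]; [left | right; subst i].
  + apply: (MemC_eqr _ _ HP _ _ (chk j)) => //; first exact: Feq_sym.
    apply: (MemC_eql _ _ HP _ (chk i)) => //; first exact: Feq_sym.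
    exact: (chk_MemC_intro _ _ HP).
  + exact: (Feq_trans _ _ HP _ _ _ _ ei (Feq_sym _ _ _ _ _ e2)).
- move=> /(fr_Or R le _ _ _ tR) Hz; apply: (proj2 (Reg_MemC _ _ HP _ _ _)) => // t' tR' tt'.
  have [u [uR [ut Hu]]] := Hz t' tR' tt'; exists u; split=> //; split=> //.
  have e2 := Feq_mono _ _ HP _ _ _ _ uR (ptrans u t' t uR tR' tR ut tt') e'.
  case: Hu => Hu.
  + have Hu' := MemC_eqr _ _ HP _ _ _ _ uR e2 Hu; apply/(chk_MemC _ _ HP) => // t1 tR1 tu1.
    have [u1 [uR1 [ut1 [i [ij ei]]]]] := proj1 (chk_MemC _ _ HP _ _ _ uR) Hu' t1 tR1 tu1.
    by exists u1; split=> //; split=> //; exists i; split=> //; apply/in_succ; left.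
  + apply: (MemC_eql _ _ HP _ (chk j)) => //.
      by apply: Feq_sym; exact: (Feq_trans _ _ HP _ _ _ _ Hu e2).
    by apply: (chk_MemC_intro _ _ HP) => //; apply/in_succ; right.
Qed.

Lemma fr_transitive_chk a p : Tr a -> p ∈ R -> fr (Defs.transitive (chk a)) p.
Proof.
move=> Ta pR.
have U1 : uniform false 2 (fun X v => sub (snd v) (snd (fst v))) by unif.
have U2 : uniform false 2 (fun X v => In (snd v) (snd (fst v))) by unif.
apply: (proj2 (chk_all _ _ HP 1 _ a (tt, chk a) p pR U1)) => z za.
apply: (proj2 (chk_all _ _ HP 1 _ z (tt, chk a) p pR U2)) => w wz.
by apply: (chk_MemC_intro _ _ HP) => //; exact: (Ta z).
Qed.

Lemma fr_ordinal_chk a p : Ord a -> p ∈ R -> fr (ordinal (chk a)) p.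
Proof.
move=> [Ta Ha] pR; split; first exact: fr_transitive_chk.
have U1 : uniform false 2 (fun X v => Defs.transitive (snd v)) by unif.
apply: (proj2 (chk_all _ _ HP 1 _ a (tt, chk a) p pR U1)) => z za.
by apply: fr_transitive_chk => //; exact: Ha.
Qed.

Lemma emap_eq n (v v' : env M n) : emap nm v = emap nm v' -> Tv (fun p => EnvEq R le p n v v').
Proof.
elim: n v v' => [|n IH] v v' /=; first by move=> _; exact: Tv_true.
move=> e; have H1 := IH _ _ (f_equal fst e); have H2 : nm (snd v) = nm (snd v') := f_equal snd e.
by apply/Tv_and; split=> //; apply/nm_eq.
Qed.

Lemma Lv_of_Val n phi : Val n phi -> Lv n (fun V => exists v, V = emap nm v /\ Tv (phi v)) phi.
Proof.
move=> V; split=> // v; split=> [[v' [/emap_eq e H]]|H]; last by exists v.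
have := proj2 (Tv_and _ _) (conj e H); apply: Tv_mono => p pR [K1 K2].
case: V => _ [_ E]; apply: (E v') => //; exact: EnvEq_sym.
Qed.

(** An injection [K] of the domain of [a] into an ordinal codes an element of [X] by the check name
    of [K y], where [y] is a name of it. One element may have several names and hence several codes,
    but a code determines [y] and so the element. *)
Lemma MU_choice (X : MU) : exists A : MU -> MU -> Prop,
    DefU 2 (fun v => A (snd (fst v)) (snd v)) /\
    (forall Z, memU Z X -> exists O, A Z O /\
       (forall Y, memU Y O -> forall Z, memU Z Y -> memU Z O) /\
       (forall W, memU W O -> forall Y, memU Y W -> forall Z, memU Z Y -> memU Z W)) /\
    (forall Z Z' O, A Z O -> A Z' O -> Z = Z').
Proof.
have [a ->] := nm_surj _ _ _ X.
have [o [Oo Lo]] := Le_Ord (Un (Un a)); have [K [HK [K1 K2]]] := Le_elim _ _ Lo.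
pose (S := fun x o s => exists y, y ∈ Un (Un a) /\ Feq s x y /\ Feq s o (chk (K y))).
have DS : Def3 S by unfold S; def.
pose (phi := fun (v : env M 2) p => forall q, q ∈ R -> lep le q p -> exists s, s ∈ R /\ lep le s q /\
   S (snd (fst v)) (snd v) s).
have V : Val 2 phi.
  split; [|split].
  - unfold phi; def.
  - move=> v; apply: (Reg_dense _ _ HP) => p q pR qR qp [y [yD [e1 e2]]]; exists y; split=> //.
    by split; apply: (Feq_mono _ _ HP p).
  - move=> v v' p pR [[_ e1] e2] H q qR qp; have [s [sR [sq [y [yD [e3 e4]]]]]] := H q qR qp.
    have sp := ptrans s q p sR qR pR sq qp.
    exists s; split=> //; split=> //; exists y; split=> //; split.
    + apply: (Feq_trans _ _ HP _ _ _ _ _ e3); apply: Feq_sym; exact: (Feq_mono _ _ HP p).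
    + apply: (Feq_trans _ _ HP _ _ _ _ _ e4); apply: Feq_sym; exact: (Feq_mono _ _ HP p).
have LA := Lv_of_Val _ _ V.
exists (fun Z O : MU => exists v : env M 2, ((tt, Z, O) : env MU 2) = emap nm v /\ Tv (phi v)); split; [|split].
- exists phi; split=> // v; rewrite -(proj2 LA v).
  by case: v => [[[] z] o'].
- move=> Z; have [z ->] := nm_surj _ _ _ Z => /memU_nm Hz.
  have [_ L] := Lv_ex _ _ _ LA.
  have [|O HO] := proj2 (L (tt, z)).
    apply: Tv_mono Hz => p pR Hz q qR qp; have [s [sR [sq [y [r [rR [yr [sr e]]]]]]]] := Hz q qR qp.
    exists s; split=> //; split=> //; exists (chk (K y)) => t tR ts; exists t; split=> //.
    split; first exact: prefl.
    exists y; split; first exact: opair_dom yr.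
    by split; [exact: (Feq_mono _ _ HP s) | exact: (Feq_refl _ _ HP)].
  exists O; split=> //; move: HO => [[[[] z'] o'] [e HO]].
  have -> : O = nm o' by case: e.
  have Uo : uniform false 1 (fun X v => ordinal (snd v)) by unif.
  have S1 : sem memU eq (ordinal (nm o')) <->
     (forall Y, memU Y (nm o') -> forall Z, memU Z Y -> memU Z (nm o')) /\
     (forall W, memU W (nm o') -> forall Y, memU Y W -> forall Z, memU Z Y -> memU Z W).
    by unfold ordinal, Defs.transitive, sub; sati.
  apply/S1/(los _ _ HP _ HU _ _ Uo (tt, o')); apply: Tv_mono HO => p pR H.
  apply: (proj2 (Reg_fr _ _ HP _)) => // q qR qp; have [s [sR [sq [y [yD [e3 e4]]]]]] := H q qR qp.
  exists s; split=> //; split=> //.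
  case: (Val_fr _ _ HP _ _ Uo) => _ [_ E]; apply: (E (tt, chk (K y))) => //.
    by split=> //; exact: Feq_sym.
  apply: fr_ordinal_chk => //; exact: (Ord_in _ _ Oo (K1 _ yD)).
- move=> Z Z' O [[[[] z] o1] [e1 H1]] [[[[] z'] o2] [e2 H2]].
  have eo : nm o1 = nm o2 by case: e1 => _ <-; case: e2.
  have -> : Z = nm z by case: e1.
  have -> : Z' = nm z' by case: e2.
  apply/nm_eq; move/nm_eq: eo => eo.
  have := proj2 (Tv_and _ _) (conj eo (proj2 (Tv_and _ _) (conj H1 H2))).
  apply: Tv_mono => p pR [e [K3 K4]]; apply: (proj2 (Reg_Feq _ _ HP _ _)) => // q qR qp.
  have [s [sR [sq [y [yD [e3 e4]]]]]] := K3 q qR qp.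
  have sp := ptrans s q p sR qR pR sq qp.
  have [t [tR [ts [y' [yD' [e5 e6]]]]]] := K4 s sR sp.
  have tp := ptrans t s p tR sR pR ts sp.
  exists t; split=> //; split; first exact: (ptrans t s q).
  have Ky : K y = K y'.
    apply: (chk_inj _ _ HP t); apply: (Feq_trans _ _ HP _ _ o1).
      apply: Feq_sym; exact: (Feq_mono _ _ HP s t _ _ tR ts e4).
    apply: (Feq_trans _ _ HP _ _ o2 _ _ e6); exact: (Feq_mono _ _ HP p t _ _ tR tp e).
  have ? := K2 _ _ yD yD' Ky; subst y'.
  apply: (Feq_trans _ _ HP _ _ y); first exact: (Feq_mono _ _ HP s).
  exact: Feq_sym.
Qed.

Definition MUModel : Model MU := {|
  mem := memU;
  Def := DefU;
  Def_mem := DefU_E;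
  Def_not := DefU_not;
  Def_and := DefU_and;
  Def_all0 := DefU_all;
  Def_ren := DefU_ren;
  m_ext := MU_ext;
  m_ind := MU_ind;
  m_sep := MU_sep;
  m_pair := MU_pair;
  m_union := MU_union;
  m_power := MU_power;
  m_coll := MU_coll;
  m_inf := MU_inf;
  m_choice := MU_choice |}.
End UltrapowerModel.

(** * Completeness of forcing and check names *)

Section Extension.
Context {M : Type} {HM : Model M}.
Implicit Types (a b c p q r : M).
Context (R le : M) (HP : Poset R le).
Notation MemC := (MemC R le).
Notation Feq := (Feq R le).
Notation fr := (fr R le).
Notation chk := (chk R).
Notation prefl := (lep_refl _ _ HP).
Notation ptrans := (lep_trans _ _ HP).
Notation Tv := (Tv R).
Notation MU := (MU R le).
Notation nm := (nm R le).

Definition Gen p (U : (M -> Prop) -> Prop) := U (fun q => q ∈ R /\ lep le q p).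

Definition satU U (HU : Ult R le U) (phi : fm (MU U)) : Prop :=
  @sem (MU U) (@mem _ (MUModel R le HP U HU)) eq phi.

Lemma losU n A U (HU : Ult R le U) (v : env M n) : uniform false n A ->
  satU U HU (A (MU U) (emap (nm U) v)) <-> Tv U (fr (A M v)).
Proof. by move=> HA; exact: (los _ _ HP _ HU _ _ HA). Qed.

Lemma Tv_Gen U (HU : Ult R le U) p (A : M -> Prop) : p ∈ R -> Gen p U ->
  (forall q, q ∈ R -> lep le q p -> A q) -> Tv U A.
Proof. by move=> pR G H; apply: (ult_up _ _ _ HU _ _ _ G) => q [qR qp]; split=> //; exact: H. Qed.

Lemma Tv_Gen_ex U (HU : Ult R le U) p (A : M -> Prop) : Gen p U -> Tv U A ->
  exists q, q ∈ R /\ lep le q p /\ A q.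
Proof.
move=> G H; have [q [qR [K1 K2]]] := Tv_ex _ _ _ HU (fun q => lep le q p /\ A q)
  (ult_up _ _ _ HU _ (fun q => q ∈ R /\ lep le q p /\ A q) (fun x K => conj (proj1 (proj1 K)) (conj (proj2 (proj1 K)) (proj2 (proj2 K))))
    (ult_and _ _ _ HU _ _ G H)).
by exists q.
Qed.

(** If [p] does not force the formula, regularity yields [q] below [p] no extension of which forces
    it, and an ultrafilter concentrating below [q] refutes it. *)
Lemma complete n A (v : env M n) p : uniform false n A -> p ∈ R ->
  fr (A M v) p <-> forall U HU, Gen p U -> satU U HU (A (MU U) (emap (nm U) v)).
Proof.
move=> HA pR; split.
- move=> H U HU G; apply/losU => //; apply: (Tv_Gen U HU p) => // q qR qp; exact: (fr_mono _ _ HP _ p).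
- move=> H; apply: NNPP => nH.
  have [q [qR [qp nq]]] : exists q, q ∈ R /\ lep le q p /\ forall s, s ∈ R -> lep le s q -> ~ fr (A M v) s.
    apply: NNPP => nE; apply: nH; apply: (proj2 (Reg_fr _ _ HP _)) => // q qR qp.
    apply: NNPP => nF; apply: nE; exists q; split=> //; split=> // s sR sq Hs; apply: nF; by exists s.
  have [U [HU G]] := Ult_exists R le q HP qR.
  have Gp : Gen p U.
    by apply: (ult_up _ _ _ HU _ _ _ G) => s [sR sq]; split=> //; exact: (ptrans s q p).
  move: (H U HU Gp) => /losU -/(_ HA) K.
  by have [s [sR [sq Hs]]] := Tv_Gen_ex U HU q _ G K; exact: (nq s sR sq).
Qed.

Lemma complete_all n A (v : env M n) : uniform false n A ->
  (forall p, p ∈ R -> fr (A M v) p) <-> forall U HU, satU U HU (A (MU U) (emap (nm U) v)).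
Proof.
move=> HA; split=> H.
- move=> U HU; apply/losU => //; exact: (Tv_true _ _ HP _ HU).
- by move=> p pR; apply/complete => // U HU _.
Qed.

Definition ck U a : MU U := nm U (chk a).

(** Elements of [ck U a] need not be check names, so a case analysis on them is impossible. Instead,
    the formula is proved at check names in every extension, hence forced, hence true at all
    elements. *)
Lemma ck_all n A (v : env M n) a : uniform false (S n) A ->
  (forall z, z ∈ a -> forall U HU, satU U HU (A (MU U) (emap (nm U) v, ck U z))) ->
  forall U (HU : Ult R le U) (X : MU U), memU R le U X (ck U a) -> satU U HU (A (MU U) (emap (nm U) v, X)).
Proof.
move=> HA H U HU X; have [x e] := nm_surj R le U X; subst X => H0.
have Hx := proj1 (memU_nm R le HP U HU x (chk a)) H0.
apply/(losU (S n) A U HU (v, x) HA); apply: (Tv_mono _ _ _ HU) Hx => p pR Hx.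
apply: (proj1 (fr_Imp _ _ HP (In x (chk a)) (A M (v, x)) p pR) _ p pR (prefl p pR) Hx).
apply: (proj2 (chk_all _ _ HP n A a v p pR HA)) => z za.
by apply: (proj2 (complete_all (S n) A (v, chk z) HA) _ p pR) => U' HU'; exact: H.
Qed.

Section FixU.
Context (U : (M -> Prop) -> Prop) (HU : Ult R le U).
Notation ck := (ck U).
Notation memU_nm := (memU_nm _ _ HP _ HU).
Notation nm_eq := (nm_eq _ _ HP _ HU).
(* As a global instance, [MUModel] would make the search for a model of [M] loop. *)
#[local] Hint Extern 0 (Model (MU U)) => exact (MUModel R le HP U HU) : typeclass_instances.
Notation sat := (satU U HU).

Lemma mem_nm x y : nm U x ∈ nm U y <-> Tv U (fun p => MemC Feq p x y).
Proof. exact: memU_nm. Qed.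
Lemma mem_ck x a : nm U x ∈ ck a <-> Tv U (fun p => MemC Feq p x (chk a)).
Proof. exact: memU_nm. Qed.
Lemma eq_ck x a : nm U x = ck a <-> Tv U (fun p => Feq p x (chk a)).
Proof. exact: nm_eq. Qed.

Lemma ck_mem_intro a b : a ∈ b -> ck a ∈ ck b.
Proof. by move=> ab; apply/mem_ck; apply: (Tv_true _ _ HP _ HU) => p pR; exact: (chk_MemC_intro _ _ HP). Qed.

Lemma ck_mem a b : ck a ∈ ck b <-> a ∈ b.
Proof.
split; last exact: ck_mem_intro.
by move=> /mem_ck /(Tv_ex _ _ _ HU) [p [pR /(chk_mem _ _ HP _ _ _ pR)]].
Qed.

Lemma ck_inj a b : ck a = ck b -> a = b.
Proof. by move=> /eq_ck /(Tv_ex _ _ _ HU) [p [pR /(chk_inj _ _ HP)]]. Qed.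

Lemma ck_pair a b : ck (pair a b) = pair (ck a) (ck b).
Proof.
apply: ext => X; rewrite in_pair; split.
- have [x ->] := nm_surj _ _ _ X => /mem_ck Hx.
  have [H|H] : Tv U (fun p => Feq p x (chk a)) \/ Tv U (fun p => Feq p x (chk b)).
    apply: (Tv_dor _ _ HP _ HU); [exact: Reg_Feq | exact: Reg_Feq |].
    apply: (Tv_mono _ _ _ HU) Hx => p pR /(chk_MemC _ _ HP _ _ _ pR) Hx q qR qp.
    have [s [sR [sq [z [/in_pair zab e]]]]] := Hx q qR qp; exists s; split=> //; split=> //.
    by case: zab => <-; [left | right].
  + by left; apply/eq_ck.
  + by right; apply/eq_ck.
- by move=> [->|->]; apply: ck_mem_intro; apply/in_pair; [left | right].
Qed.

Lemma ck_opair a b : ck (opair a b) = opair (ck a) (ck b).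
Proof. by rewrite /opair !ck_pair. Qed.

Lemma ck_emp : ck emp = emp.
Proof.
apply: ext => X; split=> [|H]; last by case: (in_emp X H).
have [x ->] := nm_surj _ _ _ X => /mem_ck /(Tv_ex _ _ _ HU) [p [pR /(chk_MemC _ _ HP _ _ _ pR) H]].
by have [s [_ [_ [z [ze _]]]]] := H p pR (prefl p pR); case: (in_emp z ze).
Qed.

Lemma ck_succ k : ck (succ k) = succ (ck k).
Proof.
apply: ext => X; rewrite in_succ; split.
- have [x ->] := nm_surj _ _ _ X => /mem_ck Hx.
  have [H|H] : Tv U (fun p => MemC Feq p x (chk k)) \/ Tv U (fun p => Feq p x (chk k)).
    apply: (Tv_dor _ _ HP _ HU); [exact: Reg_MemC | exact: Reg_Feq |].
    apply: (Tv_mono _ _ _ HU) Hx => p pR /(chk_MemC _ _ HP _ _ _ pR) Hx q qR qp.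
    have [s [sR [sq [z [/in_succ zk e]]]]] := Hx q qR qp; exists s; split=> //; split=> //.
    case: zk => [zk|<-]; [left | by right].
    apply: (MemC_eql _ _ HP _ (chk z)) => //; first exact: Feq_sym.
    exact: (chk_MemC_intro _ _ HP).
  + by left; apply/mem_ck.
  + by right; apply/eq_ck.
- move=> [|->]; last by apply: ck_mem_intro; apply/in_succ; right.
  have [x ->] := nm_surj _ _ _ X => /mem_ck Hx; apply/mem_ck; apply: (Tv_mono _ _ _ HU) Hx => p pR.
  move=> /(chk_MemC _ _ HP _ _ _ pR) Hx; apply/(chk_MemC _ _ HP) => // q qR qp.
  have [s [sR [sq [z [zk e]]]]] := Hx q qR qp; exists s; split=> //; split=> //.
  by exists z; split=> //; apply/in_succ; left.
Qed.

(** [ck_all] speaks of formulas; this lemma and the next five read the formulas to which it is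
    applied, for successors and for the clauses of injectivity. *)
Lemma sat_succ_in (Y W : MU U) : sat (All (fun m => Imp (isSucc m Y) (In m W))) <-> succ Y ∈ W.
Proof.
have S : sat (All (fun m => Imp (isSucc m Y) (In m W))) <->
    forall m : MU U, (forall z : MU U, z ∈ m <-> z ∈ Y \/ z = Y) -> m ∈ W by unfold isSucc, satU; sati.
rewrite S; split; first by apply; exact: in_succ.
move=> H m Hm; have -> // : m = succ Y by apply: ext => t; rewrite Hm in_succ.
Qed.

Lemma sat_Inj1 (Y A B : MU U) :
  sat (Ex (fun x => And (In x A) (Ex (fun y => And (In y B) (isOPair Y x y))))) <->
  exists x : MU U, x ∈ A /\ exists y : MU U, y ∈ B /\ Y = opair x y.
Proof. unfold satU; sati. Qed.

Lemma sat_Inj2 (Y B F : MU U) :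
  sat (Ex (fun y => And (In y B) (And (pairIn Y y F) (All (fun z => Imp (pairIn Y z F) (Eq z y)))))) <->
  exists y : MU U, y ∈ B /\ opair Y y ∈ F /\ forall z : MU U, opair Y z ∈ F -> z = y.
Proof. unfold satU; sati. Qed.

Lemma sat_Inj2' (Y Z W : MU U) :
  sat (All (fun w => Imp (isOPair Y Z w) (Eq w W))) <-> forall w : MU U, Y = opair Z w -> w = W.
Proof. unfold satU; sati. Qed.

Lemma sat_Inj3 (Y F : MU U) :
  sat (All (fun w => Imp (In w F) (All (fun x => All (fun y => All (fun z =>
    Imp (isOPair Y x z) (Imp (isOPair w y z) (Eq x y)))))))) <->
  forall w : MU U, w ∈ F -> forall x y z : MU U, Y = opair x z -> w = opair y z -> x = y.
Proof. unfold satU; sati. Qed.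

Lemma sat_Inj3' (Y Y' : MU U) :
  sat (All (fun x => All (fun y => All (fun z => Imp (isOPair Y x z) (Imp (isOPair Y' y z) (Eq x y)))))) <->
  forall x y z : MU U, Y = opair x z -> Y' = opair y z -> x = y.
Proof. unfold satU; sati. Qed.

Lemma ck_isNat_emp : sat (isNat (ck emp)).
Proof. apply/sat_isNat; rewrite ck_emp; exact: Nat_emp. Qed.

Lemma ck_isNat_succ k : sat (isNat (ck k)) -> sat (isNat (ck (succ k))).
Proof. move=> /sat_isNat H; apply/sat_isNat; rewrite ck_succ; exact: Nat_succ. Qed.
End FixU.

(** The induction takes place in [M], so its predicate has to be definable there. A statement about
    [fr] is; one about all ultrafilters would not obviously be. *)
Lemma ck_Nat k : Nat k -> forall p, p ∈ R -> fr (isNat (chk k)) p.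
Proof.
have UN : uniform false 1 (fun X v => isNat (snd v)) by unif.
have D : Def2 (fun k p => fr (isNat (chk k)) p).
  have [D _] := Val_fr _ _ HP _ _ UN.
  have D1 : Def2 (fun k p => fr (isNat k) p).
    by apply: (Def_ren 2 2 (fun v => v) _ _ D); exact: ren_id.
  refine (Def_app2 2 (fun k p => fr (isNat k) p) (fun v => chk (snd (fst v))) snd D1 _ _); def.
move: k; apply: (Nat_ind (fun k => forall p, p ∈ R -> fr (isNat (chk k)) p)).
- by apply: (proj2 (complete_all 1 _ (tt, chk emp) UN)) => U HU; exact: ck_isNat_emp.
- move=> k Hk IH; apply: (proj2 (complete_all 1 _ (tt, chk (succ k)) UN)) => U HU.
  apply: ck_isNat_succ; exact: (proj1 (complete_all 1 _ (tt, chk k) UN) IH U HU).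
Qed.

Section FixU2.
Context (U : (M -> Prop) -> Prop) (HU : Ult R le U).
#[local] Hint Extern 0 (Model (MU U)) => exact (MUModel R le HP U HU) : typeclass_instances.

(** Although the extension may be ill-founded, it gains no integers over [M]: membership in [ck U ω]
    is definable in the extension, hence a legitimate predicate for its own induction on natural
    numbers. *)
Lemma ck_ω : ω = ck U ω.
Proof.
have UN : uniform false 1 (fun X v => isNat (snd v)) by unif.
have US : uniform false 2 (fun X v => All (fun m => Imp (isSucc m (snd v)) (In m (snd (fst v))))) by unif.
apply: ext => X; rewrite in_ω; split.
- move: X; apply: Nat_ind.
  + rewrite -(ck_emp U HU); apply: ck_mem_intro; apply/in_ω; exact: Nat_emp.
  + move=> X _ HX; apply/sat_succ_in.
    apply: (ck_all 1 _ (tt, chk ω) ω US _ U HU X HX) => z /in_ω zω U' HU'.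
    apply/sat_succ_in; rewrite -(ck_succ U' HU'); apply: ck_mem_intro; apply/in_ω; exact: Nat_succ.
- move=> HX; apply/sat_isNat; apply: (ck_all 0 _ tt ω UN _ U HU X HX) => z /in_ω zω U' HU'.
  exact: (proj1 (complete_all 1 _ (tt, chk z) UN) (ck_Nat z zω) U' HU').
Qed.

Lemma ck_Inj f a b : Inj f a b -> Inj (ck U f) (ck U a) (ck U b).
Proof.
move=> H; have [H1 [H2 H3]] := H; split; [|split].
- have U1 : uniform false 3 (fun X v => Ex (fun x => And (In x (snd (fst (fst v)))) (Ex (fun y => And (In y (snd (fst v)))
    (isOPair (snd v) x y))))) by unif.
  move=> X HX; apply/sat_Inj1; apply: (ck_all 2 _ (tt, chk a, chk b) f U1 _ U HU X HX) => z zf U' HU'.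
  apply/sat_Inj1; have [x [xa [y [yb ->]]]] := H1 z zf.
  exists (ck U' x); split; first exact: ck_mem_intro.
  by exists (ck U' y); split; [exact: ck_mem_intro | exact: ck_opair].
- have U1 : uniform false 3 (fun X v => Ex (fun y => And (In y (snd (fst (fst v)))) (And (pairIn (snd v) y (snd (fst v)))
    (All (fun z => Imp (pairIn (snd v) z (snd (fst v))) (Eq z y)))))) by unif.
  have U2 : uniform false 3 (fun X v => All (fun w => Imp (isOPair (snd v) (snd (fst (fst v))) w) (Eq w (snd (fst v))))) by unif.
  move=> X HX; apply/sat_Inj2; apply: (ck_all 2 _ (tt, chk b, chk f) a U1 _ U HU X HX) => z za U' HU'.
  apply/sat_Inj2; have [y [yb [yf Hy]]] := H2 z za.
  exists (ck U' y); split; first exact: ck_mem_intro.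
  split; first by rewrite -(ck_opair U' HU'); exact: ck_mem_intro.
  move=> W HW; move: (eq_refl (opair (HM := MUModel R le HP U' HU') (ck U' z) W)).
  apply: (proj1 (sat_Inj2' U' HU' _ _ _)).
  apply: (ck_all 2 _ (tt, chk z, chk y) f U2 _ U' HU' _ HW) => t tf U'' HU''; apply/sat_Inj2' => w.
  have [x' [xa' [y' [yb' e]]]] := H1 t tf; subst t.
  rewrite (ck_opair U'' HU'') => e; case: (opair_inj (HM := MUModel R le HP U'' HU'') _ _ _ _ e) => e1 <-.
  have ? := ck_inj U'' HU'' _ _ e1; subst x'.
  change (ck U'' y' = ck U'' y); congr (ck U'' _); exact: (Hy y' tf).
- have U1 : uniform false 2 (fun X v => All (fun w => Imp (In w (snd (fst v))) (All (fun x => All (fun y => All (fun z =>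
    Imp (isOPair (snd v) x z) (Imp (isOPair w y z) (Eq x y)))))))) by unif.
  have U2 : uniform false 2 (fun X v => All (fun x => All (fun y => All (fun z =>
    Imp (isOPair (snd (fst v)) x z) (Imp (isOPair (snd v) y z) (Eq x y)))))) by unif.
  move=> x y z xz yz.
  apply: (proj1 (sat_Inj3 U HU _ _) (ck_all 1 _ (tt, chk f) f U1 _ U HU _ xz) _ yz _ _ _ eq_refl eq_refl).
  move=> t tf U' HU'; apply/sat_Inj3 => W HW; apply/sat_Inj3'.
  apply: (ck_all 1 _ (tt, chk t) f U2 _ U' HU' _ HW) => t' tf' U'' HU''; apply/sat_Inj3'.
  move: (H1 t tf) (H1 t' tf') => [a1 [aa1 [b1 [bb1 e1]]]] [a2 [aa2 [b2 [bb2 e2]]]]; subst t t'.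
  move=> x' y' z' e1 e2.
  have {}e1 := eq_trans (eq_sym (ck_opair U'' HU'' a1 b1)) e1.
  have {}e2 := eq_trans (eq_sym (ck_opair U'' HU'' a2 b2)) e2.
  case: (opair_inj (HM := MUModel R le HP U'' HU'') _ _ _ _ e1) => <- e3.
  case: (opair_inj (HM := MUModel R le HP U'' HU'') _ _ _ _ e2) => <- e4.
  have ? : b1 = b2 by apply: (ck_inj U'' HU''); congruence.
  subst b2.
  congr (ck U'' _); exact: (H3 _ _ _ tf tf').
Qed.
End FixU2.

Lemma fr_isOmega_chk p : p ∈ R -> fr (isOmega (chk ω)) p.
Proof.
have UN : uniform false 1 (fun X v => isOmega (snd v)) by unif.
apply: (proj2 (complete_all 1 _ (tt, chk ω) UN)) => U HU.
apply/(sat_isOmega (HM := MUModel R le HP U HU)); exact: (eq_sym (ck_ω U HU)).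
Qed.

Lemma fr_isInjection_chk f a b p : Inj f a b -> p ∈ R -> fr (isInjection (chk f) (chk a) (chk b)) p.
Proof.
move=> Hf; have UN : uniform false 3 (fun X v => isInjection (snd (fst (fst v))) (snd (fst v)) (snd v)) by unif.
apply: (proj2 (complete_all 3 _ (tt, chk f, chk a, chk b) UN)) => U HU.
apply/(sat_isInjection (HM := MUModel R le HP U HU)); exact: (ck_Inj U HU).
Qed.
End Extension.

(** * Strong properness implies the approximation property *)

Section Approximation.
Context {M : Type} {HM : Model M}.
Implicit Types (a b c h l p q r s t x y z w : M).
Context (R le : M) (HP : Poset R le).
Notation MemC := (MemC R le).
Notation SubC := (SubC R le).
Notation Feq := (Feq R le).
Notation fr := (fr R le).
Notation chk := (chk R).
Notation prefl := (lep_refl _ _ HP).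
Notation ptrans := (lep_trans _ _ HP).

(** By genericity of [q], the conditions of [B] in [N] that are incompatible with
    [s] are not dense in [N ∩ R]; a witness [v] is a trace of [s] on [N]. *)
Lemma SGen_trace (B : M -> Prop) q N s : Def1 B -> SGen q N R le -> s ∈ R -> lep le s q ->
  (forall v, v ∈ N -> v ∈ R -> exists v', v' ∈ N /\ v' ∈ R /\ lep le v' v /\ B v') ->
  exists v, v ∈ N /\ v ∈ R /\ B v /\
    forall v', v' ∈ N -> v' ∈ R -> lep le v' v -> B v' -> Cmp R le v' s.
Proof.
move=> DB [qR Hq] sR sq HB; apply: NNPP => nE.
pose (d := sep N (fun v => v ∈ R /\ B v /\ ~ Cmp R le v s)).
have ind v : v ∈ d <-> v ∈ N /\ v ∈ R /\ B v /\ ~ Cmp R le v s by exact: in_sep.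
have [|v [/ind [_ [_ [_ nC]]] C]] := Hq d _ s sR sq; last by [].
split; first by move=> v /ind [? [? _]].
move=> v vR vN; have [v1 [v1N [v1R [v1v Bv1]]]] := HB v vN vR.
apply: NNPP => nF; apply: nE; exists v1; do 3 (split=> //).
move=> v2 v2N v2R v21 Bv2; apply: NNPP => nC; apply: nF; exists v2; split; first by apply/ind.
exact: (ptrans v2 v1 v).
Qed.

(** If [x] is not decided below [q], each [s] below [q] has a point [Z s] with extensions [T0 s] and
    [T1 s] that disagree on whether it is in [x]. For [N] closed under both, an [s] below a strongly
    generic condition decides [x] on the countable set of these points. With a trace [v] of [s] on
    [N], both [T0 v] and [T1 v] are compatible with [s], yet they disagree on [Z v]. *)
Theorem nonDiag_approx l h : IsLam l R -> (forall x, x ∈ h <-> InH l x) ->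
  (forall p, p ∈ R -> forall c, Club c h -> exists n, n ∈ c /\ Pw1 h n /\ p ∈ n /\
    exists q, q ∈ R /\ lep le q p /\ SGen q n R le) ->
  forall p, p ∈ R -> fr approximatedInGround p.
Proof.
move=> Hl Hh HS p0 p0R.
change (forall x, fr (Imp (All (fun z => Imp (In z x) (Ground z))) (Imp (All (fun n => Imp (countableInGround n)
  (Ex (fun y => And (Ground y) (All (fun z => Iff (In z y) (And (In z n) (In z x)))))))) (Ground x))) p0) => x.
apply/(fr_Imp _ _ HP) => // p1 p1R p10 A1.
apply/(fr_Imp _ _ HP) => // p2 p2R p21 A2 q qR qp2; apply: NNPP => nG.
have {}A1 : forall z, fr (Imp (In z x) (Ground z)) p1 := A1.
have {}A2 : forall n, fr (Imp (countableInGround n) (Ex (fun y => And (Ground y)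
  (All (fun z => Iff (In z y) (And (In z n) (In z x))))))) p2 := A2.
have qp1 := ptrans q p2 p1 qR p2R p1R qp2 p21.
have Rh r : r ∈ R -> r ∈ h by move=> rR; apply/Hh; case: Hl => [[_ [_ H]] _]; exact: H.
(* no condition below [q] decides [x] *)
have split_ s : s ∈ R -> lep le s q -> exists z t0 t1, t0 ∈ R /\ t1 ∈ R /\ lep le t0 s /\ lep le t1 s /\
    MemC Feq t0 (chk z) x /\ forall t, t ∈ R -> lep le t t1 -> ~ MemC Feq t (chk z) x.
  move=> sR sq; apply: NNPP => nE; apply: nG.
  (* Were no point split below [s], what one extension forces into [x] would already be forced by
     [s], and [s] would force [x] to be the check name of [X]. *)
  have dec z t0 : t0 ∈ R -> lep le t0 s -> MemC Feq t0 (chk z) x -> MemC Feq s (chk z) x.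
    move=> t0R t0s Ht0; apply: (proj2 (Reg_MemC _ _ HP _ _ _) s sR) => t1 t1R t1s.
    apply: NNPP => nT; apply: nE; exists z, t0, t1; do 4 (split=> //); split=> // t tR tt1 Ht.
    by apply: nT; exists t.
  (* [X] is a set because a member [z] is determined by a pair of a condition and an element [y] of
     the domain of [x] that is forced equal to [chk z]. *)
  have [|b Hb] := repl_bound (fun u z => exists t y, u = opair t y /\ Feq t y (chk z)) (prod R (Un (Un x))) _.
    move=> u z z' [t [y [-> e]]] [t' [y' [e2 e']]]; case: (opair_inj _ _ _ _ e2) => ? ?; subst t' y'.
    exact: (chk_inj _ _ HP t _ _ (Feq_trans _ _ HP _ _ _ _ (Feq_sym _ _ _ _ _ e) e')).
  pose (X := cset (fun z => MemC Feq s (chk z) x)).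
  have inX z : z ∈ X <-> MemC Feq s (chk z) x.
    apply: (cset_sub _ b) => w Hw; have [t [tR [_ [y [r [rR [yr [_ e]]]]]]]] := Hw s sR (prefl s sR).
    apply: (Hb (opair t y)); first by apply/opair_in_prod; split=> //; exact: opair_dom yr.
    by exists t, y; split=> //; exact: Feq_sym.
  exists s; split=> //; split=> //; exists X; apply/FeqE; split=> //; split.
  - move=> w r rR wr t tR ts tr; apply/(chk_MemC _ _ HP) => // t' t'R t't.
    have t's := ptrans t' t s t'R tR sR t't ts.
    have t'p1 := ptrans t' q p1 t'R qR p1R (ptrans t' s q t'R sR qR t's sq) qp1.
    have wx : MemC Feq t' w x.
      by apply: (MemC_intro _ _ HP _ _ r) => //; exact: (ptrans t' t r).
    have [u [uR [ut [Z e]]]] := proj1 (fr_Imp _ _ HP _ _ _ p1R) (A1 w) t' t'R t'p1 wx t' t'R (prefl t' t'R).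
    exists u; split=> //; split=> //; exists Z; split=> //; apply/inX; apply: (dec Z u) => //.
      exact: (ptrans u t' s).
    by apply: (MemC_eql _ _ HP _ w) => //; apply: (proj1 (Reg_MemC _ _ HP _ _ _) t').
  - move=> w r rR /in_chk [z [r' [/inX Hz [_ e]]]] t tR ts _; case: (opair_inj _ _ _ _ e) => -> _.
    exact: (proj1 (Reg_MemC _ _ HP _ _ _) s).
pose (a := sep R (fun s => lep le s q)).
have ina s : s ∈ a <-> s ∈ R /\ lep le s q by exact: in_sep.
have [|Z [DZ HZ]] := definable_choice (fun s z => exists t0 t1, t0 ∈ R /\ t1 ∈ R /\ lep le t0 s /\ lep le t1 s /\
    MemC Feq t0 (chk z) x /\ forall t, t ∈ R -> lep le t t1 -> ~ MemC Feq t (chk z) x) a _.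
  by move=> s /ina [sR sq]; exact: split_.
have [|T0 [DT0 HT0]] := definable_choice (fun s t0 => t0 ∈ R /\ lep le t0 s /\ MemC Feq t0 (chk (Z s)) x) a _.
  by move=> s /HZ [t0 [t1 H]]; exists t0; tauto.
have [|T1 [DT1 HT1]] := definable_choice (fun s t1 => t1 ∈ R /\ lep le t1 s /\
    forall t, t ∈ R -> lep le t t1 -> ~ MemC Feq t (chk (Z s)) x) a _.
  by move=> s /HZ [t0 [t1 H]]; exists t1; tauto.
(* Closing [N] under [g] makes the conditions that are below [q] or incompatible with [q] dense in
   [N ∩ R]; the trace can then be taken below [q], where [Z] is meaningful. *)
pose (b := sep R (fun s => Cmp R le s q)).
have inb s : s ∈ b <-> s ∈ R /\ Cmp R le s q by exact: in_sep.
have [|g [Dg Hg]] := definable_choice (fun s t => t ∈ R /\ lep le t s /\ lep le t q) b _.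
  by move=> s /inb [sR [t Ht]]; exists t.
pose (F := fun s => cset (fun t => (s ∈ a /\ (t = T0 s \/ t = T1 s)) \/ (s ∈ b /\ t = g s))).
have DF : Fn1 F by unfold F; def.
have inF s t : t ∈ F s <-> (s ∈ a /\ (t = T0 s \/ t = T1 s)) \/ (s ∈ b /\ t = g s).
  apply: (cset_sub _ (cup (pair (T0 s) (T1 s)) (pair (g s) (g s)))) => u.
  by rewrite in_cup !in_pair; tauto.
have FR s : Sub (F s) R.
  move=> t /inF [[/ina sa [->|->]]|[sb ->]].
  - by case: (HT0 s); first apply/ina.
  - by case: (HT1 s); first apply/ina.
  - by case: (Hg s sb).
have CF s : Ctbl (F s).
  apply: (Ctbl_sub _ (cup (pair (T0 s) (T1 s)) (pair (g s) (g s)))).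
    by move=> t /inF; rewrite in_cup !in_pair; tauto.
  by apply: Ctbl_cup; exact: Ctbl_pair.
pose (C := sep (pow h) (fun N => Ctbl N /\ forall s, s ∈ N -> Sub (F s) N)).
have inC N : N ∈ C <-> Sub N h /\ Ctbl N /\ forall s, s ∈ N -> Sub (F s) N.
  by rewrite /C in_sep in_pow.
have [|N [/inC [Nh [CN clN]] [_ [qN [q2 [q2R [q2q SG]]]]]]] := HS q qR C.
  split; [|split].
  - by move=> n /inC [? [? _]].
  - move=> m [mh Cm]; have [|n [Cn [mn [nh Hn]]]] := Ctbl_closure F h m DF Cm mh.
      by move=> y _; split=> // t /FR /Rh.
    by exists n; split=> //; apply/inC.
  - move=> d dC _ Cd _; apply/inC; split; [|split].
    + by move=> y /in_Un [n [yn /dC /inC [nh _]]]; exact: nh.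
    + by apply: Ctbl_Un => // n /dC /inC [_ []].
    + move=> s /in_Un [n [sn nd]] t ts; have /inC [_ [_ H]] := dC n nd.
      by apply/in_Un; exists n; split=> //; exact: (H s sn).
pose (Zs := repl (sep N (fun s => s ∈ a)) Z).
have inZs s : s ∈ N -> s ∈ a -> Z s ∈ Zs.
  by move=> sN sa; apply/in_repl; exists s; split=> //; apply/in_sep.
have [f Hf] : Ctbl Zs.
  by apply: Ctbl_image; apply: Ctbl_sub CN => s /in_sep [].
have q2p2 := ptrans q2 q p2 q2R qR p2R q2q qp2.
have cg : fr (countableInGround (chk Zs)) q2.
  have gr c r : r ∈ R -> fr (Ground (chk c)) r.
    move=> rR r' r'R _; exists r'; split=> //; split; first exact: prefl.
    by exists c; exact: (Feq_refl _ _ HP).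
  split; first exact: gr.
  apply: (Ex_intro _ _ HP _ (chk ω)) => //; split; first exact: (fr_isOmega_chk _ _ HP).
  apply: (Ex_intro _ _ HP _ (chk f)) => //; split; first exact: gr.
  exact: (fr_isInjection_chk _ _ HP).
have {}A2 := proj1 (fr_Imp _ _ HP _ _ _ p2R) (A2 (chk Zs)) q2 q2R q2p2 cg.
have [s1 [s1R [s1q2 [y [Gy Hy]]]]] := proj1 (fr_Ex _ _ _ _ q2R) A2 q2 q2R (prefl q2 q2R).
have {}Hy : forall z, fr (Iff (In z y) (And (In z (chk Zs)) (In z x))) s1 := Hy.
have [s [sR [ss1 [A e]]]] := Gy s1 s1R (prefl s1 s1R).
have sq2 := ptrans s s1 q2 sR s1R q2R ss1 s1q2.
(* The name [y] of the trace of [x] on [Zs] has been decided to be [A], so from [s] on membership of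
   these points in [x] is settled. *)
have yA t z : t ∈ R -> lep le t s -> z ∈ Zs -> (MemC Feq t (chk z) x <-> z ∈ A).
  move=> tR ts zZ; have ts1 := ptrans t s s1 tR sR s1R ts ss1.
  have et := Feq_mono _ _ HP _ _ _ _ tR ts e.
  have [K1 K2] := proj1 (fr_Iff _ _ HP _ _ _ s1R) (Hy (chk z)) t tR ts1.
  split=> H.
  - apply: (chk_mem _ _ HP t) => //; apply: (MemC_eqr _ _ HP _ _ y) => //; apply: K2; split=> //.
    exact: (chk_MemC_intro _ _ HP).
  - have [] := K1 _ => //; apply: (MemC_eqr _ _ HP _ _ (chk A)) => //; first exact: Feq_sym.
    exact: (chk_MemC_intro _ _ HP).
have [|v [vN [vR [Bv Hv]]]] := SGen_trace (fun v => lep le v q \/ ~ Cmp R le v q) q2 N s _ SG sR sq2.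
  move=> v vN vR; case: (classic (Cmp R le v q)) => vq.
    have vb : v ∈ b by apply/inb.
    have [gR [gv gq]] := Hg v vb; exists (g v); split; last by split=> //; split=> //; left.
    by apply: (clN v vN); apply/inF; right.
  by exists v; split=> //; split=> //; split; [exact: prefl | right].
have vq : lep le v q.
  case: Bv => // nC; have [|u [uR [uv us]]] := Hv v vN vR (prefl v vR) _; first by right.
  case: nC.
  exists u; split=> //; split=> //; apply: (ptrans u q2 q) => //; exact: (ptrans u s q2).
have va : v ∈ a by apply/ina.
have [T0R [T0v HT0v]] := HT0 v va; have [T1R [T1v HT1v]] := HT1 v va.
have T0N : T0 v ∈ N by apply: (clN v vN); apply/inF; left; split=> //; left.
have T1N : T1 v ∈ N by apply: (clN v vN); apply/inF; left; split=> //; right.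
have zZ := inZs v vN va.
(* Both answers about [Z v] are in [N] and below [v], so each has a common extension with [s]; [u0]
   puts [Z v] into [A], which contradicts [u1]. *)
have [|u0 [u0R [u0t u0s]]] := Hv (T0 v) T0N T0R T0v; first by left; exact: (ptrans _ v).
have [|u1 [u1R [u1t u1s]]] := Hv (T1 v) T1N T1R T1v; first by left; exact: (ptrans _ v).
apply: (HT1v u1 u1R u1t); apply/(yA u1) => //; apply/(yA u0) => //.
exact: (proj1 (Reg_MemC _ _ HP _ _ _) (T0 v)).
Qed.
End Approximation.

Theorem sat_nonDiag_approx {M : Type} {HM : Model M} (R le : M) :
  sat (nonDiagStronglyProper R le) -> sat (ω1Approximation R le).
Proof.
move=> /sat_nonDiag [HP [l [h [H1 [H2 H3]]]]].
unfold ω1Approximation, forced.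
apply/SI_All => [p|]; first (eapply SI_Imp; [apply: SI_In | reflexivity]).
move=> p pR; apply/sat_force => //; exact: (nonDiag_approx R le HP l h).
Qed.

(** * The universe *)

Lemma fchoice {A B : Type} (T : A -> B -> Prop) : (forall x, exists y, T x y) ->
  exists f, forall x, T x (f x).
Proof.
move=> H; exists (fun x => proj1_sig (constructive_indefinite_description _ (H x))) => x.
exact: proj2_sig.
Qed.

Lemma seteq_refl x : seteq x x.
Proof. by elim: x => A f IH /=; split=> a; exists a. Qed.

Lemma seteq_sym x y : seteq x y -> seteq y x.
Proof.
elim: x y => A f IH [B g] /= [H1 H2]; split=> b.
- by have [a Ha] := H2 b; exists a; exact: IH.
- by have [a Ha] := H1 b; exists a; exact: IH.
Qed.

Lemma seteq_trans x y z : seteq x y -> seteq y z -> seteq x z.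
Proof.
elim: x y z => A f IH [B g] [C h] /= [H1 H2] [H3 H4]; split=> a.
- by have [b Hb] := H1 a; have [c Hc] := H3 b; exists c; exact: IH Hb Hc.
- by have [b Hb] := H4 a; have [c Hc] := H2 b; exists c; exact: IH Hc Hb.
Qed.

Lemma seteq_ext x y : (forall z, setin z x <-> setin z y) -> seteq x y.
Proof.
case: x y => A f [B g] /= H; split=> a.
- by apply/H; exists a; exact: seteq_refl.
- have [b Hb] : exists b, seteq (g a) (f b) by apply/H; exists a; exact: seteq_refl.
  by exists b; exact: seteq_sym.
Qed.

Definition V : Type := quot seteq.
Definition cl : ZF -> V := cls seteq.

Lemma cl_eq x y : cl x = cl y <-> seteq x y.
Proof. exact: cls_eq seteq_refl seteq_sym seteq_trans. Qed.

Definition memV (X Y : V) := exists x y, X = cl x /\ Y = cl y /\ setin x y.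

Lemma memV_mk X B (g : B -> ZF) : memV X (cl (mkset B g)) <-> exists b, X = cl (g b).
Proof.
split=> [[x [[C h] [-> [/cl_eq /= [H1 H2] [c Hc]]]]]|[b ->]].
- have [b Hb] := H2 c; exists b; apply/cl_eq; apply: seteq_trans Hc _; exact: seteq_sym.
- by exists (g b), (mkset B g); split=> //; split=> //; exists b; exact: seteq_refl.
Qed.

Lemma memV_cl x y : memV (cl x) (cl y) <-> setin x y.
Proof.
case: y => B g; rewrite memV_mk /=; split=> -[b Hb]; exists b; by apply/cl_eq.
Qed.

Lemma V_case (X : V) : exists B (g : B -> ZF), X = cl (mkset B g).
Proof. by have [[B g] ->] := cls_surj _ X; exists B, g. Qed.

Lemma V_ext (X Y : V) : (forall Z, memV Z X <-> memV Z Y) -> X = Y.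
Proof.
have [x ->] := cls_surj _ X; have [y ->] := cls_surj _ Y => H; apply/cl_eq.
by apply: seteq_ext => z; rewrite -!memV_cl; exact: H.
Qed.

Lemma V_ind (A : V -> Prop) : (forall X, (forall Y, memV Y X -> A Y) -> A X) -> forall X, A X.
Proof.
move=> H X; have [x ->] := cls_surj _ X; elim: x => B g IH.
by apply: H => Y /memV_mk [b ->].
Qed.

Lemma V_sep (A : V -> Prop) (X : V) : exists Y, forall Z, memV Z Y <-> memV Z X /\ A Z.
Proof.
have [B [g ->]] := V_case X; exists (cl (mkset {b | A (cl (g b))} (fun b => g (proj1_sig b)))) => Z.
rewrite !memV_mk; split; first by move=> [[b Hb] ->]; split=> //; exists b.
by move=> [[b ->] Ab]; exists (exist _ b Ab).
Qed.

Lemma V_pair (X Y : V) : exists Z, forall W, memV W Z <-> W = X \/ W = Y.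
Proof.
have [x ->] := cls_surj _ X; have [y ->] := cls_surj _ Y.
exists (cl (mkset bool (fun b => if b then x else y))) => W; rewrite memV_mk.
by split=> [[[] ->]|[->|->]]; [left | right | exists true | exists false].
Qed.

Lemma V_union (X : V) : exists Y, forall Z, memV Z Y <-> exists W, memV Z W /\ memV W X.
Proof.
have [B [g ->]] := V_case X.
pose idx x := match x with mkset B _ => B end.
pose elt x : idx x -> ZF := match x with mkset B g => g end.
have K x Z : memV Z (cl x) <-> exists i, Z = cl (elt x i) by case: x => C h; exact: memV_mk.
exists (cl (mkset {b : B & idx (g b)} (fun s => elt (g (projT1 s)) (projT2 s)))) => Z.
rewrite memV_mk; split.
- move=> [[b i] ->]; exists (cl (g b)); rewrite memV_mk; split; last by exists b.
  by apply/K; exists i.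
- move=> [W [ZW /memV_mk [b e]]]; subst W; move/K: ZW => [i ->].
  by exists (existT _ b i).
Qed.

Lemma V_power (X : V) : exists Y, forall Z, (forall W, memV W Z -> memV W X) -> memV Z Y.
Proof.
have [B [g ->]] := V_case X.
exists (cl (mkset (B -> Prop) (fun T => mkset {b | T b} (fun s => g (proj1_sig s))))) => Z H.
apply/memV_mk; exists (fun b => memV (cl (g b)) Z); apply: V_ext => W; rewrite memV_mk; split.
- by move=> WZ; have /memV_mk [b e] := H W WZ; subst W; exists (exist _ b WZ).
- by move=> [[b Hb] ->].
Qed.

Lemma V_coll (A : V -> V -> Prop) (X : V) : (forall Z, memV Z X -> exists Y, A Z Y) ->
  exists B, forall Z, memV Z X -> exists Y, memV Y B /\ A Z Y.
Proof.
have [B [g ->]] := V_case X => H.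
have [|f Hf] := fchoice (fun b y => A (cl (g b)) (cl y)).
  move=> b; have [|Y HY] := H (cl (g b)); first by apply/memV_mk; exists b.
  by have [y e] := cls_surj _ Y; exists y; rewrite /cl -e.
exists (cl (mkset B f)) => Z /memV_mk [b ->]; exists (cl (f b)); split=> //.
by apply/memV_mk; exists b.
Qed.

Definition succZ x := match x with mkset B g => mkset (option B) (fun o => if o is Some b then g b else x) end.
Lemma memV_succZ x Z : memV Z (cl (succZ x)) <-> memV Z (cl x) \/ Z = cl x.
Proof.
case: x => B g /=; rewrite !memV_mk; split.
- by move=> [[b|] ->]; [left; exists b | right].
- by move=> [[b ->]|->]; [exists (Some b) | exists None].
Qed.

Fixpoint numZ n := match n with 0 => mkset Empty_set (fun e => match e with end) | S n => succZ (numZ n) end.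

Lemma V_inf : exists W, (exists X, memV X W /\ forall Z, ~ memV Z X) /\
  forall K, memV K W -> exists N, memV N W /\ forall Z, memV Z N <-> memV Z K \/ Z = K.
Proof.
exists (cl (mkset nat numZ)); split.
- exists (cl (numZ 0)); split; first by apply/memV_mk; exists 0.
  by move=> Z /memV_mk [[]].
- move=> K /memV_mk [n ->]; exists (cl (numZ (S n))); split; first by apply/memV_mk; exists (S n).
  exact: memV_succZ.
Qed.

Lemma memV_irrefl X : ~ memV X X.
Proof.
by move: X; apply: (V_ind (fun X => ~ memV X X)) => X IH XX; exact: (IH X XX XX).
Qed.

(** A well-order of the index type gives each index [b] its rank [o b], an ordinal. An element with
    several indices receives several ordinals, which [m_choice] permits; [True] stands for its
    definability clause. *)
Lemma V_choice (X : V) : exists A : V -> V -> Prop, True /\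
    (forall x, memV x X -> exists o, A x o /\
       (forall y, memV y o -> forall z, memV z y -> memV z o) /\
       (forall w, memV w o -> forall y, memV y w -> forall z, memV z y -> memV z w)) /\
    (forall x x' o, A x o -> A x' o -> x = x').
Proof.
have [B [g ->]] := V_case X.
have [lt [least [asym wf]]] := well_ordering B.
have tri x y : lt x y \/ x = y \/ lt y x.
  have [|m [[->|->] H]] := least (fun z => z = x \/ z = y); first by exists x; left.
  - by have [->|?] := H y (or_intror eq_refl); tauto.
  - by have [->|?] := H x (or_introl eq_refl); tauto.
have tr x y z : lt x y -> lt y z -> lt x z.
  move=> xy yz; case: (tri x z) => [//|[e|zx]]; first by subst z; case: (asym _ _ xy).
  have [|m [Hm H]] := least (fun w => w = x \/ w = y \/ w = z); first by exists x; left.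
  case: Hm => [|[|]] ?; subst m.
  - by have [e|xz] := H z (or_intror (or_intror eq_refl)); [subst z; case: (asym _ _ xy) | ].
  - by have [e|yx] := H x (or_introl eq_refl); [subst y; case: (asym _ _ xy) | case: (asym _ _ xy)].
  - by have [e|zy] := H y (or_intror (or_introl eq_refl)); [subst z; case: (asym _ _ yz) | case: (asym _ _ yz)].
pose o := Fix wf (fun _ => ZF) (fun b f => mkset {c | lt c b} (fun s => f (proj1_sig s) (proj2_sig s))).
have oE b Z : memV Z (cl (o b)) <-> exists c, lt c b /\ Z = cl (o c).
  rewrite {1}/o Fix_eq; last by move=> x f f' e; congr (mkset _ _); extensionality s; exact: e.
  rewrite memV_mk; split; first by move=> [[c Hc] ->]; exists c.
  by move=> [c [Hc ->]]; exists (exist _ c Hc).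
have oinj b c : cl (o b) = cl (o c) -> b = c.
  move=> e; case: (tri b c) => [H|[//|H]]; case: (memV_irrefl (cl (o b))).
  - by rewrite {2}e; apply/oE; exists b.
  - by rewrite {1}e; apply/oE; exists c.
have otr b y : memV y (cl (o b)) -> forall z, memV z y -> memV z (cl (o b)).
  move=> /oE [c [cb ->]] z /oE [d [dc ->]]; apply/oE; exists d; split=> //; exact: tr dc cb.
exists (fun x y => exists b, x = cl (g b) /\ y = cl (o b)); split=> //; split.
- move=> x /memV_mk [b ->]; exists (cl (o b)); split; first by exists b.
  split; first exact: otr.
  by move=> w /oE [c [_ ->]]; exact: otr.
- by move=> x x' y [b [-> ->]] [c [-> /oinj ->]].
Qed.

(** Separation and collection hold in [V] for arbitrary predicates of the metatheory, so all
    relations count as definable and choices made there may be used as functions of the model. *)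
#[global] Instance VModel : Model V := {|
  mem := memV;
  Def := fun _ _ => True;
  Def_mem := I;
  Def_not := fun _ _ _ => I;
  Def_and := fun _ _ _ _ _ => I;
  Def_all0 := fun _ _ _ => I;
  Def_ren := fun _ _ _ _ _ _ => I;
  m_ext := V_ext;
  m_ind := fun A _ => V_ind A;
  m_sep := fun A _ => V_sep A;
  m_pair := V_pair;
  m_union := V_union;
  m_power := V_power;
  m_coll := fun A _ => V_coll A;
  m_inf := V_inf;
  m_choice := V_choice |}.

#[global] Hint Extern 0 (@Def1 V _ _) => exact I : typeclass_instances.
#[global] Hint Extern 0 (@Def2 V _ _) => exact I : typeclass_instances.
#[global] Hint Extern 0 (@Def3 V _ _) => exact I : typeclass_instances.
#[global] Hint Extern 0 (@Fn1 V _ _) => exact I : typeclass_instances.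
#[global] Hint Extern 0 (@Fn2 V _ _) => exact I : typeclass_instances.

Lemma holds_sat n A (r : env ZF n) : uniform false n A ->
  holds (A ZF r) <-> sat (A V (emap cl r)).
Proof.
move=> HA; rewrite holds_sem; apply: (sem_map cl setin seteq mem eq _ _ _ _ _ _ HA).
- exact: cls_surj.
- by move=> x y; have H := memV_cl x y; tauto.
- by move=> x y; have H := cl_eq x y; tauto.
Qed.

Fixpoint num (n : nat) : V := match n with 0 => emp | S n => succ (num n) end.

Lemma in_ω_num x : x ∈ ω <-> exists n, x = num n.
Proof.
rewrite in_ω; split.
- move: x; apply: Nat_ind; first by exists 0.
  by move=> k _ [n ->]; exists (S n).
- by move=> [n ->]; elim: n => [|n IH]; [exact: Nat_emp | exact: Nat_succ].
Qed.

Lemma num_inj m n : num m = num n -> m = n.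
Proof.
elim: m n => [|m IH] [|n] //=.
- by move=> e; case: (in_emp (num n)); rewrite e; apply/in_succ; right.
- by move=> e; case: (in_emp (num m)); rewrite -e; apply/in_succ; right.
- by move=> e; rewrite (IH n (succ_inj _ _ e)).
Qed.

Lemma nat_set (f : nat -> V) : exists a, forall x, x ∈ a <-> exists n, x = f n.
Proof.
have [g Hg] : exists g : V -> V, forall n, g (num n) = f n.
  have [|g Hg] := fchoice (fun x y => forall n, x = num n -> y = f n); last by exists g => n; exact: Hg.
  move=> x; case: (classic (exists n, x = num n)) => [[n ->]|H]; last by exists emp => n e; case: H; exists n.
  by exists (f n) => m /num_inj ->.
exists (repl ω g) => x; rewrite in_repl; split.
- by move=> [y [/in_ω_num [n ->] ->]]; exists n.
- by move=> [n ->]; exists (num n); split=> //; apply/in_ω_num; exists n.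
Qed.

(** The natural numbers of [V] are the numerals of the metatheory, so countability there amounts to
    an external enumeration. In an extension countability has to go through Boolean values. *)
Lemma Ctbl_V a : Ctbl a <-> exists e : nat -> V, forall x, x ∈ a -> exists k, e k = x.
Proof.
split.
- move=> H; have [F [_ [F1 F2]]] := Le_elim _ _ H.
  have [|e He] := fchoice (fun n y => forall x, x ∈ a -> F x = num n -> y = x).
    move=> n; case: (classic (exists x, x ∈ a /\ F x = num n)) => [[x [xa e]]|H'].
      by exists x => y ya e'; apply: F2 => //; rewrite e'.
    by exists emp => x xa e; case: H'; exists x.
  exists e => x xa; have /in_ω_num [n en] := F1 x xa.
  by exists n; exact: He.
- move=> [e He]; apply: (Ctbl_cover (fun k x => exists n, k = num n /\ e n = x)).
  + move=> x xa; have [n en] := He x xa; exists (num n); split; first by apply/in_ω_num; exists n.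
    by exists n.
  + by move=> k x x' _ _ [n [-> <-]] [n' [/num_inj -> <-]].
Qed.

(** * Hulls and reductions *)

Section Hull.
Context (op : nat -> V -> V -> V).
Implicit Types (x y N : V).

Inductive Hull N : V -> Prop :=
| Hull_in x : x ∈ N -> Hull N x
| Hull_op i x y : Hull N x -> Hull N y -> Hull N (op i x y).

Lemma Hull_mono N N' x : (forall y, y ∈ N -> Hull N' y) -> Hull N x -> Hull N' x.
Proof. by move=> H; elim=> {x} [|i x y _ IHx _ IHy]; [exact: H | exact: Hull_op]. Qed.

Lemma Hull_enum N : (exists x, x ∈ N) -> Ctbl N -> exists e : nat -> V, forall x, Hull N x <-> exists k, e k = x.
Proof.
move=> [x0 x0N] /Ctbl_V [e0 H0].
(* [x0] is the default for indices at which [e0] leaves [N]. *)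
pose (e1 := fun k => match excluded_middle_informative (e0 k ∈ N) with left _ => e0 k | right _ => x0 end).
(* Stage [n] lists the terms of depth at most [n]: the code [(0, j)] repeats item [j] of the
   previous stage, and [(S i, (a, b))] applies [op i] to its items [a] and [b]. *)
pose (g := fix g n k := match n with
  | 0 => e1 k
  | S n => match fst (of_nat k) with
           | 0 => g n (snd (of_nat k))
           | S i => op i (g n (fst (of_nat (snd (of_nat k))))) (g n (snd (of_nat (snd (of_nat k)))))
           end
  end).
have g0 n j : g (S n) (to_nat (0, j)) = g n j by cbn [g]; rewrite cancel_of_to.
have gS n i a b : g (S n) (to_nat (S i, to_nat (a, b))) = op i (g n a) (g n b).
  by cbn [g]; rewrite !cancel_of_to.
have up n m k : exists k', g (m + n) k' = g n k.
  elim: m => [|m [k' IH]]; first by exists k.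
  by exists (to_nat (0, k')); rewrite -IH; exact: g0.
exists (fun m => g (fst (of_nat m)) (snd (of_nat m))) => x; split.
- have K : Hull N x -> exists n k, g n k = x.
    elim=> {x} [x xN|i x y _ [n [a <-]] _ [m [b <-]]].
      have [k ek] := H0 x xN; exists 0, k; cbn; rewrite /e1 ek.
      by case: excluded_middle_informative.
    have [a' <-] := up n m a; have [b' <-] := up m n b; rewrite (Nat.add_comm m n).
    exists (S (n + m)), (to_nat (S i, to_nat (a', b'))); exact: gS.
  by move=> /K [n [k <-]]; exists (to_nat (n, k)); cbv beta; rewrite cancel_of_to.
- have K n : forall k, Hull N (g n k).
    elim: n => [|n IH] k; cbn [g].
      by apply: Hull_in; rewrite /e1; case: excluded_middle_informative.
    by case: (fst (of_nat k)) => [|i]; [exact: IH | apply: Hull_op; exact: IH].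
  by move=> [k <-]; exact: K.
Qed.

(** The operations also produce names and other sets outside [h], so only the part of the hull
    inside [h] is absorbed. Unions of chains cause no trouble: an element of the hull depends on
    finitely many generators, all of which lie in one member of the chain. *)
Lemma Hull_club h : exists C, Club C h /\ forall N, N ∈ C -> forall x, x ∈ h -> Hull N x -> x ∈ N.
Proof.
pose (C := sep (pow h) (fun N => Ctbl N /\ forall x, x ∈ h -> Hull N x -> x ∈ N)).
have inC N : N ∈ C <-> Sub N h /\ Ctbl N /\ forall x, x ∈ h -> Hull N x -> x ∈ N.
  by rewrite /C in_sep in_pow.
exists C; split; last by move=> N /inC [_ []].
split; [|split].
- by move=> n /inC [? [? _]].
- move=> m [mh Cm]; pose (N := sep h (fun x => Hull m x)).
  have inN x : x ∈ N <-> x ∈ h /\ Hull m x by exact: in_sep.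
  exists N; split; last by move=> x xm; apply/inN; split; [exact: mh | exact: Hull_in].
  apply/inC; split; [|split].
  + by move=> x /inN [].
  + case: (classic (exists x, x ∈ m)) => [ne|em].
      have [e He] := Hull_enum m ne Cm; apply/Ctbl_V; exists e => x /inN [_ /He //].
    have nH x : ~ Hull m x by elim=> {x} // x xm; apply: em; exists x.
    by apply/Ctbl_V; exists (fun _ => emp) => x /inN [_ /nH].
  + move=> x xh Hx; apply/inN; split=> //; apply: Hull_mono Hx.
    by move=> y /inN [].
- move=> d dC _ Cd ch; apply/inC; split; [|split].
  + by move=> y /in_Un [n [yn /dC /inC [nh _]]]; exact: nh.
  + by apply: Ctbl_Un => // n /dC /inC [_ []].
  + move=> x xh Hx.
    have [n [nd Hn]] : exists n, n ∈ d /\ Hull n x.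
      elim: Hx => {x xh} [x /in_Un [n [xn nd]]|i x y _ [n [nd Hn]] _ [m [md Hm]]].
        by exists n; split=> //; exact: Hull_in.
      case: (ch n nd m md) => s.
      * exists m; split=> //; apply: Hull_op => //; apply: Hull_mono Hn => z /s; exact: Hull_in.
      * exists n; split=> //; apply: Hull_op => //; apply: Hull_mono Hm => z /s; exact: Hull_in.
    by apply/in_Un; exists n; split=> //; have /inC [_ [_ H]] := dC n nd; exact: H.
Qed.
End Hull.

Section Reduction.
Context (P Q le : V) (HP : Poset P le) (HQ : Poset Q le) (PQ : Sub P Q).
Context (cmpPQ : forall p, p ∈ P -> forall q, q ∈ P -> Cmp Q le p q -> Cmp P le p q).
Context (maxPQ : forall a, 
  (Sub a P /\ forall p, p ∈ a -> forall q, q ∈ a -> p <> q -> ~ Cmp P le p q) /\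
  (forall b, (Sub b P /\ forall p, p ∈ b -> forall q, q ∈ b -> p <> q -> ~ Cmp P le p q) ->
     Sub a b -> Sub b a) ->
  (forall b, (Sub b Q /\ forall p, p ∈ b -> forall q, q ∈ b -> p <> q -> ~ Cmp Q le p q) ->
     Sub a b -> Sub b a)).

(** [p] forces that [z] belongs to the quotient. *)
Definition Inq p z := forall p', p' ∈ P -> lep le p' p -> Cmp Q le z p'.

Lemma Cmp_sym R p q : Cmp R le p q -> Cmp R le q p.
Proof. by move=> [r [rR [rp rq]]]; exists r. Qed.

(** Greedy selection along a well-order of [V]: a condition in [D] is taken when it is incompatible
    with all those taken before; one that is passed over is compatible with an earlier choice. *)
Lemma maximal_antichain_in (D : V -> Prop) : exists a, Sub a P /\
  (forall p, p ∈ a -> D p) /\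
  (forall p, p ∈ a -> forall q, q ∈ a -> p <> q -> ~ Cmp P le p q) /\
  forall p, p ∈ P -> D p -> exists q, q ∈ a /\ Cmp P le p q.
Proof.
have [lt [least [_ wf]]] := well_ordering V.
have tri x y : lt x y \/ x = y \/ lt y x.
  have [|m [[->|->] H]] := least (fun z => z = x \/ z = y); first by exists x; left.
  - by have [->|?] := H y (or_intror eq_refl); tauto.
  - by have [->|?] := H x (or_introl eq_refl); tauto.
pose (A := Fix wf (fun _ => Prop) (fun x A => (x ∈ P /\ D x) /\ forall y (yx : lt y x), A y yx -> ~ Cmp P le y x)).
have AE x : A x <-> (x ∈ P /\ D x) /\ forall y, lt y x -> A y -> ~ Cmp P le y x.
  rewrite {1}/A Fix_eq //.
  move=> {}x f g e; have -> // : f = g.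
  by extensionality y; extensionality yx; exact: e.
pose (a := sep P A).
have ina x : x ∈ a <-> x ∈ P /\ A x by exact: in_sep.
exists a; split; first by move=> x /ina [].
split; first by move=> x /ina [_ /AE [[]]].
split.
- move=> p /ina [_ Ap] q /ina [_ Aq] ne; case: (tri p q) => [pq|[//|qp]].
  + by case/AE: Aq => _; apply.
  + by case/AE: Ap => _ H /Cmp_sym; apply: H.
- move=> p pP Dp; case: (classic (A p)) => [Ap|nA].
    exists p; split; first by apply/ina.
    by exists p; split=> //; split; apply: (lep_refl _ _ HP).
  apply: NNPP => nE; apply: nA; apply/AE; split=> // y yp Ay C; apply: nE; exists y; split; last exact: Cmp_sym.
  by apply/ina; split=> //; case/AE: Ay => [[]].
Qed.

(** Otherwise the conditions of [P] incompatible with [q] are dense in [P], and an antichain maximal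
    among them is maximal in [P], hence in [Q]. But adding [q] to it leaves an antichain. *)
Lemma reduction q : q ∈ Q -> exists p, p ∈ P /\ Inq p q.
Proof.
move=> qQ; apply: NNPP => nE.
have dn p : p ∈ P -> exists p', p' ∈ P /\ lep le p' p /\ ~ Cmp Q le q p'.
  move=> pP; apply: NNPP => nF; apply: nE; exists p; split=> // p' p'P p'p.
  by apply: NNPP => nC; apply: nF; exists p'.
have [a [aP [aD [anti mx]]]] := maximal_antichain_in (fun p => ~ Cmp Q le q p).
have mxP b : Sub b P /\ (forall p, p ∈ b -> forall q, q ∈ b -> p <> q -> ~ Cmp P le p q) ->
    Sub a b -> Sub b a.
  move=> [bP bA] ab p pb; have [p' [p'P [p'p nC]]] := dn p (bP p pb).
  have [r [ra [s [sP [sp' sr]]]]] := mx p' p'P nC.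
  have -> // : p = r.
  apply: NNPP => ne; case: (bA p pb r (ab r ra) ne); exists s; split=> //; split=> //.
  by apply: (lep_trans _ _ HP s p' p) => //; exact: bP.
have K := maxPQ a (conj (conj aP anti) mxP) (cup a (pair q q)).
have qa : q ∈ a.
  apply: K; last by apply/in_cup; right; apply/in_pair; left.
    split.
    - by move=> z /in_cup [/aP /PQ //|/in_pair [->|->]].
    - have aq z : z ∈ a -> ~ Cmp Q le z q by move=> za /Cmp_sym; exact: aD.
      move=> z Hz w Hw ne C; move: Hz Hw => /in_cup [za|/in_pair zq] /in_cup [wa|/in_pair wq].
      + by apply: (anti z za w wa ne); apply: cmpPQ => //; exact: aP.
      + by have {}wq : w = q by [case: wq]; subst w; case: (aq z za).
      + have {}zq : z = q by [case: zq]; subst z; by case: (aD w wa).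
      + by apply: ne; case: zq; case: wq => -> ->.
  by move=> z za; apply/in_cup; left.
by apply: (aD q qa); exists q; split=> //; split; apply: (lep_refl _ _ HQ).
Qed.
End Reduction.

(** * The quotient forcing *)

Section Quotient.
Context (P Q le : V) (HP : Poset P le).
Implicit Types (a b p q x y z s : V).
Notation MU := (MU P le).
Notation nm := (nm P le).
Notation ck := (ck P le).
Notation chk := (chk P).
Notation Gen := (Gen P le).
Notation Ult := (Ult P le).
Notation Tv := (Tv P).
Notation fr := (fr P le).
Notation Feq := (Feq P le).
Notation MemC := (MemC P le).
Notation prefl := (lep_refl _ _ HP).
Notation ptrans := (lep_trans _ _ HP).
Notation satG := (satU P le HP).
#[local] Hint Extern 0 (Model (MU ?U)) =>
  (match goal with HU : Ult U |- _ => exact (MUModel P le HP U HU) end) : typeclass_instances.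

Lemma Gen_exists p : p ∈ P -> exists U, Ult U /\ Gen p U.
Proof. exact: Ult_exists. Qed.

Lemma Gen_mono U (HU : Ult U) p q : p ∈ P -> q ∈ P -> lep le p q -> Gen p U -> Gen q U.
Proof.
move=> pP qP pq; apply: (ult_up _ _ _ HU) => s [sP sp]; split=> //; exact: (ptrans s p q).
Qed.

(** The substitute for the truth lemma of a generic filter: what holds at [U], together with a set
    [B] that [U] accepts, is witnessed at a single condition [s], and the argument goes on at any
    ultrafilter below [s]. *)
Lemma Gen_refine n A (v : env V n) U (HU : Ult U) p (B : V -> Prop) : uniform false n A -> p ∈ P ->
  Gen p U -> satG U HU (A (MU U) (emap (nm U) v)) -> Tv U B ->
  exists s, s ∈ P /\ lep le s p /\ B s /\
    forall U' HU', Gen s U' -> satG U' HU' (A (MU U') (emap (nm U') v)).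
Proof.
move=> HA pP Gp /(losU _ _ HP n A U HU v HA) TA TB.
have TAB : Tv U (fun s => B s /\ fr (A V v) s) by apply/(Tv_and _ _ _ HU).
have [s [sP [sp [Bs As]]]] := Tv_Gen_ex _ _ _ HU p _ Gp TAB.
exists s; do 3 (split=> //); exact: (proj1 (complete _ _ HP n A v s HA sP) As).
Qed.

Lemma maximum_principle n A (v : env V n) p : uniform false (S n) A -> p ∈ P ->
  (forall U (HU : Ult U), Gen p U -> exists X, satG U HU (A (MU U) (emap (nm U) v, X))) ->
  exists x, forall U (HU : Ult U), Gen p U -> satG U HU (A (MU U) (emap (nm U) v, nm U x)).
Proof.
move=> HA pP H.
have UE : uniform false n (fun X v => Ex (fun y : X => A X (v, y))).
  exact (u_Not false n _ (u_All false n _ (u_Not false (S n) _ HA))).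
have E : fr (Ex (fun x => A V (v, x))) p.
  apply: (proj2 (complete _ _ HP n _ v p UE pP)) => U HU G.
  have [X HX] := H U HU G; move=> K; exact: (K X HX).
have [x Hx] := fullness _ _ HP n _ (Val_fr _ _ HP _ _ HA) v.
exists x; apply: (proj1 (complete _ _ HP (S n) A (v, x) p HA pP)).
by apply: Hx => //; exact: (proj1 (fr_Ex P le _ p pP) E).
Qed.

Lemma nm_Feq U (HU : Ult U) s x y : Gen s U -> Feq s x y -> nm U x = nm U y.
Proof.
move=> G e; have sP := Feq_in _ _ _ _ _ e; apply/(nm_eq _ _ HP _ HU).
apply: (Tv_Gen _ _ _ HU s) => // q qP qs; exact: (Feq_mono _ _ HP s).
Qed.

(** Which element of the domain of [b] equals [x] may vary with the condition, so the conclusion is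
    a set of conditions in [U] and not one [y]. *)
Lemma mem_Tv U (HU : Ult U) x b : nm U x ∈ nm U b ->
  Tv U (fun s => exists y r, r ∈ P /\ opair y r ∈ b /\ lep le s r /\ Feq s x y).
Proof.
move=> /(mem_nm _ _ HP U HU) H; apply: NNPP => nT.
have K : forall p q, p ∈ P -> q ∈ P -> lep le q p ->
    (exists y r, r ∈ P /\ opair y r ∈ b /\ lep le p r /\ Feq p x y) ->
    exists y r, r ∈ P /\ opair y r ∈ b /\ lep le q r /\ Feq q x y.
  move=> p q pP qP qp [y [r [rP [yr [pr e]]]]]; exists y, r; split=> //; split=> //.
  by split; [exact: (ptrans q p r) | exact: (Feq_mono _ _ HP p)].
have {nT}T := proj2 (Tv_not _ _ HP _ HU _ K) nT.
have [p [pP [H1 H2]]] := Tv_ex _ _ _ HU _ (proj2 (Tv_and _ _ _ HU _ _) (conj H T)).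
have [s [sP [sp Hs]]] := H1 p pP (prefl p pP); exact: (H2 s sP sp).
Qed.

Lemma in_ck_Tv U (HU : Ult U) x a : nm U x ∈ ck U a -> Tv U (fun s => exists z, z ∈ a /\ Feq s x (chk z)).
Proof.
move=> /(mem_Tv U HU); apply: (Tv_mono _ _ _ HU) => s sP [y [r [rP [/in_chk [z [r' [za [_ e]]]] [_ H]]]]].
by have [ey _] := opair_inj _ _ _ _ e; exists z; rewrite -ey.
Qed.

Lemma ck_lep U (HU : Ult U) x y : lep (ck U le) (ck U x) (ck U y) <-> lep le x y.
Proof. by rewrite /lep -(ck_opair _ _ HP U HU); exact: (ck_mem _ _ HP U HU). Qed.

(** A common extension found in the extension is an element of [ck U Q] that need not be a check
    name; incompatibility is therefore transferred by [ck_all]. *)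
Lemma ck_Cmp U (HU : Ult U) x y : Cmp (ck U Q) (ck U le) (ck U x) (ck U y) <-> Cmp Q le x y.
Proof.
split; last first.
  move=> [z [zQ [zx zy]]]; exists (ck U z); split; first by apply/(ck_mem _ _ HP U HU).
  by split; apply/ck_lep.
move=> [Z [ZQ [Zx Zy]]]; apply: NNPP => nC.
have UA : uniform false 4 (fun X v => Not (And (pairIn (snd v) (snd (fst (fst v))) (snd (fst (fst (fst v)))))
   (pairIn (snd v) (snd (fst v)) (snd (fst (fst (fst v))))))) by unif.
have S : forall U (HU : Ult U) (A B L Z : MU U),
   satG U HU (Not (And (pairIn Z A L) (pairIn Z B L))) <-> ~ (lep L Z A /\ lep L Z B).
  by move=> *; unfold satU; sati.
refine (proj1 (S U HU (ck U x) (ck U y) (ck U le) Z)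
  (ck_all _ _ HP 3 _ (tt, chk le, chk x, chk y) Q UA _ U HU Z ZQ) (conj Zx Zy)) => z zQ U' HU'.
apply: (proj2 (S U' HU' (ck U' x) (ck U' y) (ck U' le) (ck U' z))) => -[].
by move=> /(ck_lep U' HU') zx /(ck_lep U' HU') zy; apply: nC; exists z.
Qed.

Definition GenName := repl P (fun p => opair (chk p) p).

Lemma ck_GenName U (HU : Ult U) p : p ∈ P -> Gen p U -> ck U p ∈ nm U GenName.
Proof.
move=> pP G; apply/(mem_nm _ _ HP U HU); apply: (Tv_Gen _ _ _ HU p) => // q qP qp.
by apply: (MemC_intro _ _ HP q _ p) => //; apply/in_repl; exists p.
Qed.

Lemma GenName_Tv U (HU : Ult U) x : nm U x ∈ nm U GenName ->
  Tv U (fun s => exists p, p ∈ P /\ lep le s p /\ Feq s x (chk p)).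
Proof.
move=> /(mem_Tv U HU); apply: (Tv_mono _ _ _ HU) => s sP [y [r [rP [/in_repl [r' [_ e]] [sr H]]]]].
by have [ey er] := opair_inj _ _ _ _ e; exists r; split=> //; split=> //; rewrite er -ey.
Qed.

(** Connects the combinatorial [Inq] with what [p] forces. From a failure at an element of the
    generic set, refining yields [s] at which that element is [chk r] with [s] below [r]; a common
    extension of [z] and [s] also serves for [r]. *)
Lemma quotient_ck p z : p ∈ P -> Sub P Q -> Poset Q le ->
  (forall U (HU : Ult U), Gen p U -> forall Y, Y ∈ nm U GenName -> Cmp (ck U Q) (ck U le) (ck U z) Y) <->
  Inq P Q le p z.
Proof.
move=> pP PQ HQ; split.
- move=> H p' p'P p'p; have [U [HU G]] := Gen_exists p' p'P.
  apply/(ck_Cmp U HU); apply: H; last exact: ck_GenName.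
  exact: (Gen_mono _ HU p').
- move=> H U HU G Y; have [x ->] := nm_surj _ _ _ Y => /(GenName_Tv U HU) T; apply: NNPP => nC.
  have UA : uniform false 4 (fun X v => Not (compatible (snd (fst (fst (fst v)))) (snd (fst (fst v)))
    (snd (fst v)) (snd v))) by unif.
  have S : forall U (HU : Ult U) (A B C D : MU U),
     satG U HU (Not (compatible A B C D)) <-> ~ Cmp A B C D.
    by move=> *; unfold satU; sati.
  have [s [sP [sp [[r [rP [sr e]]] K]]]] := Gen_refine 4 _ (tt, chk Q, chk le, chk z, x) U HU p _ UA pP G
    (proj2 (S U HU _ _ _ _) nC) T.
  have [U' [HU' G']] := Gen_exists s sP.
  apply: (proj1 (S U' HU' _ _ _ _) (K U' HU' G')); cbn [emap fst snd].
  rewrite (nm_Feq U' HU' s x (chk r) G' e); apply/(ck_Cmp U' HU').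
  have [t [tQ [tz ts]]] := H s sP sp; exists t; split=> //; split=> //.
  apply: (lep_trans _ _ HQ t s r) => //; exact: PQ.
Qed.
End Quotient.

(** * A name for the set of terms of an external sequence of names *)

Section ChainName.
Context (P le : V) (HP : Poset P le).
Notation MU := (MU P le).
Notation nm := (nm P le).
Notation ck := (ck P le).
Notation chk := (chk P).
Notation Gen := (Gen P le).
Notation Ult := (Ult P le).
Notation Tv := (Tv P).
Notation fr := (fr P le).
Notation Feq := (Feq P le).
Notation MemC := (MemC P le).
Notation prefl := (lep_refl _ _ HP).
Notation ptrans := (lep_trans _ _ HP).
Notation satG := (satU P le HP).
#[local] Hint Extern 0 (Model (MU ?U)) =>
  (match goal with HU : Ult U |- _ => exact (MUModel P le HP U HU) end) : typeclass_instances.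

Context (ch : nat -> V).

Definition termOf (x : V) s := exists i, Feq s x (ch i).

(** [k] names an index at which the sequence takes the value named by [x]. *)
Definition indexOf (v : env V 2) p := forall q, q ∈ P -> lep le q p -> exists s, s ∈ P /\ lep le s q /\
  exists i, Feq s (snd (fst v)) (ch i) /\ Feq s (snd v) (chk (num i)).

Lemma Val_indexOf : Val P le 2 indexOf.
Proof.
split; [exact: I | split].
- move=> v; apply: (Reg_dense _ _ HP) => p q pP qP qp [i [e1 e2]]; exists i.
  by split; apply: (Feq_mono _ _ HP p).
- move=> v v' p pP [[_ e1] e2] H q qP qp; have [s [sP [sq [i [e3 e4]]]]] := H q qP qp.
  have sp := ptrans s q p sP qP pP sq qp.
  exists s; split=> //; split=> //; exists i; split.
  + apply: (Feq_trans _ _ HP _ _ _ _ _ e3); apply: Feq_sym; exact: (Feq_mono _ _ HP p).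
  + apply: (Feq_trans _ _ HP _ _ _ _ _ e4); apply: Feq_sym; exact: (Feq_mono _ _ HP p).
Qed.

(** The sequence [ch] is external to the extension. The relation with Boolean value [indexOf]
    connects a term with every index at which it occurs, and the integers of the extension are
    [ck U ω], so [Ctbl_cover] applies. *)
Lemma Ctbl_terms U (HU : Ult U) d : (forall x, nm U x ∈ nm U d -> Tv U (termOf x)) -> Ctbl (nm U d).
Proof.
move=> Hd; have LA := Lv_of_Val _ _ HP _ HU _ _ Val_indexOf.
pose (B := fun K X : MU U => exists v : env V 2, ((tt, X, K) : env (MU U) 2) = emap (nm U) v /\ Tv U (indexOf v)).
have BE x k : B (nm U k) (nm U x) <-> Tv U (indexOf (tt, x, k)) by exact: (proj2 LA (tt, x, k)).
have DB : Def2 B.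
  exists (fun v => indexOf (tt, snd v, snd (fst v))); split.
    split; [exact: I | split]; first by move=> v; exact: (proj1 (proj2 Val_indexOf)).
    by move=> v v' p pP [[_ e1] e2]; apply: (proj2 (proj2 Val_indexOf)).
  by move=> [[[] k] x]; exact: BE.
apply: (Ctbl_cover B) => [X|K X X'].
- have [x ->] := nm_surj _ _ _ X => /Hd T.
  have [_ L] := Lv_ex _ _ HP _ HU _ _ _ LA.
  have [|K HK] := proj2 (L (tt, x)).
    apply: (Tv_mono _ _ _ HU) T => // p pP [i e] q qP qp; exists q; split=> //; split; first exact: prefl.
    exists (chk (num i)) => s sP sq; exists s; split=> //; split; first exact: prefl.
    by exists i; split; [apply: (Feq_mono _ _ HP p) => //; exact: (ptrans s q p) | exact: (Feq_refl _ _ HP)].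
  exists K; split=> //; rewrite (ck_ω _ _ HP U HU); move: HK.
  have [k ->] := nm_surj _ _ _ K => HK; have {}HK := proj1 (BE x k) HK.
  apply/(mem_ck _ _ HP U HU); apply: (Tv_mono _ _ _ HU) HK => // p pP H; apply/(chk_MemC _ _ HP) => // q qP qp.
  have [s [sP [sq [i [_ e]]]]] := H q qP qp; exists s; split=> //; split=> //; exists (num i).
  by split=> //; apply/in_ω_num; exists i.
- have [k ->] := nm_surj _ _ _ K; have [x ->] := nm_surj _ _ _ X; have [x' ->] := nm_surj _ _ _ X' => _ _.
  move=> /BE T /BE T'; apply/(nm_eq _ _ HP U HU).
  have := proj2 (Tv_and _ _ _ HU _ _) (conj T T'); apply: (Tv_mono _ _ _ HU) => // p pP [H H'].
  apply: (proj2 (Reg_Feq _ _ HP _ _)) => // q qP qp.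
  have [s [sP [sq [i [e1 e2]]]]] := H q qP qp.
  have [t [tP [ts [j [e3 e4]]]]] := H' s sP (ptrans s q p sP qP pP sq qp).
  exists t; split=> //; split; first exact: (ptrans t s q).
  have ij : i = j.
    apply: num_inj; apply: (chk_inj _ _ HP t); apply: (Feq_trans _ _ HP _ _ k); last exact: e4.
    by apply: Feq_sym; exact: (Feq_mono _ _ HP s t _ _ tP ts e2).
  subst j; apply: (Feq_trans _ _ HP _ _ (ch i)); first exact: (Feq_mono _ _ HP s t _ _ tP ts e1).
  exact: Feq_sym.
Qed.

(** The terms are attached to all conditions of [P]. Elements of [d] are only locally of the form
    [ch i], so membership in the club and comparability are checked below a condition fixing the
    indices; there comparability is that of indices in [nat]. *)
Lemma chain_name p c h : p ∈ P ->
  (forall U (HU : Ult U), Gen p U -> forall i, Sub (nm U (ch i)) (nm U (ch (S i)))) ->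
  (forall U (HU : Ult U), Gen p U -> Club (nm U c) (nm U h) /\ forall i, nm U (ch i) ∈ nm U c) ->
  exists d, forall U (HU : Ult U), Gen p U ->
    (forall i, nm U (ch i) ∈ nm U d) /\
    (forall x, nm U x ∈ nm U d -> Tv U (termOf x)) /\ Un (nm U d) ∈ nm U c.
Proof.
move=> pP Hinc HC; have [a Ha] := nat_set ch; exists (prod a P) => U HU G.
have E1 i : nm U (ch i) ∈ nm U (prod a P).
  apply/(mem_nm _ _ HP U HU); apply: (Tv_true _ _ HP _ HU) => q qP.
  apply: (MemC_intro _ _ HP q _ q) => //; last exact: prefl.
  by apply/opair_in_prod; split=> //; apply/Ha; exists i.
have E2 x : nm U x ∈ nm U (prod a P) -> Tv U (termOf x).
  move=> /(mem_Tv _ _ HP U HU); apply: (Tv_mono _ _ _ HU) => // s sP [y [r [rP [/opair_in_prod [/Ha [i ->] _] [_ e]]]]].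
  by exists i.
split=> //; split=> //; have [[_ [_ Hcl]] _] := HC U HU G; apply: Hcl.
- move=> X; have [x ->] := nm_surj _ _ _ X => /E2 T; apply: NNPP => nC.
  have UA : uniform false 2 (fun X v => Not (In (snd v) (snd (fst v)))) by unif.
  have [s [sP [sp [[i e] K]]]] := Gen_refine _ _ HP 2 _ (tt, c, x) U HU p _ UA pP G nC T.
  have [U' [HU' G']] := Gen_exists _ _ HP s sP.
  apply: (K U' HU' G'); rewrite /= (nm_Feq _ _ HP U' HU' s x (ch i) G' e).
  by apply: (proj2 (HC U' HU' _)); exact: (Gen_mono _ _ HP _ HU' s).
- move=> em; exact: (em _ (E1 0)).
- exact: Ctbl_terms.
- move=> X; have [x ->] := nm_surj _ _ _ X => /E2 Tx Y; have [y ->] := nm_surj _ _ _ Y => /E2 Ty.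
  apply: NNPP => nC.
  have UA : uniform false 2 (fun X v => Not (Or (sub (snd (fst v)) (snd v)) (sub (snd v) (snd (fst v))))) by unif.
  have S : forall U (HU : Ult U) (A B : MU U),
     satG U HU (Not (Or (sub A B) (sub B A))) <-> ~ (Sub A B \/ Sub B A).
    by move=> *; unfold satU; sati.
  have [s [sP [sp [[[i ex] [j ey]] K]]]] := Gen_refine _ _ HP 2 _ (tt, x, y) U HU p _ UA pP G
    (proj2 (S U HU (nm U x) (nm U y)) nC) (proj2 (Tv_and _ _ _ HU _ _) (conj Tx Ty)).
  have [U' [HU' G']] := Gen_exists _ _ HP s sP.
  apply: (proj1 (S U' HU' _ _) (K U' HU' G')); cbn [emap fst snd].
  rewrite (nm_Feq _ _ HP U' HU' s x (ch i) G' ex) (nm_Feq _ _ HP U' HU' s y (ch j) G' ey).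
  have up := Hinc U' HU' (Gen_mono _ _ HP _ HU' s p sP pP sp G').
  have mono m n : Sub (nm U' (ch m)) (nm U' (ch (n + m))).
    by elim: n => [|n IH] //= z zm; apply: up; exact: IH.
  have [ij|ji] := Nat.le_ge_cases i j; [left|right].
  + have := mono i (j - i); by rewrite Nat.sub_add.
  + have := mono j (i - j); by rewrite Nat.sub_add.
Qed.
End ChainName.

(** * Stationarity in the extension *)

Section Stationarity.
Context (P Q le : V) (HP : Poset P le) (HQ : Poset Q le) (PQ : Sub P Q).
Implicit Types (a b p q x y z s : V).
Notation MU := (MU P le).
Notation nm := (nm P le).
Notation ck := (ck P le).
Notation chk := (chk P).
Notation Gen := (Gen P le).
Notation Ult := (Ult P le).
Notation Tv := (Tv P).
Notation Feq := (Feq P le).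
Notation prefl := (lep_refl _ _ HP).
Notation ptrans := (lep_trans _ _ HP).
Notation qrefl := (lep_refl _ _ HQ).
Notation qtrans := (lep_trans _ _ HQ).
Notation satG := (satU P le HP).
Notation GenName := (GenName P).
Notation Inq := (Inq P Q le).
#[local] Hint Extern 0 (Model (MU ?U)) =>
  (match goal with HU : Ult U |- _ => exact (MUModel P le HP U HU) end) : typeclass_instances.

Context (cmpPQ : forall p, p ∈ P -> forall q, q ∈ P -> Cmp Q le p q -> Cmp P le p q).
Context (red : forall q, q ∈ Q -> exists p, p ∈ P /\ Inq p q).
Context (glbQ : forall p, p ∈ Q -> forall q, q ∈ Q -> Cmp Q le p q -> exists r, Glb Q le r p q).
Context (star : forall x, x ∈ P -> forall y, y ∈ Q -> forall z, z ∈ Q ->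
  Cmp Q le x y -> Cmp Q le x z -> Cmp Q le y z -> forall w, Glb Q le w y z -> Cmp Q le x w).
Context (h0 : V) (Qh0 : Sub Q h0).
Context (stat : forall p, p ∈ Q -> forall C, Club C h0 -> exists n, n ∈ C /\ Pw1 h0 n /\ p ∈ n /\
    exists q, q ∈ Q /\ lep le q p /\ SGen q n Q le).
Context (p0 : V) (p0P : p0 ∈ P) (R h r c : V).
Context (HR : forall U (HU : Ult U), Gen p0 U -> forall X, X ∈ nm U R <-> X ∈ ck U Q /\
  forall Y, Y ∈ nm U GenName -> Cmp (ck U Q) (ck U le) X Y).
Context (Rh : forall U (HU : Ult U), Gen p0 U -> Sub (nm U R) (nm U h)).
Context (rR : forall U (HU : Ult U), Gen p0 U -> nm U r ∈ nm U R).
Context (Hc : forall U (HU : Ult U), Gen p0 U -> Club (nm U c) (nm U h)).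

Lemma Inq_mono p p' z : p ∈ P -> p' ∈ P -> lep le p' p -> Inq p z -> Inq p' z.
Proof. by move=> pP p'P p'p H s sP sp'; apply: H => //; exact: (ptrans s p' p). Qed.

Lemma ck_R p z : p ∈ P -> lep le p p0 -> z ∈ Q ->
  (forall U (HU : Ult U), Gen p U -> ck U z ∈ nm U R) <-> Inq p z.
Proof.
move=> pP pp0 zQ; have [K1 K2] := quotient_ck P Q le HP p z pP PQ HQ; split.
- move=> H; apply: K1 => U HU G Y; apply: (proj2 (proj1 (HR U HU _ _) (H U HU G))).
  exact: (Gen_mono _ _ HP _ HU p).
- move=> H U HU G; apply/(HR U HU); first exact: (Gen_mono _ _ HP _ HU p).
  split; first by apply/(ck_mem _ _ HP U HU).
  exact: K2 H U HU G.
Qed.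

(** The formula [A] carries facts known at [U] down to [s], where the element of [ck U a] has become
    an actual check name. *)
Lemma decide_in_ck n A (v : env V n) U (HU : Ult U) p x a : uniform false n A -> p ∈ P -> Gen p U ->
  satG U HU (A (MU U) (emap (nm U) v)) -> nm U x ∈ ck U a ->
  exists s z, s ∈ P /\ lep le s p /\ z ∈ a /\
    forall U' (HU' : Ult U'), Gen s U' -> nm U' x = ck U' z /\ satG U' HU' (A (MU U') (emap (nm U') v)).
Proof.
move=> HA pP G K /(in_ck_Tv _ _ HP U HU) T.
have [s [sP [sp [[z [za e]] H]]]] := Gen_refine _ _ HP n A v U HU p _ HA pP G K T.
exists s, z; do 3 (split=> //); move=> U' HU' G'; split; last exact: H.
exact: (nm_Feq _ _ HP U' HU' s).
Qed.

Lemma decide_condition : exists p1 r1, p1 ∈ P /\ lep le p1 p0 /\ r1 ∈ Q /\ Inq p1 r1 /\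
  forall U (HU : Ult U), Gen p1 U -> nm U r = ck U r1.
Proof.
have [U [HU G]] := Gen_exists _ _ HP p0 p0P.
have [rQ _] := proj1 (HR U HU G _) (rR U HU G).
have UT : uniform false 0 (fun X _ => All (fun x : X => Eq x x)) by unif.
have [p1 [r1 [p1P [p10 [r1Q H]]]]] := decide_in_ck 0 _ tt U HU p0 r Q UT p0P G (fun _ => eq_refl) rQ.
exists p1, r1; do 3 (split=> //); split; last by move=> U' HU' G'; case: (H U' HU' G').
apply/ck_R => // U' HU' G'; have [<- _] := H U' HU' G'; apply: rR.
exact: (Gen_mono _ _ HP _ HU' p1).
Qed.

Lemma extend_name n y : exists b, forall U (HU : Ult U), Gen p0 U -> nm U n ∈ nm U c ->
  nm U b ∈ nm U c /\ Sub (nm U n) (nm U b) /\ (nm U y ∈ nm U h -> nm U y ∈ nm U b).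
Proof.
have UA : uniform false 5 (fun X v => Imp (In (snd (fst (fst v))) (snd (fst (fst (fst (fst v))))))
  (And (In (snd v) (snd (fst (fst (fst (fst v)))))) (And (sub (snd (fst (fst v))) (snd v))
    (Imp (In (snd (fst v)) (snd (fst (fst (fst v))))) (In (snd (fst v)) (snd v)))))) by unif.
have S : forall U (HU : Ult U) (C H N Y B : MU U),
   satG U HU (Imp (In N C) (And (In B C) (And (sub N B) (Imp (In Y H) (In Y B))))) <->
   (N ∈ C -> B ∈ C /\ Sub N B /\ (Y ∈ H -> Y ∈ B)).
  by move=> *; unfold satU; sati.
have [|b Hb] := maximum_principle _ _ HP 4 _ (tt, c, h, n, y) p0 UA p0P.
  move=> U HU G; have [Hc1 [Hc2 _]] := Hc U HU G.
  case: (classic (nm U n ∈ nm U c)) => [nc|nc]; last first.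
    by exists (nm U n); apply: (proj2 (S U HU (nm U c) (nm U h) (nm U n) (nm U y) (nm U n))).
  have [nh Cn] := Hc1 _ nc.
  have [|N [NC HN]] := Hc2 (sep (cup (nm U n) (pair (nm U y) (nm U y))) (fun w => w ∈ nm U h)).
    split; first by move=> z /in_sep [].
    apply: (Ctbl_sub _ (cup (nm U n) (pair (nm U y) (nm U y)))); first by move=> z /in_sep [].
    by apply: Ctbl_cup => //; exact: Ctbl_pair.
  exists N; apply: (proj2 (S U HU (nm U c) (nm U h) (nm U n) (nm U y) N)) => _; split=> //; split.
  - by move=> z zn; apply: HN; apply/in_sep; split; [apply/in_cup; left | exact: nh].
  - by move=> yh; apply: HN; apply/in_sep; split=> //; apply/in_cup; right; apply/in_pair; left.
exists b => U HU G; exact: (proj1 (S U HU (nm U c) (nm U h) (nm U n) (nm U y) (nm U b)) (Hb U HU G)).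
Qed.

Lemma initial_name : exists n, forall U (HU : Ult U), Gen p0 U -> nm U n ∈ nm U c.
Proof.
have UA : uniform false 2 (fun X v => In (snd v) (snd (fst v))) by unif.
have [|n Hn] := maximum_principle _ _ HP 1 _ (tt, c) p0 UA p0P; last by exists n.
move=> U HU G; have [_ [Hc2 _]] := Hc U HU G.
have [|N [NC _]] := Hc2 emp; last by exists N.
by split; [move=> z zz; case: (in_emp z zz) | exact: Ctbl_emp].
Qed.

Lemma injection_name y : exists f, forall U (HU : Ult U), Gen p0 U -> nm U y ∈ nm U c -> Inj (nm U f) (nm U y) ω.
Proof.
have UA : uniform false 4 (fun X v => Imp (In (snd (fst v)) (snd (fst (fst (fst v)))))
  (isInjection (snd v) (snd (fst v)) (snd (fst (fst v))))) by unif.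
have S : forall U (HU : Ult U) (C W Y F : MU U),
   satG U HU (Imp (In Y C) (isInjection F Y W)) <-> (Y ∈ C -> Inj F Y W).
  by move=> *; unfold satU; sati.
have [|f Hf] := maximum_principle _ _ HP 3 _ (tt, c, chk ω, y) p0 UA p0P.
  move=> U HU G; have [Hc1 _] := Hc U HU G.
  case: (classic (nm U y ∈ nm U c)) => yc.
    have [_ [F HF]] := Hc1 _ yc; exists F; apply: (proj2 (S U HU (nm U c) (ck U ω) (nm U y) F)) => _.
    by rewrite -(ck_ω _ _ HP U HU).
  by exists (nm U y); apply: (proj2 (S U HU (nm U c) (ck U ω) (nm U y) (nm U y))).
exists f => U HU G; rewrite (ck_ω _ _ HP U HU).
exact: (proj1 (S U HU (nm U c) (ck U ω) (nm U y) (nm U f)) (Hf U HU G)).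
Qed.

(** Here [f] names an injection of a countable set into [ω]. *)
Definition nth_is f (k : nat) p a := forall U (HU : Ult U), Gen p U -> opair (ck U a) (ck U (num k)) ∈ nm U f.

(** * The union of the chain and [N] have the same trace on the quotient *)

Section Trace.
Context (ff : V -> V) (Hff : forall y U (HU : Ult U), Gen p0 U -> nm U y ∈ nm U c -> Inj (nm U (ff y)) (nm U y) ω).
(** In the application [MM] is the hull of [N] under countably many operations. It contains names as
    well as conditions, and [NM] and [MN] make it agree with [N] on [Q]. The hypotheses that follow
    are the closure properties that the chosen operations provide. *)
Context (MM : V -> Prop) (N : V) (NM : forall x, x ∈ N -> MM x) (MN : forall x, x ∈ Q -> MM x -> x ∈ N).
Context (Mglb : forall x y, MM x -> MM y -> x ∈ Q -> y ∈ Q -> Cmp Q le x y -> exists g, MM g /\ Glb Q le g x y).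
Context (Mred : forall x, x ∈ Q -> MM x -> exists p, p ∈ P /\ MM p /\ Inq p x).
Context (Mdec : forall k y p, MM y -> MM p -> p ∈ P -> exists p', p' ∈ P /\ MM p' /\ lep le p' p /\
  ((exists a, a ∈ Q /\ nth_is (ff y) k p' a) \/
   forall s, s ∈ P -> lep le s p' -> forall a, a ∈ Q -> ~ nth_is (ff y) k s a)).
Context (Mnth : forall k y p a, MM y -> MM p -> p ∈ P -> a ∈ Q -> nth_is (ff y) k p a ->
  exists a', a' ∈ Q /\ MM a' /\ nth_is (ff y) k p a').
Context (ch : nat -> V) (chM : forall i, MM (ch i)).
Context (chc : forall i U (HU : Ult U), Gen p0 U -> nm U (ch i) ∈ nm U c).
Context (chx : forall x, x ∈ Q -> MM x -> exists j, forall U (HU : Ult U), Gen p0 U -> ck U x ∈ nm U h ->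
  ck U x ∈ nm U (ch j)).
Context (d : V) (Hd1 : forall U (HU : Ult U), Gen p0 U -> forall i, nm U (ch i) ∈ nm U d).
Context (Hd2 : forall U (HU : Ult U), Gen p0 U -> forall x, nm U x ∈ nm U d -> Tv U (termOf P le ch x)).
Context (q p2 : V) (qQ : q ∈ Q) (SG : SGen q N Q le) (p2P : p2 ∈ P) (p20 : lep le p2 p0) (p2q : Inq p2 q).

Lemma Gen0 p U : Ult U -> p ∈ P -> lep le p p2 -> Gen p U -> Gen p0 U.
Proof.
move=> HU pP pp2; apply: (Gen_mono _ _ HP _ HU p p0) => //; exact: (ptrans p p2 p0).
Qed.

Lemma hull_in_union x U (HU : Ult U) : x ∈ Q -> MM x -> Gen p0 U -> ck U x ∈ nm U R -> ck U x ∈ Un (nm U d).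
Proof.
move=> xQ Mx G xR; have [j Hj] := chx x xQ Mx; apply/in_Un; exists (nm U (ch j)); split; last exact: Hd1.
by apply: Hj => //; exact: Rh.
Qed.

(** Below [p] some [s2] makes [z] the [k]-th element of a term [ch i]. A trace on [N] of a common
    extension of [q] and [s2] lies below a [p'] in [MM] that decides the [k]-th element and is
    compatible with [s2]. That decision must be [z], and it can be found in [MM], hence in [N]. *)
Lemma union_in_trace p z : p ∈ P -> lep le p p2 -> z ∈ Q ->
  (forall U (HU : Ult U), Gen p U -> ck U z ∈ Un (nm U d)) -> z ∈ N.
Proof.
move=> pP pp2 zQ Hz.
have [s1 [i [s1P [s1p Hs1]]]] : exists s1 i, s1 ∈ P /\ lep le s1 p /\
    forall U (HU : Ult U), Gen s1 U -> ck U z ∈ nm U (ch i).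
  have [U [HU G]] := Gen_exists _ _ HP p pP.
  have [Y [zY Yd]] := proj1 (in_Un _ _) (Hz U HU G); have [y ey] := nm_surj _ _ _ Y; subst Y.
  have UA : uniform false 2 (fun X v => In (snd (fst v)) (snd v)) by unif.
  have [s1 [s1P [s1p [[i e] H]]]] := Gen_refine _ _ HP 2 _ (tt, chk z, y) U HU p _ UA pP G zY
    (Hd2 U HU (Gen0 p U HU pP pp2 G) y Yd).
  exists s1, i; do 2 (split=> //); move=> U' HU' G'.
  rewrite -(nm_Feq _ _ HP U' HU' s1 y (ch i) G' e); exact: (H U' HU' G').
have s1p2 := ptrans s1 p p2 s1P pP p2P s1p pp2.
have [s2 [k [s2P [s2s1 Hs2]]]] : exists s2 k, s2 ∈ P /\ lep le s2 s1 /\ nth_is (ff (ch i)) k s2 z.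
  have [U [HU G]] := Gen_exists _ _ HP s1 s1P; have G0 := Gen0 s1 U HU s1P s1p2 G.
  have [_ [H _]] := Hff (ch i) U HU G0 (chc i U HU G0).
  have [K [Kω [zK _]]] := H _ (Hs1 U HU G).
  have [k ek] := nm_surj _ _ _ K; subst K; rewrite (ck_ω _ _ HP U HU) in Kω.
  have UA : uniform false 3 (fun X v => pairIn (snd (fst (fst v))) (snd (fst v)) (snd v)) by unif.
  have S : forall U (HU : Ult U) (A B C : MU U), satG U HU (pairIn A B C) <-> opair A B ∈ C.
    by move=> *; unfold satU; sati.
  have [s2 [k' [s2P [s21 [/in_ω_num [j ej] Hs2]]]]] := decide_in_ck 3 _ (tt, chk z, k, ff (ch i)) U HU s1 k ω UA s1P G
    (proj2 (S U HU (ck U z) (nm U k) (nm U (ff (ch i)))) zK) Kω.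
  exists s2, j; do 2 (split=> //); move=> U' HU' G'; have [e H'] := Hs2 U' HU' G'.
  rewrite -ej -e; exact: (proj1 (S U' HU' (ck U' z) (nm U' k) (nm U' (ff (ch i)))) H').
have s2p2 := ptrans s2 s1 p2 s2P s1P p2P s2s1 s1p2.
have [s [sQ [sq ss2]]] := p2q s2 s2P s2p2.
(* Density of [B] in [N ∩ Q]: reduce [v] to a condition of [P], extend it inside [MM] to one that
   decides, and take the meet with [v]; the reduction guarantees compatibility. *)
pose (B := fun v => exists p', p' ∈ P /\ MM p' /\ lep le v p' /\
  ((exists a, a ∈ Q /\ nth_is (ff (ch i)) k p' a) \/
   forall s, s ∈ P -> lep le s p' -> forall a, a ∈ Q -> ~ nth_is (ff (ch i)) k s a)).
have [|v [vN [vQ [[p' [p'P [Mp' [vp' Hp']]]] Hv]]]] := SGen_trace Q le HQ B q N s I SG sQ sq.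
  move=> v vN vQ; have [t [tP [Mt tv]]] := Mred v vQ (NM v vN).
  have [p' [p'P [Mp' [p't Hp']]]] := Mdec k (ch i) t (chM i) Mt tP.
  have [g [Mg [gQ [gv [gp' _]]]]] := Mglb v p' (NM v vN) Mp' vQ (PQ _ p'P) (tv p' p'P p't).
  exists g; split; first exact: MN.
  by do 2 (split=> //); exists p'.
have [t [tQ [tv ts]]] : Cmp Q le v s.
  by apply: Hv => //; [exact: qrefl | exists p'].
have [s3 [s3P [s3p' s3s2]]] : Cmp P le p' s2.
  apply: cmpPQ => //; exists t; split=> //; split; [apply: (qtrans t v p') | apply: (qtrans t s s2)] => //; exact: PQ.
have nth_mono u u' a : u ∈ P -> u' ∈ P -> lep le u' u -> nth_is (ff (ch i)) k u a -> nth_is (ff (ch i)) k u' a.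
  by move=> H1 H2 H3 H U HU G; apply: H; exact: (Gen_mono _ _ HP _ HU u').
case: Hp' => [[a [aQ Ha]]|H]; last first.
  by case: (H s3 s3P s3p' z zQ); apply: (nth_mono s2).
have [a' [a'Q [Ma' Ha']]] := Mnth k (ch i) p' a (chM i) Mp' p'P aQ Ha.
have -> : z = a'; last exact: MN.
have [U [HU G]] := Gen_exists _ _ HP s3 s3P; have G0 : Gen p0 U.
  apply: (Gen0 s3) => //; exact: (ptrans s3 s2 p2).
have [_ [_ inj]] := Hff (ch i) U HU G0 (chc i U HU G0).
apply: (ck_inj _ _ HP U HU); apply: (inj _ _ (ck U (num k))).
- exact: (nth_mono s2 s3 z s2P s3P s3s2 Hs2 U HU G).
- exact: (nth_mono p' s3 a' p'P s3P s3p' Ha' U HU G).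
Qed.

Lemma union_strongly_generic U (HU : Ult U) : Gen p2 U -> SGen (ck U q) (Un (nm U d)) (nm U R) (ck U le).
Proof.
move=> G2.
have G0 U' : Ult U' -> Gen p2 U' -> Gen p0 U' by move=> HU' G'; apply: (Gen0 p2) => //; exact: prefl.
split; first exact: (proj2 (ck_R p2 q p2P p20 qQ) p2q U HU G2).
move=> D; have [d' ->] := nm_surj _ _ _ D => {D} HD S; have [s' ->] := nm_surj _ _ _ S => {S} SR Sq.
apply: NNPP => nE.
have [SQ _] := proj1 (HR U HU (G0 U HU G2) _) SR.
(* Everything that has to survive below [p3] is packed into one formula: the position of [s'], the
   density of [d'] in the trace of the union, and the supposed failure. *)
have UA : uniform false 6 (fun X v => And (In (snd v) (snd (fst (fst (fst v)))))
  (And (pairIn (snd v) (snd (fst (fst (fst (fst (fst v)))))) (snd (fst (fst (fst (fst v))))))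
  (And (Ex (fun u => And (isUnion u (snd (fst (fst v))))
     (denseInTrace (snd (fst v)) u (snd (fst (fst (fst v)))) (snd (fst (fst (fst (fst v))))))))
   (Not (Ex (fun w => And (In w (snd (fst v))) (compatible (snd (fst (fst (fst v))))
      (snd (fst (fst (fst (fst v))))) w (snd v)))))))) by unif.
have SA : forall U (HU : Ult U) (q' L R' d' D S : MU U), satG U HU (And (In S R') (And (pairIn S q' L)
  (And (Ex (fun u => And (isUnion u d') (denseInTrace D u R' L)))
   (Not (Ex (fun w => And (In w D) (compatible R' L w S))))))) <->
   S ∈ R' /\ lep L S q' /\ (exists u, (forall w, w ∈ u <-> exists n, n ∈ d' /\ w ∈ n) /\ DenseTr D u R' L) /\
   ~ exists w, w ∈ D /\ Cmp R' L w S.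
  by move=> *; unfold satU, isUnion, denseInTrace; sati.
have UnE U' (HU' : Ult U') (w : MU U') : w ∈ Un (nm U' d) <-> exists n, n ∈ nm U' d /\ w ∈ n.
  by rewrite in_Un; split=> -[n [? ?]]; exists n.
have [p3 [s [p3P [p32 [sQ K3]]]]] := decide_in_ck 6 _ (tt, chk q, chk le, R, d, d', s') U HU p2 s' Q UA p2P G2
  (proj2 (SA U HU (ck U q) (ck U le) (nm U R) (nm U d) (nm U d') (nm U s'))
    (conj SR (conj Sq (conj (ex_intro _ (Un (nm U d)) (conj (UnE U HU) HD)) nE)))) SQ.
have {}K3 : forall U (HU : Ult U), Gen p3 U -> ck U s ∈ nm U R /\ lep (ck U le) (ck U s) (ck U q) /\
    DenseTr (nm U d') (Un (nm U d)) (nm U R) (ck U le) /\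
    forall w, w ∈ nm U d' -> ~ Cmp (nm U R) (ck U le) w (ck U s).
  move=> U' HU' G'; have [e H] := K3 U' HU' G'.
  have [H1 [H2 [[u [Hu H3]] H4]]] := proj1 (SA U' HU' (ck U' q) (ck U' le) (nm U' R) (nm U' d) (nm U' d') (nm U' s')) H.
  rewrite -e; split; [exact: H1 | split; [exact: H2 | split]]; last by move=> w wd wC; apply: H4; exists w.
  have <- // : u = Un (nm U' d) by apply: ext => w; rewrite Hu (UnE U' HU').
have p30 : lep le p3 p0 by exact: (ptrans p3 p2 p0).
have Is : Inq p3 s by apply/ck_R => // U' HU' G'; case: (K3 U' HU' G').
have sq : lep le s q.
  have [U' [HU' G']] := Gen_exists _ _ HP p3 p3P.
  by have [_ [H _]] := K3 U' HU' G'; apply/(ck_lep _ _ HP U' HU').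
(* [t] remembers [p3] as well as [s], so the conditions of [P] found from its trace can be kept
   below [p3]. *)
have [t [tQ [ts tp3]]] := Is p3 p3P (prefl p3 p3P).
have [|v [vN [vQ [_ Hv]]]] := SGen_trace Q le HQ (fun _ => True) q N t I SG tQ (qtrans t s q tQ sQ qQ ts sq).
  by move=> v vN vQ; exists v; do 2 (split=> //); split=> //; exact: qrefl.
have [t' [t'Q [t'v t't]]] := Hv v vN vQ (qrefl v vQ) I.
(* A reduction [p'] of the common extension [t'] is compatible with [p3], since [t'] is below [p3].
   Any [p4] below both forces [v] into the quotient, since [t'] is below [v]. *)
have [p' [p'P It']] := red t' t'Q.
have [p4 [p4P [p4p' p43]]] : Cmp P le p' p3.
  have [u [uQ [ut' up']]] := It' p' p'P (prefl p' p'P).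
  apply: cmpPQ => //; exists u; split=> //; split=> //.
  have p3Q := PQ _ p3P; apply: (qtrans u t' p3) => //; exact: (qtrans t' t p3).
have p40 : lep le p4 p0 by exact: (ptrans p4 p3 p0).
have Iv : Inq p4 v.
  move=> u uP up4; have [w [wQ [wt' wu]]] := It' u uP (ptrans u p4 p' uP p4P p'P up4 p4p').
  by exists w; split=> //; split=> //; exact: (qtrans w t' v).
have [U4 [HU4 G4]] := Gen_exists _ _ HP p4 p4P.
have G40 := Gen_mono _ _ HP _ HU4 p4 p0 p4P p0P p40 G4.
have vR : ck U4 v ∈ nm U4 R by exact: (proj2 (ck_R p4 v p4P p40 vQ) Iv).
have vU := hull_in_union v U4 HU4 vQ (NM v vN) G40 vR.
have [_ [_ [[Dsub Ddense] _]]] := K3 U4 HU4 (Gen_mono _ _ HP _ HU4 p4 p3 p4P p3P p43 G4).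
have [X [XD Xv]] := Ddense _ vR vU; have [XU XR] := Dsub X XD.
have [x ex] := nm_surj _ _ _ X; subst X.
have UB : uniform false 6 (fun X v => And (In (snd v) (snd (fst (fst (fst v)))))
  (And (pairIn (snd v) (snd (fst (fst (fst (fst (fst v)))))) (snd (fst (fst (fst (fst v))))))
  (And (Ex (fun n => And (In n (snd (fst (fst v)))) (In (snd v) n))) (In (snd v) (snd (fst v)))))) by unif.
have SB : forall U (HU : Ult U) (v' L R' d' D X : MU U), satG U HU (And (In X R') (And (pairIn X v' L)
  (And (Ex (fun n => And (In n d') (In X n))) (In X D)))) <->
   X ∈ R' /\ lep L X v' /\ (exists n, n ∈ d' /\ X ∈ n) /\ X ∈ D.
  by move=> *; unfold satU; sati.
have XQ := proj1 (proj1 (HR U4 HU4 G40 _) XR).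
have [p5 [z [p5P [p54 [zQ K5]]]]] := decide_in_ck 6 _ (tt, chk v, chk le, R, d, d', x) U4 HU4 p4 x Q UB p4P G4
  (proj2 (SB U4 HU4 (ck U4 v) (ck U4 le) (nm U4 R) (nm U4 d) (nm U4 d') (nm U4 x))
    (conj XR (conj Xv (conj (proj1 (UnE U4 HU4 _) XU) XD)))) XQ.
have {}K5 : forall U (HU : Ult U), Gen p5 U -> ck U z ∈ nm U R /\ lep (ck U le) (ck U z) (ck U v) /\
    ck U z ∈ Un (nm U d) /\ ck U z ∈ nm U d'.
  move=> U' HU' G'; have [e H] := K5 U' HU' G'; rewrite -e.
  have [H1 [H2 [[n [nd xn]] H4]]] := proj1 (SB U' HU' (ck U' v) (ck U' le) (nm U' R) (nm U' d) (nm U' d') (nm U' x)) H.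
  by do 2 (split=> //); split=> //; apply/(UnE U' HU'); exists n.
have p53 : lep le p5 p3 by exact: (ptrans p5 p4 p3).
have p52 : lep le p5 p2 by exact: (ptrans p5 p3 p2).
have p50 : lep le p5 p0 by exact: (ptrans p5 p2 p0).
have zN : z ∈ N by apply: (union_in_trace p5) => // U' HU' G'; case: (K5 U' HU' G') => _ [_ []].
have [U5 [HU5 G5]] := Gen_exists _ _ HP p5 p5P.
have zv : lep le z v by have [_ [H _]] := K5 U5 HU5 G5; apply/(ck_lep _ _ HP U5 HU5).
(* [z] is in [N] and below [v], so the trace property makes it compatible with [t], and thus with
   [s]. *)
have [u [uQ [uz ut]]] := Hv z zN zQ zv I.
have zs : Cmp Q le z s by exists u; split=> //; split=> //; exact: (qtrans u t s).
have [g Hg] := glbQ z zQ s sQ zs.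
have [gQ [gz [gs _]]] := Hg.
have Iz : Inq p5 z by apply/ck_R => // U' HU' G'; case: (K5 U' HU' G').
have Ig : Inq p5 g.
  (* Each [w] below [p5] is compatible with [z] and with [s], so property [*] makes it compatible
     with their meet [g]. *)
  move=> w wP wp5; apply: Cmp_sym; apply: (star w wP z zQ s sQ _ _ zs g Hg); apply: Cmp_sym.
  - exact: Iz.
  - by apply: Is => //; exact: (ptrans w p5 p3).
have gR := proj2 (ck_R p5 g p5P p50 gQ) Ig U5 HU5 G5.
have [_ [_ [_ H]]] := K3 U5 HU5 (Gen_mono _ _ HP _ HU5 p5 p3 p5P p3P p53 G5).
have [_ [_ [_ zd]]] := K5 U5 HU5 G5.
apply: (H _ zd); exists (ck U5 g); split=> //.
by split; apply/(ck_lep _ _ HP U5 HU5).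
Qed.
End Trace.

Lemma stationarity : exists U (HU : Ult U), Gen p0 U /\ exists n, n ∈ nm U c /\ nm U r ∈ n /\
  exists X, X ∈ nm U R /\ lep (ck U le) X (nm U r) /\ SGen X n (nm U R) (ck U le).
Proof.
have [p1 [r1 [p1P [p10 [r1Q [Ir1 Er1]]]]]] := decide_condition.
have [n0 Hn0] := initial_name.
have [bf Hbf] := fchoice _ (fun ny : V * V => extend_name (fst ny) (snd ny)).
have [ff Hff] := fchoice _ injection_name.
have [|gl Hgl] := fchoice (fun (u : V * V) g => fst u ∈ Q -> snd u ∈ Q -> Cmp Q le (fst u) (snd u) ->
    Glb Q le g (fst u) (snd u)).
  move=> [x y]; case: (classic (x ∈ Q /\ y ∈ Q /\ Cmp Q le x y)) => [[xQ [yQ C]]|H]; last by exists x; tauto.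
  by have [g Hg] := glbQ x xQ y yQ C; exists g.
have [|rd Hrd] := fchoice (fun x p => x ∈ Q -> p ∈ P /\ Inq p x).
  move=> x; case: (classic (x ∈ Q)) => [/red [p Hp]|H]; last by exists x; tauto.
  by exists p.
have [|dc Hdc] := fchoice (fun (u : nat * (V * V)) p' => snd (snd u) ∈ P -> p' ∈ P /\ lep le p' (snd (snd u)) /\
   ((exists a, a ∈ Q /\ nth_is (ff (fst (snd u))) (fst u) p' a) \/
   forall s, s ∈ P -> lep le s p' -> forall a, a ∈ Q -> ~ nth_is (ff (fst (snd u))) (fst u) s a)).
  move=> [k [y p]]; cbn [fst snd]; case: (classic (exists s, s ∈ P /\ lep le s p /\ exists a, a ∈ Q /\ nth_is (ff y) k s a)).
    by move=> [s [sP [sp H]]]; exists s => pP; do 2 (split=> //); left.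
  move=> H; exists p => pP; split=> //; split; first exact: prefl.
  by right=> s sP sp a aQ K; apply: H; exists s; split=> //; split=> //; exists a.
have [|dz Hdz] := fchoice (fun (u : nat * (V * V)) a => (exists a, a ∈ Q /\ nth_is (ff (fst (snd u))) (fst u) (snd (snd u)) a) ->
   a ∈ Q /\ nth_is (ff (fst (snd u))) (fst u) (snd (snd u)) a).
  move=> u; case: (classic (exists a, a ∈ Q /\ nth_is (ff (fst (snd u))) (fst u) (snd (snd u)) a)) => [[a Ha]|H].
    by exists a.
  by exists (fst (snd u)).
(* All closure functions are coded as binary operations indexed by [nat]; from 6 on the index
   encodes [(k, 0)] for deciding the [k]-th element and [(k, 1)] for reading off the decision. *)
pose (op := fun (i : nat) (x y : V) => match i with
  | 0 => bf (x, y) | 1 => gl (x, y) | 2 => rd x | 3 => chk x | 4 => n0 | 5 => r1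
  | S (S (S (S (S (S j))))) => match of_nat j with (k, 0) => dc (k, (x, y)) | (k, S _) => dz (k, (x, y)) end
  end).
have op_dc k x y : op (6 + to_nat (k, 0)) x y = dc (k, (x, y)) by unfold op; cbn [Nat.add]; rewrite cancel_of_to.
have op_dz k x y : op (6 + to_nat (k, 1)) x y = dz (k, (x, y)) by unfold op; cbn [Nat.add]; rewrite cancel_of_to.
(* [w] lies below both [r1] and [p1], so a generic condition below [w] extends [r1] and its
   reduction is compatible with [p1]. *)
have [w [wQ [wr wp]]] := Ir1 p1 p1P (prefl p1 p1P).
have [C [HC clC]] := Hull_club op h0.
have [N [NC [[_ CN] [wN [q [qQ [qw SG]]]]]]] := stat w wQ C HC.
have clN := clC N NC.
have [e He] := Hull_enum op N (ex_intro _ w wN) CN.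
have Hw : Hull op N w by exact: Hull_in.
have Hop i x y : Hull op N x -> Hull op N y -> Hull op N (op i x y) by exact: Hull_op.
have [p' [p'P Ip']] := red q qQ.
have [p2 [p2P [p2p' p21]]] : Cmp P le p' p1.
  have [t [tQ [tq tp']]] := Ip' p' p'P (prefl p' p'P).
  apply: cmpPQ => //; exists t; split=> //; split=> //.
  have p1Q := PQ _ p1P; apply: (qtrans t q p1) => //; exact: (qtrans q w p1).
have p20 : lep le p2 p0 by exact: (ptrans p2 p1 p0).
have p2q := Inq_mono p' p2 q p'P p2P p2p' Ip'.
(* Bookkeeping: [e] enumerates the whole hull, and term [i + 1] absorbs [e i]. Operation 3 puts
   [chk x] into the hull, so each condition of the hull that lies in [h] is absorbed at some
   stage. *)
pose (ch := fix ch (i : nat) := match i with 0 => n0 | S i => bf (ch i, e i) end).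
have chM i : Hull op N (ch i).
  elim: i => [|i IH]; first exact: (Hop 4 w w).
  by apply: (Hop 0 (ch i) (e i)) => //; apply/He; exists i.
have chc i U (HU : Ult U) : Gen p0 U -> nm U (ch i) ∈ nm U c.
  move=> G; elim: i => [|i IH]; first exact: Hn0.
  by case: (Hbf (ch i, e i) U HU G IH).
have chS U (HU : Ult U) : Gen p0 U -> forall i, Sub (nm U (ch i)) (nm U (ch (S i))).
  by move=> G i; have [_ []] := Hbf (ch i, e i) U HU G (chc i U HU G).
have chx x : x ∈ Q -> Hull op N x -> exists j, forall U (HU : Ult U), Gen p0 U -> ck U x ∈ nm U h ->
    ck U x ∈ nm U (ch j).
  move=> xQ Hx; have [j ej] := proj1 (He (chk x)) (Hop 3 x x Hx Hx).
  exists (S j) => U HU G xh; have [_ [_ H]] := Hbf (ch j, e j) U HU G (chc j U HU G).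
  move: xh; rewrite /ck -ej; exact: H.
have [d Hd] := chain_name P le HP ch p0 c h p0P chS (fun U HU G => conj (Hc U HU G) (fun i => chc i U HU G)).
have MN x : x ∈ Q -> Hull op N x -> x ∈ N by move=> xQ; apply: clN; exact: Qh0.
have Hr1 : Hull op N r1 by exact: (Hop 5 w w).
have [U [HU G2]] := Gen_exists _ _ HP p2 p2P.
have G0 := Gen_mono _ _ HP _ HU p2 p0 p2P p0P p20 G2.
have er := Er1 U HU (Gen_mono _ _ HP _ HU p2 p1 p2P p1P p21 G2).
have [Hd1 [Hd2 Hd3]] := Hd U HU G0.
exists U, HU; split=> //; exists (Un (nm U d)); split=> //; split.
  rewrite er; apply/in_Un; have [j Hj] := chx r1 r1Q Hr1; exists (nm U (ch j)); split=> //.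
  by apply: Hj => //; rewrite -er; apply: Rh => //; exact: rR.
exists (ck U q); split; first exact: (proj2 (ck_R p2 q p2P p20 qQ) p2q U HU G2).
split; first by rewrite er; apply/(ck_lep _ _ HP U HU); exact: (qtrans q w r1).
apply: (union_strongly_generic ff Hff (Hull op N) N _ MN _ _ _ _ ch chM chc chx d _ _ q p2 qQ SG p2P p20 p2q U HU G2).
- by move=> x; exact: Hull_in.
- move=> x y Hx Hy xQ yQ xy; exists (gl (x, y)); split; first exact: (Hop 1 x y).
  exact: Hgl.
- move=> x xQ Hx; have [H1 H2] := Hrd x xQ; exists (rd x); split=> //; split=> //; exact: (Hop 2 x x).
- move=> k y p Hy Hp pP; have [H1 [H2 H3]] := Hdc (k, (y, p)) pP.
  exists (dc (k, (y, p))); split=> //; split=> //; rewrite -op_dc; exact: Hop.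
- move=> k y p a Hy Hp pP aQ Ha; have [|H1 H2] := Hdz (k, (y, p)); first by exists a.
  exists (dz (k, (y, p))); split=> //; split=> //; rewrite -op_dz; exact: Hop.
- by move=> U' HU' G' i; case: (Hd U' HU' G').
- by move=> U' HU' G'; case: (Hd U' HU' G') => _ [].
Qed.
End Stationarity.

(** * Strong properness of the quotient in every extension *)

Section QuotientProper.
Context (P Q le : V) (HP : Poset P le) (HQ : Poset Q le) (PQ : Sub P Q).
Notation MU := (MU P le).
Notation nm := (nm P le).
Notation ck := (ck P le).
Notation chk := (chk P).
Notation Gen := (Gen P le).
Notation Ult := (Ult P le).
Notation satG := (satU P le HP).
Notation GenName := (GenName P).
Notation Inq := (Inq P Q le).
#[local] Hint Extern 0 (Model (MU ?U)) =>
  (match goal with HU : Ult U |- _ => exact (MUModel P le HP U HU) end) : typeclass_instances.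

Lemma ck_le_refl U (HU : Ult U) X : X ∈ ck U Q -> lep (ck U le) X X.
Proof.
move=> XQ.
have UA : uniform false 2 (fun X v => pairIn (snd v) (snd v) (snd (fst v))) by unif.
have S : forall U (HU : Ult U) (L X : MU U), satG U HU (pairIn X X L) <-> lep L X X.
  by move=> *; unfold satU; sati.
refine (proj1 (S U HU (ck U le) X) (ck_all _ _ HP 1 _ (tt, chk le) Q UA _ U HU X XQ)) => z zQ U' HU'.
apply: (proj2 (S U' HU' (ck U' le) (ck U' z))); apply/(ck_lep _ _ HP U' HU'); exact: (lep_refl _ _ HQ).
Qed.

Lemma ck_le_trans U (HU : Ult U) X Y Z : X ∈ ck U Q -> Y ∈ ck U Q -> Z ∈ ck U Q ->
  lep (ck U le) X Y -> lep (ck U le) Y Z -> lep (ck U le) X Z.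
Proof.
have U3 : uniform false 4 (fun X v => Imp (pairIn (snd (fst (fst v))) (snd (fst v)) (snd (fst (fst (fst v)))))
  (Imp (pairIn (snd (fst v)) (snd v) (snd (fst (fst (fst v)))))
     (pairIn (snd (fst (fst v))) (snd v) (snd (fst (fst (fst v))))))) by unif.
have U2 : uniform false 4 (fun X v => All (fun z => Imp (In z (snd (fst (fst v))))
  (Imp (pairIn (snd (fst v)) (snd v) (snd (fst (fst (fst v)))))
  (Imp (pairIn (snd v) z (snd (fst (fst (fst v)))))
     (pairIn (snd (fst v)) z (snd (fst (fst (fst v))))))))) by unif.
have U1 : uniform false 3 (fun X v => All (fun y => Imp (In y (snd (fst v)))
  (All (fun z => Imp (In z (snd (fst v)))
  (Imp (pairIn (snd v) y (snd (fst (fst v))))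
  (Imp (pairIn y z (snd (fst (fst v))))
     (pairIn (snd v) z (snd (fst (fst v)))))))))) by unif.
have S3 : forall U (HU : Ult U) (L X Y Z : MU U), satG U HU (Imp (pairIn X Y L) (Imp (pairIn Y Z L) (pairIn X Z L))) <->
  (lep L X Y -> lep L Y Z -> lep L X Z) by move=> *; unfold satU; sati.
have S2 : forall U (HU : Ult U) (L Q' X Y : MU U), satG U HU (All (fun Z => Imp (In Z Q')
    (Imp (pairIn X Y L) (Imp (pairIn Y Z L) (pairIn X Z L))))) <->
  forall Z, Z ∈ Q' -> lep L X Y -> lep L Y Z -> lep L X Z by move=> *; unfold satU; sati.
have S1 : forall U (HU : Ult U) (L Q' X : MU U), satG U HU (All (fun Y => Imp (In Y Q') (All (fun Z => Imp (In Z Q')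
    (Imp (pairIn X Y L) (Imp (pairIn Y Z L) (pairIn X Z L))))))) <->
  forall Y, Y ∈ Q' -> forall Z, Z ∈ Q' -> lep L X Y -> lep L Y Z -> lep L X Z by move=> *; unfold satU; sati.
move=> XQ YQ ZQ.
(* [ck_all] turns one element into a check name and then changes the ultrafilter, so the three
   variables are treated in turn, each with its own formula. *)
refine (proj1 (S1 U HU (ck U le) (ck U Q) X) (ck_all _ _ HP 2 _ (tt, chk le, chk Q) Q U1 _ U HU X XQ) Y YQ Z ZQ)
  => {U HU X Y Z XQ YQ ZQ} x xQ U HU.
apply: (proj2 (S1 U HU (ck U le) (ck U Q) (ck U x))) => Y YQ.
refine (proj1 (S2 U HU (ck U le) (ck U Q) (ck U x) Y) (ck_all _ _ HP 3 _ (tt, chk le, chk Q, chk x) Q U2 _ U HU Y YQ))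
  => {U HU Y YQ} y yQ U HU.
apply: (proj2 (S2 U HU (ck U le) (ck U Q) (ck U x) (ck U y))) => Z ZQ.
refine (proj1 (S3 U HU (ck U le) (ck U x) (ck U y) Z) (ck_all _ _ HP 3 _ (tt, chk le, chk x, chk y) Q U3 _ U HU Z ZQ))
  => {U HU Z ZQ} z zQ U HU.
apply: (proj2 (S3 U HU (ck U le) (ck U x) (ck U y) (ck U z))).
move=> /(ck_lep _ _ HP U HU) xy /(ck_lep _ _ HP U HU) yz; apply/(ck_lep _ _ HP U HU).
exact: (lep_trans _ _ HQ x y z).
Qed.

Context (cmpPQ : forall p, p ∈ P -> forall q, q ∈ P -> Cmp Q le p q -> Cmp P le p q).
Context (red : forall q, q ∈ Q -> exists p, p ∈ P /\ Inq p q).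
Context (glbQ : forall p, p ∈ Q -> forall q, q ∈ Q -> Cmp Q le p q -> exists r, Glb Q le r p q).
Context (star : forall x, x ∈ P -> forall y, y ∈ Q -> forall z, z ∈ Q ->
  Cmp Q le x y -> Cmp Q le x z -> Cmp Q le y z -> forall w, Glb Q le w y z -> Cmp Q le x w).
Context (h0 : V) (Qh0 : Sub Q h0).
Context (stat : forall p, p ∈ Q -> forall C, Club C h0 -> exists n, n ∈ C /\ Pw1 h0 n /\ p ∈ n /\
    exists q, q ∈ Q /\ lep le q p /\ SGen q n Q le).

(** [stationarity] supplies an ultrafilter of its own. A failure at [U] is therefore first expressed
    as one formula, then forced by some [p0], and contradicted at the ultrafilter below [p0] so
    obtained. *)
Lemma quotient_stationary U (HU : Ult U) (R h r c : MU U) :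
  (forall X, X ∈ R <-> X ∈ ck U Q /\ forall Y, Y ∈ nm U GenName -> Cmp (ck U Q) (ck U le) X Y) ->
  Sub R h -> r ∈ R -> Club c h ->
  exists n, n ∈ c /\ Pw1 h n /\ r ∈ n /\ exists X, X ∈ R /\ lep (ck U le) X r /\ SGen X n R (ck U le).
Proof.
have [R' ->] := nm_surj _ _ _ R; have [h' ->] := nm_surj _ _ _ h.
have [r' ->] := nm_surj _ _ _ r; have [c' ->] := nm_surj _ _ _ c.
move=> HR Rh rR Hc; apply: NNPP => nE.
have UA : uniform false 7 (fun X v =>
  And (isQuotient (snd (fst (fst (fst v)))) (snd (fst (fst (fst (fst (fst (fst v)))))))
     (snd (fst (fst (fst (fst (fst v)))))) (snd (fst (fst (fst (fst v))))))
  (And (sub (snd (fst (fst (fst v)))) (snd (fst (fst v))))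
  (And (In (snd (fst v)) (snd (fst (fst (fst v)))))
  (And (isClub (snd v) (snd (fst (fst v))))
  (Not (Ex (fun n => And (In n (snd v)) (And (In (snd (fst v)) n) (Ex (fun x =>
     And (In x (snd (fst (fst (fst v))))) (And (pairIn x (snd (fst v)) (snd (fst (fst (fst (fst (fst v)))))))
       (stronglyGeneric x n (snd (fst (fst (fst v)))) (snd (fst (fst (fst (fst (fst v)))))))))))))))))) by unif.
have S : forall U (HU : Ult U) (Q' L G R h r c : MU U), satG U HU
    (And (isQuotient R Q' L G) (And (sub R h) (And (In r R) (And (isClub c h)
    (Not (Ex (fun n => And (In n c) (And (In r n) (Ex (fun x =>
       And (In x R) (And (pairIn x r L) (stronglyGeneric x n R L)))))))))))) <->
   (forall X, X ∈ R <-> X ∈ Q' /\ forall Y, Y ∈ G -> Cmp Q' L X Y) /\ Sub R h /\ r ∈ R /\ Club c h /\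
   ~ exists n, n ∈ c /\ r ∈ n /\ exists X, X ∈ R /\ lep L X r /\ SGen X n R L.
  by move=> *; unfold satU; sati.
have nE' : ~ exists n, n ∈ nm U c' /\ nm U r' ∈ n /\ exists X, X ∈ nm U R' /\ lep (ck U le) X (nm U r') /\
    SGen X n (nm U R') (ck U le).
  by move=> [n [nc K]]; apply: nE; exists n; split=> //; split=> //; exact: (proj1 Hc).
have H : satG U HU _ := proj2 (S U HU (ck U Q) (ck U le) (nm U GenName) (nm U R') (nm U h') (nm U r') (nm U c'))
  (conj HR (conj Rh (conj rR (conj Hc nE')))).
have T := proj1 (losU _ _ HP 7 _ U HU (tt, chk Q, chk le, GenName, R', h', r', c') UA) H.
have [p0 [p0P F]] := Tv_ex _ _ _ HU _ T.
have {H T}K U' (HU' : Ult U') (G : Gen p0 U') := proj1 (S U' HU' (ck U' Q) (ck U' le) (nm U' GenName) (nm U' R')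
  (nm U' h') (nm U' r') (nm U' c')) (proj1 (complete _ _ HP 7 _ (tt, chk Q, chk le, GenName, R', h', r', c') p0 UA p0P) F U' HU' G).
have [||||U' [HU' [G [n Hn]]]] := stationarity P Q le HP HQ PQ cmpPQ red glbQ star h0 Qh0 stat p0 p0P R' h' r' c'.
- by move=> U' HU' G; case: (K U' HU' G).
- by move=> U' HU' G; case: (K U' HU' G) => _ [].
- by move=> U' HU' G; case: (K U' HU' G) => _ [_ []].
- by move=> U' HU' G; case: (K U' HU' G) => _ [_ [_ []]].
- by case: (K U' HU' G) => _ [_ [_ [_ nK]]]; apply: nK; exists n.
Qed.

Lemma quotient_nonDiag U (HU : Ult U) p : p ∈ P -> Gen p U -> exists R : MU U,
  satG U HU (isQuotient R (ck U Q) (ck U le) (nm U GenName)) /\ satG U HU (nonDiagStronglyProper R (ck U le)).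
Proof.
move=> pP G; pose (R := sep (ck U Q) (fun X => forall Y, Y ∈ nm U GenName -> Cmp (ck U Q) (ck U le) X Y)).
have HR X : X ∈ R <-> X ∈ ck U Q /\ forall Y, Y ∈ nm U GenName -> Cmp (ck U Q) (ck U le) X Y.
  exact: in_sep.
exists R; split; first by apply/(sat_isQuotient (HM := MUModel P le HP U HU)).
apply/(sat_nonDiag (HM := MUModel P le HP U HU)); split.
  split; [|split].
  - exists (ck U p); apply/HR; split; first by apply/(ck_mem _ _ HP U HU); exact: PQ.
    apply: (proj2 (quotient_ck P Q le HP p p pP PQ HQ)) => // p' p'P p'p.
    by exists p'; split; [exact: PQ | split=> //; exact: (lep_refl _ _ HP)].
  - by move=> X /HR [XQ _]; exact: ck_le_refl.
  - by move=> X Y Z /HR [XQ _] /HR [YQ _] /HR [ZQ _] XY YZ; exact: (ck_le_trans U HU X Y Z XQ YQ ZQ XY YZ).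
have [l Hl] := Lam_exists R; have [h Hh] := H_exists l.
exists l, h; split=> //; split=> // r rR c Hc; apply: (quotient_stationary U HU R h r c HR _ rR Hc).
by move=> X XR; apply/Hh; case: Hl => [[_ [_ H]] _]; exact: H.
Qed.
End QuotientProper.

Lemma sat_quotientForced (phi : forall X, X -> X -> fm X) (P Q le : V) :
  uniform false 2 (fun X r => phi X (snd (fst r)) (snd r)) -> forall HP : Poset P le,
  (forall p, p ∈ P -> forall U (HU : Ult P le U), Gen P le p U -> exists R : MU P le U,
     satU P le HP U HU (isQuotient R (ck P le U Q) (ck P le U le) (nm P le U (GenName P))) /\
     satU P le HP U HU (phi _ R (ck P le U le))) ->
  sat (quotientForced P Q le (phi V)).
Proof.
move=> Hphi HP H.
have S : sat (quotientForced P Q le (phi V)) <-> exists Qc lec G, sat (isCheck P Q Qc) /\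
    sat (isCheck P le lec) /\ sat (isGenericName P G) /\
    sat (forced P le (Ex (fun R => And (isQuotient R Qc lec G) (phi V R lec)))).
  by unfold quotientForced; sati.
apply/S; exists (chk P Q), (chk P le), (GenName P).
split; first exact/sat_isCheck.
split; first exact/sat_isCheck.
split.
  have SG : sat (isGenericName P (GenName P)) <-> forall u, u ∈ GenName P <->
      exists p, p ∈ P /\ exists c, sat (isCheck P p c) /\ u = opair c p.
    by unfold isGenericName; sati.
  apply/SG => u; rewrite in_repl; split.
    by move=> [p [pP ->]]; exists p; split=> //; exists (chk P p); split=> //; exact/sat_isCheck.
  by move=> [p [pP [c [/sat_isCheck -> ->]]]]; exists p.
unfold forced.
apply/SI_All => [p|]; first (eapply SI_Imp; [apply: SI_In | reflexivity]).
move=> p pP; apply/sat_force => //.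
have [UA _] := u_quotientForced phi Hphi.
apply: (proj2 (complete P le HP 3 _ (tt, chk P Q, chk P le, GenName P) p UA pP)) => U HU G.
have [R [H1 H2]] := H p pP U HU G.
by move=> K; exact: (K R (conj H1 H2)).
Qed.

(** * From the hypotheses in the universe to forced statements about the quotient *)

Section Universe.
Context (P Q le : V) (HQ : Poset Q le).
Context (glbQ : forall p, p ∈ Q -> forall q, q ∈ Q -> Cmp Q le p q -> exists r, Glb Q le r p q).
Context (properQ : sat (nonDiagStronglyProper Q le)) (regP : sat (regularSuborder P Q le)).
Context (starPQ : sat (starProperty P Q le)).

(** With [phi] ranging over consequences of strong properness valid in all models, both conclusions
    of the theorem come from the same argument: the second through [sat_nonDiag_approx], applied
    inside the extension. *)
Lemma quotient_forced (phi : forall X, X -> X -> fm X) :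
  uniform false 2 (fun X r => phi X (snd (fst r)) (snd r)) ->
  (forall M (HM : Model M) R L, sat (nonDiagStronglyProper R L) -> sat (phi M R L)) ->
  sat (quotientForced P Q le (phi V)).
Proof.
move=> Hphi imp.
have [_ [l [h [[[_ [_ Ql]] _] [Hh stat]]]]] := proj1 (sat_nonDiag _ _) properQ.
have SR : sat (regularSuborder P Q le) <-> Sub P Q /\
    (forall p, p ∈ P -> forall q, q ∈ P -> Cmp Q le p q -> Cmp P le p q) /\
    forall a, sat (maximalAntichain a P le) -> sat (maximalAntichain a Q le).
  unfold regularSuborder; eapply SI_And; [sati | eapply SI_And; [sati|]].
  by apply: SI_All => a; eapply SI_Imp; reflexivity.
have SS : sat (starProperty P Q le) <-> forall x, x ∈ P -> forall y, y ∈ Q -> forall z, z ∈ Q ->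
    Cmp Q le x y -> Cmp Q le x z -> Cmp Q le y z -> forall w, Glb Q le w y z -> Cmp Q le x w.
  by unfold starProperty; sati.
have [PQ [cmpPQ maxPQ]] := proj1 SR regP; have star := proj1 SS starPQ.
have {}maxPQ a Ha := proj2 (proj1 (sat_maximalAntichain a Q le) (maxPQ a (proj2 (sat_maximalAntichain a P le) Ha))).
have HP : Poset P le.
  split; [|split].
  (* If [P] were empty, the empty set would be a maximal antichain of [P], hence of [Q], although
     [{q}] is a larger antichain. *)
  - apply: NNPP => nP; have [q qQ] := proj1 HQ; case: (in_emp q).
    apply: (maxPQ emp _ (pair q q)); last by apply/in_pair; left.
    + split; first by split=> x xe; case: (in_emp x xe).
      by move=> b [bP _] _ x /bP xP; case: nP; exists x.
    + split; first by move=> x /in_pair [->|->].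
      by move=> x /in_pair xq y /in_pair yq ne; case: ne; case: xq; case: yq => -> ->.
    + by move=> x xe; case: (in_emp x xe).
  - by move=> p /PQ; exact: (lep_refl _ _ HQ).
  - by move=> p q r /PQ pQ /PQ qQ /PQ rQ; exact: (lep_trans _ _ HQ).
have red := reduction P Q le HP HQ PQ cmpPQ maxPQ.
apply: (sat_quotientForced phi P Q le Hphi HP) => p pP U HU G.
have Qh : Sub Q h by move=> q /Ql /Hh.
have [R [H1 H2]] := quotient_nonDiag P Q le HP HQ PQ cmpPQ red glbQ star h Qh stat U HU p pP G.
by exists R; split=> //; exact: (imp _ (MUModel P le HP U HU) _ _ H2).
Qed.
End Universe.

Theorem theorem4p6 (P Q le : ZF)
  (posetQ : holds (forcingPoset Q le))
  (glbQ : holds (hasGlbs Q le))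
  (properQ : holds (nonDiagStronglyProper Q le))
  (regP : holds (regularSuborder P Q le))
  (starPQ : holds (starProperty P Q le)) :
  holds (quotientForced P Q le nonDiagStronglyProper) /\
  holds (quotientForced P Q le ω1Approximation).
Proof.
have Up : uniform false 2 (fun X r => forcingPoset (snd (fst r)) (snd r)) by unif.
have Ug : uniform false 2 (fun X r => hasGlbs (snd (fst r)) (snd r)) by unif.
have Un : uniform false 2 (fun X r => nonDiagStronglyProper (snd (fst r)) (snd r)).
  by apply: (u_nonDiagStronglyProper 2 (fun X r => snd (fst r)) (fun X r => snd r)); pv.
have Ua : uniform false 2 (fun X r => ω1Approximation (snd (fst r)) (snd r)).
  by apply: (u_ω1Approximation 2 (fun X r => snd (fst r)) (fun X r => snd r)); pv.
have Ur : uniform false 3 (fun X r => regularSuborder (snd (fst (fst r))) (snd (fst r)) (snd r)) by unif.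
have Us : uniform false 3 (fun X r => starProperty (snd (fst (fst r))) (snd (fst r)) (snd r)) by unif.
have HQ := proj1 (sat_forcingPoset _ _) (proj1 (holds_sat 2 _ (tt, Q, le) Up) posetQ).
have Hg := proj1 (sat_hasGlbs _ _) (proj1 (holds_sat 2 _ (tt, Q, le) Ug) glbQ).
have Hn := proj1 (holds_sat 2 _ (tt, Q, le) Un) properQ.
have Hr := proj1 (holds_sat 3 _ (tt, P, Q, le) Ur) regP.
have Hs := proj1 (holds_sat 3 _ (tt, P, Q, le) Us) starPQ.
have [_ UQn] := u_quotientForced (fun X => nonDiagStronglyProper) Un.
have [_ UQa] := u_quotientForced (fun X => ω1Approximation) Ua.
have K := quotient_forced (cl P) (cl Q) (cl le) HQ Hg Hn Hr Hs; split.
- by apply/(holds_sat 3 _ (tt, P, Q, le) UQn); exact: (K (fun X => nonDiagStronglyProper) Un).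
- apply/(holds_sat 3 _ (tt, P, Q, le) UQa); apply: (K (fun X => ω1Approximation) Ua).
  by move=> M HM R L; exact: sat_nonDiag_approx.
Qed.
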